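(* In the generalized-regression setting described in the context, let $\theta_0=\mathrm{E}[m(W,\gamma_0)]$ and let $\hat\theta,\hat V$ be the cross-fitted estimators given there, built from learners $\hat\gamma_\ell,\hat\alpha_\ell$, $\ell=1,\dots,L$. Suppose: (1) for some $M>0$, $\mathrm{E}[m(W,\alpha)^2]\le M\|\alpha\|^2$ for all $\alpha\in\Gamma$; (2) for each $\ell$: (i) $\|\hat\gamma_\ell-\gamma_0\|\overset{p}{\to}0$ and $\|\hat\alpha_\ell-\alpha_0\|\overset{p}{\to}0$; (ii) $\sqrt n\,\|\hat\gamma_\ell-\gamma_0\|\,\|\hat\alpha_\ell-\alpha_0\|\overset{p}{\to}0$; (iii) $\hat\alpha_\ell(X)$ is bounded; (3) (i) $\alpha_0(X)$ and $\mathrm{E}[\rho(W,\gamma_0)^2\mid X]$ are bounded and $\mathrm{E}[m(W,\gamma_0)^2]<\infty$; (ii) $\mathrm{E}[\{\rho(W,\gamma)-\rho(W,\gamma_0)\}^2]\to0$ if $\|\gamma-\gamma_0\|\to0$; (iii) there is $C>0$ such that for all $\|\gamma-\gamma_0\|$ small enough, $\mathrm{E}[\{\bar\rho(X,\gamma)-\bar\rho(X,\gamma_0)\}^2]\le C\|\gamma-\gamma_0\|^2$, where $\bar\rho(X,\gamma)=\mathrm{E}[\rho(W,\gamma)\mid X]$; (4) either $\rho(W,\gamma)$ is affine in $\gamma$, or $n^{1/4}\|\hat\gamma_\ell-\gamma_0\|\overset{p}{\to}0$ for each $\ell$ and there are $C,\varepsilon>0$ such that $$|\mathrm{E}[m(W,\gamma)-\theta_0+\alpha_0(X)\rho(W,\gamma)]|\le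 C\|\gamma-\gamma_0\|^2\quad\text{whenever }\|\gamma-\gamma_0\|^2\le\varepsilon.$$ Then $$\sqrt n(\hat\theta-\theta_0)\overset{d}{\to}N(0,V)\quad\text{and}\quad\hat V\overset{p}{\to}V,$$ where $V=\mathrm{E}[\{m(W,\gamma_0)-\theta_0+\alpha_0(X)\rho(W,\gamma_0)\}^2]$.
   Context: $W_1,\dots,W_n$ are i.i.d. copies of $W$ (CDF $F_0$), which includes an outcome $Y$ and regressors $X$. $\Gamma$ is a closed linear subspace of $L^2(X)$. The generalized regression $\gamma_0\in\Gamma$ satisfies $\mathrm{E}[\rho(W,\gamma_0)b(X)]=0$ for all $b\in\Gamma$, where $\rho(W,\gamma)$ is a generalized residual. $m(w,\gamma)$ is a functional, linear in $\gamma$, with $\gamma\mapsto\mathrm{E}[m(W,\gamma)]$ mean-square continuous on $\Gamma$, and $v_m$ (with $\mathrm{E}[v_m(X)^2]<\infty$) satisfies $\mathrm{E}[m(W,\gamma)]=\mathrm{E}[v_m(X)\gamma(X)]$ for all $\gamma\in\Gamma$. For scalar $a$, $v_\rho(X)=\frac{\partial}{\partial a}\mathrm{E}[\rho(W,\gamma_0+a)\mid X]\big|_{a=0}$ is assumed to exist and, by sign normalization of $\rho$, to satisfy $v_\rho(X)\le0$. The function $\alpha_0\in\Gamma$ is $$\alpha_0=\arg\min_{\alpha\in\Gamma}\mathrm{E}[-2m(W,\alpha)-v_\rho(X)\alpha(X)^2],$$ whose first-order condition is the Neyman orthogonality condition: for all $\delta\in\Gamma$, $$\frac{\partial}{\partial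 r}\mathrm{E}[m(W,\gamma_0+r\delta)-\theta_0+\alpha_0(X)\rho(W,\gamma_0+r\delta)]\Big|_{r=0}=\mathrm{E}[\{v_m(X)+\alpha_0(X)v_\rho(X)\}\delta(X)]=0.$$ $\|a\|=\sqrt{\mathrm{E}[a(W)^2]}$; for a data-dependent function the expectation is over a fresh draw of $W$ with the function held fixed. Functions $\gamma$ in the hypotheses range over $\Gamma$. Boundedness of $\hat\alpha_\ell(X)$ means by a constant not depending on $n$. Cross-fitting: the indices $\{1,\dots,n\}$ are partitioned into $L$ (fixed) disjoint subsets $I_1,\dots,I_L$ of about equal size. For each $\ell$, $\hat\gamma_\ell\in\Gamma$ (a learner of $\gamma_0$) and $\hat\alpha_\ell\in\Gamma$ (a learner of $\alpha_0$) are computed using only observations not in $I_\ell$. The estimators are $$\hat\theta=\frac1n\sum_{\ell=1}^L\sum_{i\in I_\ell}\{m(W_i,\hat\gamma_\ell)+\hat\alpha_\ell(X_i)\rho(W_i,\hat\gamma_\ell)\},$$ $$\hat V=\frac1n\sum_{\ell=1}^L\sum_{i\in I_\ell}\{m(W_i,\hat\gamma_\ell)-\hat\theta+\hat\alpha_\ell(X_i)\rho(W_i,\hat\gamma_\ell)\}^2.$$ *)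

(* Defs.v *)
From HB Require Import structures.
From mathcomp Require Import all_boot all_order all_algebra.
From mathcomp Require Import finmap.
From mathcomp Require Import all_classical all_reals all_analysis.

Set Implicit Arguments.
Unset Strict Implicit.
Unset Printing Implicit Defensive.

Import Order.TTheory GRing.Theory Num.Theory.
Import numFieldNormedType.Exports.

Local Open Scope classical_set_scope.
Local Open Scope ring_scope.

Section probability_notions.
Context {R : realType}.

Definition l2norm d (T : measurableType d) (P : probability T R) (a : T -> R) : R :=
  Num.sqrt (fine 'E_P[fun w => a w ^+ 2]).

Definition mutually_independent d dW (Omega : measurableType d)
    (TW : measurableType dW) (P : probability Omega R)
    (W : nat -> Omega -> TW) : Prop :=
  forall (J : {fset nat}) (A : nat -> set TW), (forall i, measurable (A i)) ->
  P (\bigcap_(i in [set` J]) W i @^-1` A i) =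
  (\prod_(i <- J) P (W i @^-1` A i))%E.

Definition iid_copies d dW (Omega : measurableType d) (TW : measurableType dW)
    (P : probability Omega R) (F : probability TW R)
    (W : nat -> {RV P >-> TW}) : Prop :=
  mutually_independent P W /\
  forall i (A : set TW), measurable A -> distribution P (W i) A = F A.

(* [g] is a version of E[Z | X], seen as a function of the value of X *)
Definition is_condexp d dX (T : measurableType d) (TX : measurableType dX)
    (P : probability T R) (X : T -> TX) (Z : T -> R) (g : TX -> R) : Prop :=
  [/\ P.-integrable setT (EFin \o Z),
      measurable_fun setT g,
      P.-integrable setT (EFin \o (g \o X)) &
      forall B : set TX, measurable B ->
        (\int[P]_(w in X @^-1` B) (g (X w))%:E =
         \int[P]_(w in X @^-1` B) (Z w)%:E)%E].

Definition cvg_in_prob d (Omega : measurableType d) (P : probability Omega R)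
    (Z : nat -> Omega -> R) (c : R) : Prop :=
  forall e : R, 0 < e ->
    P [set om | e <= `|Z n om - c|] @[n --> \oo] --> 0%E.

Definition cvg_in_distr d (Omega : measurableType d) (P : probability Omega R)
    (Z : nat -> Omega -> R) (mu : set R -> \bar R) : Prop :=
  forall x : R, {for x, continuous (fun y : R => mu [set` `]-oo, y]])} ->
    P [set om | Z n om <= x] @[n --> \oo] --> mu [set` `]-oo, x]].

(* N(0, V); [normal_prob 0 0] is uniform on [0, 1] in the library, so the
   degenerate case has to be given separately. *)
Definition centered_normal (V : R) : set R -> \bar R :=
  if V == 0 then \d_(0 : R) else normal_prob 0 (Num.sqrt V).

(* Elements of L^2(mu) are represented by functions, not by classes; closedness
   under limits in norm makes G stable under equality almost everywhere. *)
Definition closed_L2_subspace d (T : measurableType d) (mu : probability T R)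
    (G : set (T -> R)) : Prop :=
  [/\ forall g, G g -> g \in Lfun mu 2%:E,
      G (fun=> 0),
      forall (a : R) g h, G g -> G h -> G (fun x => a * g x + h x) &
      forall (u : nat -> T -> R) (g : T -> R),
        (forall k, G (u k)) -> g \in Lfun mu 2%:E ->
        l2norm mu (u k \- g) @[k --> \oo] --> (0 : R) -> G g].

Definition ae_bounded d (T : measurableType d) (P : probability T R)
    (a : T -> R) (C : R) : Prop :=
  {ae P, forall w, `|a w| <= C}.

End probability_notions.

Section cross_fitting.
Context {R : realType} {dW dX : measure_display}.
Context {TW : measurableType dW} {TX : measurableType dX}.
Variables (X : TW -> TX) (m rho : TW -> (TX -> R) -> R).

Definition psi (theta : R) (gamma alpha : TX -> R) (w : TW) : R :=
  m w gamma - theta + alpha (X w) * rho w gamma.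

Variables (L : nat) (fold : forall n, 'I_n -> 'I_L).
Arguments fold : clear implicits.

(* The l-th fold of {0, .., n-1} is the set of i with [fold n i = l]. *)
Definition about_equal_folds : Prop :=
  forall l : 'I_L,
    (#|[pred i | fold n i == l]|%:R / n%:R : R) @[n --> \oo] --> (L%:R^-1 : R).

(* A learner maps the sample to a function of x, for each sample size and each
   fold; it uses only the observations outside the fold. *)
Definition cross_fitted
    (lrn : forall n, 'I_L -> n.-tuple TW -> TX -> R) : Prop :=
  forall n (l : 'I_L) (s t : n.-tuple TW),
    (forall i, fold n i != l -> tnth s i = tnth t i) -> lrn n l s = lrn n l t.

Variables ghat ahat : forall n, 'I_L -> n.-tuple TW -> TX -> R.
Arguments ghat : clear implicits.
Arguments ahat : clear implicits.

Definition thetahat n (s : n.-tuple TW) : R :=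
  n%:R^-1 * \sum_(l < L) \sum_(i < n | fold n i == l)
    (m (tnth s i) (ghat n l s)
     + ahat n l s (X (tnth s i)) * rho (tnth s i) (ghat n l s)).

Definition Vhat n (s : n.-tuple TW) : R :=
  n%:R^-1 * \sum_(l < L) \sum_(i < n | fold n i == l)
    psi (thetahat s) (ghat n l s) (ahat n l s) (tnth s i) ^+ 2.

End cross_fitting.

Arguments about_equal_folds R {L} fold.

Definition sample T Omega (W : nat -> Omega -> T) n (om : Omega) : n.-tuple T :=
  [tuple W i om | i < n].

(* Main.v *)
Require Import Defs.
From HB Require Import structures.
From mathcomp Require Import all_boot all_order all_algebra.
From mathcomp Require Import finmap.
From mathcomp Require Import all_classical all_reals all_analysis.
From mathcomp Require Import measurable_realfun.
From mathcomp Require Import ring lra.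

(* Write psi(g, a) for the score with nuisance functions g and a, psi0 for the
   score at (gamma0, alpha0), and D_l = psi(ghat_l, ahat_l) - psi0. Up to the
   term sum_l n^(-1/2) sum_(i in I_l) D_l(W_i), the statistic
   sqrt n (thetahat - theta0) is the normalized sum of the psi0(W_i). Given the
   observations outside I_l, the D_l(W_i) are i.i.d.; their second moment is at
   most a constant times |ghat_l - gamma0|^2 + E[(rho(ghat_l) - rho(gamma0))^2]
   + |ahat_l - alpha0|^2, which tends to zero in probability, so the centered sum
   is negligible by Chebyshev's inequality. Their mean is the sum of
   E[psi(ghat_l, alpha0)] and of E[(ahat_l - alpha0)(rhobar(ghat_l) -
   rhobar(gamma0))]. The second term is at most
   sqrt C |ghat_l - gamma0| |ahat_l - alpha0| = o_p(n^(-1/2)); the first one is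
   zero in the affine case by Neyman orthogonality, and
   O(|ghat_l - gamma0|^2) = o_p(n^(-1/2)) otherwise.

   The central limit theorem is proved by Lindeberg's replacement method with
   sigmoid test functions, which are smooth with bounded derivatives and are
   close enough to indicators of half-lines to give convergence of
   distribution functions. *)

Set Implicit Arguments.
Unset Strict Implicit.
Unset Printing Implicit Defensive.

Import Order.TTheory GRing.Theory Num.Theory.
Import numFieldNormedType.Exports.

Local Open Scope classical_set_scope.
Local Open Scope ring_scope.


(** * Taylor remainders and sigmoid test functions *)

(** Conditioning on the observations outside a fold is never carried out as such: it becomes
    Fubini's theorem for functions of the sample that ignore one coordinate. The obstacle is that
    the conditional second moment of D_l is small only in probability, and no bound on its
    expectation over the sample is available, so Chebyshev's inequality does not apply directly.
    Each D_l is therefore replaced by zero on the event that this moment exceeds a threshold. The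
    event is determined by the observations outside the fold, so independence and centering survive,
    and off an event of small probability nothing has changed.

    Only two moments of psi0 are at hand. For the limit law this excludes a plain third-moment
    remainder; the Taylor remainder is kept as the minimum of a quadratic and a cubic, and dominated
    convergence shows that n such remainders vanish. For the variance estimator it excludes
    Chebyshev's inequality for the squares of psi0, so the law of large numbers is proved under a
    first moment alone, and the cross term between psi0 and its perturbation is absorbed by Young's
    inequality. *)

Section taylor.
Context {R : realType}.
Implicit Types f : R -> R.

(** Mean value theorem. The bound on [df] is asked only within distance [|y|] of [x] because
    [taylor2_derive] applies it to a derivative whose bound holds only there. *)
Lemma derive_bound_increment (f df : R -> R) (B x y : R) :
  (forall z, is_derive z (1 : R) f (df z)) ->
  (forall z, `|z - x| <= `|y| -> `|df z| <= B) ->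
  `|f (x + y) - f x| <= B * `|y|.
Proof.
move=> dff hB.
have cf : continuous f.
  move=> z; apply/differentiable_continuous/derivable1_diffP.
  by case: (dff z).
have [y0|y0] := leP 0 y.
- have [||c] := @MVT_segment R f df x (x + y) _ (fun z _ => dff z).
  + by rewrite lerDl.
  + exact: continuous_subspaceT.
  rewrite in_itv /= => /andP[xc cy] ->.
  rewrite addrAC subrr add0r normrM ler_wpM2r //; apply: hB.
  by rewrite !ger0_norm ?subr_ge0 // lerBlDl.
- have [||c] := @MVT_segment R f df (x + y) x _ (fun z _ => dff z).
  + by rewrite gerDl ltW.
  + exact: continuous_subspaceT.
  rewrite in_itv /= => /andP[yc cx] e.
  rewrite distrC e opprD addrA subrr sub0r normrM normrN ler_wpM2r //.
  apply: hB; rewrite distrC (ltr0_norm y0) ger0_norm ?subr_ge0 //.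
  by rewrite lerBlDl -lerBlDr opprK.
Qed.

(** The quadratic alternative keeps the averaged remainder finite under a second moment; the cubic
    one makes it negligible after n steps of size n^(-1/2). *)
Definition taylor2 (C : R) (f f1 f2 : R -> R) :=
  forall x y, `|f (x + y) - f x - y * f1 x - y ^+ 2 / 2 * f2 x| <=
              C * Num.min (y ^+ 2) (`|y| ^+ 3).

(* The two bounds inside the minimum come from expanding to order two and to
   order three. *)
Lemma taylor2_derive (C : R) (f f1 f2 f3 : R -> R) :
  (forall z, is_derive z (1 : R) f (f1 z)) -> (forall z, is_derive z (1 : R) f1 (f2 z)) ->
  (forall z, is_derive z (1 : R) f2 (f3 z)) ->
  (forall z, `|f2 z| <= C) -> (forall z, `|f3 z| <= C) ->
  taylor2 (2 * C) f f1 f2.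
Proof.
move=> d1 d2 d3 b2 b3 x y.
have C0 : 0 <= C by apply: le_trans (b2 0).
(* [r] is [f] minus the nonconstant part of its quadratic Taylor polynomial at [x], and [r1 - f1 x]
   is its derivative. The remainder is thus an increment of [r], and two uses of the mean value
   theorem reduce it to the oscillation of [f2]. *)
pose r1 z := f1 z - (z - x) * f2 x.
pose r z := f z - (z - x) * f1 x - (z - x) ^+ 2 / 2 * f2 x.
have dr1 z : is_derive z (1 : R) r1 (f2 z - f2 x).
  have -> : r1 = f1 - (fun z => z * f2 x) + cst (x * f2 x).
    by apply/funext => u; rewrite /r1 /= !fctE; ring.
  have -> : f2 z - f2 x = f2 z - f2 x + 0 by rewrite addr0.
  apply: is_deriveD; apply: is_deriveB.
  have -> : (fun z => z * f2 x) = f2 x \*: (@id R).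
    by apply/funext => u; rewrite /= mulrC.
  by apply: is_derive_eq; rewrite scaler1.
have dr z : is_derive z (1 : R) r (r1 z - f1 x).
  have -> : r = f - cst (f1 x) * (@id R) - cst (f2 x / 2) * ((@id R - cst x) ^+ 2) + cst (x * f1 x).
    by apply/funext => u; rewrite /r /= !fctE /= expr2; field.
  by apply: is_derive_eq; rewrite /r1 ?fctE /GRing.scale /= ?exprfctE; field.
have hr1 z K : (forall u, `|u - x| <= `|y| -> `|f2 u - f2 x| <= K) ->
    `|z - x| <= `|y| -> `|r1 z - f1 x| <= K * `|y|.
  move=> hK zy; have -> : f1 x = r1 x by rewrite /r1 subrr mul0r subr0.
  have K0 : 0 <= K by apply: le_trans (hK x _); rewrite ?subrr ?normr0.
  have := @derive_bound_increment r1 _ K x (z - x) dr1.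
  rewrite [x + _]addrC subrK => /(_ _)/le_trans; apply.
    by move=> u ux; apply: hK; apply: le_trans ux zy.
  by rewrite ler_wpM2l.
have hr K : (forall u, `|u - x| <= `|y| -> `|f2 u - f2 x| <= K) ->
    `|r (x + y) - r x| <= K * `|y| * `|y|.
  move=> hK; apply: derive_bound_increment dr _ => z zy.
  exact: hr1.
have -> : f (x + y) - f x - y * f1 x - y ^+ 2 / 2 * f2 x = r (x + y) - r x.
  by rewrite /r; field.
have y3 : `|y| ^+ 3 = `|y| * `|y| * `|y| by rewrite !exprS expr0 mulr1 mulrA.
have y2 : y ^+ 2 = `|y| * `|y| by rewrite -normrM -expr2 ger0_norm ?sqr_ge0.
(* The oscillation of [f2] is at most 2C everywhere, which gives the quadratic bound and the factor
   2 of the statement; within distance [|y|] it is at most [C * |y|], which gives the cubic one. *)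
have [_|_] := leP (y ^+ 2) (`|y| ^+ 3).
  rewrite y2 mulrA; apply: hr => u _.
  rewrite mulrDl mul1r; apply: (le_trans (ler_normB _ _)); exact: lerD.
apply: (@le_trans _ _ (C * `|y| * `|y| * `|y|)).
  apply: hr => u uy; rewrite -{1}(subrK x u) [_ + x]addrC.
  apply: (le_trans (derive_bound_increment d3 _)) => [z _|]; first exact: b3.
  by rewrite ler_wpM2l.
have h : 0 <= C * (`|y| * `|y| * `|y|) by rewrite !mulr_ge0.
by rewrite y3; lra.
Qed.

(* For large [a] this is a smooth approximation of the indicator of ]-oo, b]. *)
Definition sigm (a b t : R) := (1 + expR (a * (t - b)))^-1.

Lemma sigm_gt0 a b t : 0 < sigm a b t.
Proof. by rewrite invr_gt0 addr_gt0 // expR_gt0. Qed.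

Lemma sigm_lt1 a b t : sigm a b t < 1.
Proof. by rewrite invf_lt1 ?ltrDl ?expR_gt0 // addr_gt0 // expR_gt0. Qed.

(** The logistic differential equation. It makes every higher derivative a polynomial in [sigm],
    hence bounded, since [sigm] takes values between 0 and 1. *)
Lemma is_derive_sigm a b t :
  is_derive t (1 : R) (sigm a b) (- a * (sigm a b t * (1 - sigm a b t))).
Proof.
have e0 : 1 + expR (a * (t - b)) != 0 by rewrite gt_eqF // addr_gt0 // expR_gt0.
pose g t := 1 + expR (a * (t - b)).
have dg u : is_derive u (1 : R) g (a * expR (a * (u - b))).
  have -> : g = cst 1 + (expR \o (cst a * (@id R - cst b))).
    by apply/funext => v; rewrite /g !fctE.
  by apply: is_derive_eq; rewrite !fctE /GRing.scale /=; ring.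
have -> : sigm a b = (fun u => (g u)^-1) by [].
have [dgt vgt] := dg t.
apply: DeriveDef; first exact: derivableV.
rewrite deriveV // vgt /g /GRing.scale /=; field.
by [].
Qed.

Lemma measurable_sigm a b : measurable_fun setT (sigm a b).
Proof.
apply: continuous_measurable_fun => x.
apply/differentiable_continuous/derivable1_diffP.
by case: (is_derive_sigm a b x).
Qed.

Lemma continuous_sigm a b : continuous (sigm a b).
Proof.
move=> x; apply/differentiable_continuous/derivable1_diffP.
by case: (is_derive_sigm a b x).
Qed.

Lemma sigm_ge a b e t : 0 < a -> t <= b - e -> 1 - expR (- (a * e)) <= sigm a b t.
Proof.
move=> a0 tb; have h : expR (a * (t - b)) <= expR (- (a * e)).
  by rewrite ler_expR -mulrN ler_pM2l // lerBlDr addrC.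
apply: (@le_trans _ _ (1 - expR (a * (t - b)))); first exact: lerB.
have e0 := expR_gt0 (a * (t - b)).
rewrite /sigm -[leRHS]mul1r ler_pdivlMr; last exact: addr_gt0.
by rewrite -subr_sqr expr1n gerBl sqr_ge0.
Qed.

Lemma sigm_le a b e t : 0 < a -> b + e <= t -> sigm a b t <= expR (- (a * e)).
Proof.
move=> a0 tb; have h : expR (- (a * (t - b))) <= expR (- (a * e)).
  by rewrite ler_expR lerN2 ler_pM2l // lerBrDl.
apply: le_trans h; rewrite expRN /sigm lef_pV2 ?posrE ?addr_gt0 ?expR_gt0 //.
by rewrite lerDr.
Qed.

Definition testfun (C : R) (f f1 f2 : R -> R) :=
  [/\ measurable_fun setT f, measurable_fun setT f1, measurable_fun setT f2,
      (forall x, [/\ `|f x| <= C, `|f1 x| <= C & `|f2 x| <= C]) &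
      taylor2 C f f1 f2].

Lemma testfun_sigm a b : exists C f1 f2, testfun C (sigm a b) f1 f2.
Proof.
pose g := sigm a b.
pose f1 := cst (- a) * (g * (cst 1 - g)).
pose f2 := cst (a ^+ 2) * (g * (cst 1 - g) * (cst 1 - cst 2 * g)).
pose f3 := cst (- a ^+ 3) * (g * (cst 1 - g) * (cst 1 - cst 6 * g + cst 6 * g ^+ 2)).
have dg z : is_derive z (1 : R) g (f1 z) by exact: is_derive_sigm.
have df1 z : is_derive z (1 : R) f1 (f2 z).
  apply: is_derive_eq; rewrite /f1 /f2 !fctE /GRing.scale /=; ring.
have df2 z : is_derive z (1 : R) f2 (f3 z).
  apply: is_derive_eq; rewrite /f1 /f2 /f3 !fctE /GRing.scale /= ?exprfctE; ring.
have g01 z : 0 < g z < 1 by rewrite sigm_gt0 sigm_lt1.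
have mg : measurable_fun setT g by exact: measurable_sigm.
have mf1 : measurable_fun setT f1.
  by apply: measurable_funM => //; apply: measurable_funM => //; apply: measurable_funB.
have mf2 : measurable_fun setT f2.
  apply: measurable_funM => //; apply: measurable_funM.
    by apply: measurable_funM => //; apply: measurable_funB.
  by apply: measurable_funB => //; apply: measurable_funM.
(* Each of [g], [f1], [f2], [f3] is a coefficient, up to sign a power of [a], times a polynomial in
   [g] bounded by 1 on the unit interval; [K] dominates all the coefficients at once. *)
pose K := 1 + `|a| + a ^+ 2 + `|a ^+ 3|.
have K0 := sqr_ge0 a; have K1 := normr_ge0 a; have K2 := normr_ge0 (a ^+ 3).
have bK c p z : `|c| <= K -> `|p (g z)| <= 1 -> `|c * p (g z)| <= K.
  move=> cK pz; rewrite normrM -[leRHS]mulr1.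
  by rewrite ler_pM.
have b0 z : `|g z| <= K.
  by have /andP[? ?] := g01 z; rewrite gtr0_norm // /K; lra.
have b1 z : `|f1 z| <= K.
  apply: (bK (- a) (fun u => u * (1 - u))); first by rewrite normrN /K; lra.
  by have /andP[? ?] := g01 z; rewrite ger0_norm; nra.
have b2 z : `|f2 z| <= K.
  apply: (bK (a ^+ 2) (fun u => u * (1 - u) * (1 - 2 * u))).
    by rewrite ger0_norm // /K; lra.
  have /andP[? ?] := g01 z; rewrite normrM.
  rewrite [leRHS](_ : 1 = 1 * 1); last by rewrite mulr1.
  apply: ler_pM => //; first by rewrite ger0_norm; nra.
  by rewrite ler_norml; apply/andP; split; lra.
have b3 z : `|f3 z| <= K.
  apply: (bK (- a ^+ 3) (fun u => u * (1 - u) * (1 - 6 * u + 6 * u ^+ 2))).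
    by rewrite normrN /K; lra.
  have /andP[? ?] := g01 z; rewrite normrM.
  rewrite [leRHS](_ : 1 = 1 * 1); last by rewrite mulr1.
  apply: ler_pM => //; first by rewrite ger0_norm; nra.
  by rewrite ler_norml; apply/andP; split; nra.
exists (2 * K), f1, f2; split => //; last exact: taylor2_derive df2 b2 b3.
have KK : K <= 2 * K by rewrite /K; lra.
by move=> x; split; apply: le_trans KK.
Qed.

End taylor.

(** * Gaussian integrals *)

Section gaussian.
Context {R : realType}.
Local Notation mu := (@lebesgue_measure R).
Local Open Scope ereal_scope.

(** The normal law is dominated by Lebesgue measure, and its Radon-Nikodym derivative agrees almost
    everywhere with [normal_pdf], since both have the same integral over every measurable set. *)
Lemma ge0_integral_normal_prob (m s : R) (f : R -> \bar R) :
  measurable_fun setT f -> (forall x, 0 <= f x) ->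
  \int[normal_prob m s]_x f x = \int[mu]_x (f x * (normal_pdf m s x)%:E).
Proof.
move=> mf f0.
have dom := @normal_prob_dominates R m s.
have mpdf : measurable_fun setT (EFin \o normal_pdf m s).
  by apply/measurable_EFinP; exact: measurable_normal_pdf.
rewrite -(Radon_Nikodym_SigmaFinite.change_of_variables dom)//.
have iRN := Radon_Nikodym_SigmaFinite.f_integrable dom.
apply: ae_eq_integral => //.
- by apply: emeasurable_funM => //; exact: measurable_int iRN.
- exact: emeasurable_funM.
- apply: ae_eqe_mul2l; apply: integral_ae_eq => //.
  move=> E _ mE.
  by rewrite -Radon_Nikodym_SigmaFinite.f_integral.
Qed.

Lemma ge0_integral_translation (a : R) (G : R -> R) :
  continuous G -> (forall x, 0 <= G x)%R ->
  \int[mu]_x (G x)%:E = \int[mu]_x (G (x + a))%:E.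
Proof.
move=> cG G0.
have d1 x : is_derive x (1%R : R) (fun x : R => (x + a)%R) 1%R.
  have -> : (fun x : R => (x + a)%R) = (@id R + cst a)%R by [].
  by apply: is_derive_eq; rewrite addr0.
have dE : (fun x : R => (x + a)%R)^`()%classic = cst 1%R.
  by apply/funext => x; rewrite derive1E derive_val.
rewrite (@increasing_ge0_integration_by_substitutionT _ (fun x => x + a)%R)//.
- by rewrite dE; apply: eq_integral => x _; rewrite !fctE /= mulr1.
- by move=> x y; rewrite ltrD2r.
- by rewrite dE => ?; exact: cvg_cst.
- by rewrite dE; exact: is_cvg_cst.
- by rewrite dE; exact: is_cvg_cst.
- exact: cvg_addrr_Ny.
- exact: cvg_addrr.
Qed.

Lemma ge0_integral_dilation (c : R) (G : R -> R) : (0 < c)%R ->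
  continuous G -> (forall x, 0 <= G x)%R ->
  \int[mu]_x (G x)%:E = \int[mu]_x (G (c * x) * c)%:E.
Proof.
move=> c0 cG G0.
have d1 x : is_derive x (1%R : R) (fun x : R => (c * x)%R) c.
  have -> : (fun x : R => (c * x)%R) = (cst c * @id R)%R by [].
  by apply: is_derive_eq; rewrite !fctE /GRing.scale /= mulr0 addr0 mulr1.
have dE : (fun x : R => (c * x)%R)^`()%classic = cst c.
  by apply/funext => x; rewrite derive1E derive_val.
rewrite (@increasing_ge0_integration_by_substitutionT _ (fun x => c * x)%R)//.
- by rewrite dE; apply: eq_integral => x _; rewrite !fctE /=.
- by move=> x y; rewrite ltr_pM2l.
- by rewrite dE => ?; exact: cvg_cst.
- by rewrite dE; exact: is_cvg_cst.
- by rewrite dE; exact: is_cvg_cst.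
- by apply/gt0_cvgMrNy => //; exact: cvg_id.
- by apply/gt0_cvgMry => //; exact: cvg_id.
Qed.

Lemma normal_pdf_dilation (c s x : R) : (0 < c)%R -> (0 < s)%R ->
  (normal_pdf 0 (c * s) (c * x) * c = normal_pdf 0 s x)%R.
Proof.
move=> c0 s0; have cs : (0 < c * s)%R by rewrite mulr_gt0.
rewrite !normal_pdfE ?gt_eqF// /normal_peak /normal_fun !subr0.
have -> : (- (c * x) ^+ 2 / ((c * s) ^+ 2 *+ 2) = - x ^+ 2 / (s ^+ 2 *+ 2))%R.
  by field; rewrite !gt_eqF.
rewrite mulrAC; congr (_ * _)%R.
rewrite -!mulrnAr !(sqrtrM _ (sqr_ge0 _)) !sqrtr_sqr !gtr0_norm//.
by field; rewrite !gt_eqF // sqrtr_gt0 mulrn_wgt0 // pi_gt0.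
Qed.

(** Completing the square in [z]. The joint density of two independent centered normals is factored
    as the density of their sum [u] times the conditional density of the first one given the sum. *)
Lemma normal_pdf_conv (s t u z : R) : (0 < s)%R -> (0 < t)%R ->
  let r := Num.sqrt (s ^+ 2 + t ^+ 2) in
  (normal_pdf 0 s z * normal_pdf 0 t (u - z) =
   normal_pdf 0 r u * normal_pdf (u * s ^+ 2 / r ^+ 2) (s * t / r) z)%R.
Proof.
move=> s0 t0 r.
have st0 : (0 < s ^+ 2 + t ^+ 2)%R by rewrite addr_gt0 // exprn_gt0.
have r0 : (0 < r)%R by rewrite sqrtr_gt0.
have rE : (r ^+ 2 = s ^+ 2 + t ^+ 2)%R by rewrite sqr_sqrtr // ltW.
have q0 : (0 < s * t / r)%R by rewrite divr_gt0 // mulr_gt0.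
rewrite !normal_pdfE ?gt_eqF// /normal_peak /normal_fun !subr0.
rewrite mulrACA [RHS]mulrACA -!expRD; congr (_ * expR _)%R.
  rewrite -!mulrnAr !(sqrtrM _ (sqr_ge0 _)) !sqrtr_sqr !gtr0_norm//.
  rewrite !invfM; field.
  by rewrite !gt_eqF // sqrtr_gt0 mulrn_wgt0 // pi_gt0.
rewrite exprMn exprVn exprMn rE; field.
by rewrite !gt_eqF.
Qed.

Lemma measurable_comp_addl (f : R -> R) (x : R) :
  measurable_fun setT f -> measurable_fun setT (fun y => f (x + y)%R).
Proof.
move=> mf; apply: (measurableT_comp mf) => //=.
exact: measurable_funD.
Qed.

Lemma continuous_comp_addl (f : R -> R) (x : R) :
  continuous f -> continuous (fun y => f (x + y)%R).
Proof.
move=> cf y; apply: (@continuous_comp _ _ _ (fun y => x + y)%R f); last exact: cf.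
by apply: cvgD; [exact: cvg_cst|exact: cvg_id].
Qed.

Lemma ge0_integral_normal_prob_dilation (f : R -> R) (c s x : R) :
  (0 < c)%R -> (0 < s)%R -> continuous f -> (forall y, 0 <= f y)%R ->
  \int[normal_prob 0 s]_z (f (x + c * z)%R)%:E =
  \int[normal_prob 0 (c * s)]_y (f (x + y)%R)%:E.
Proof.
move=> c0 s0 cf f0; have mf := continuous_measurable_fun cf.
have cs : (0 < c * s)%R by rewrite mulr_gt0.
rewrite !ge0_integral_normal_prob//; last 4 first.
- by apply/measurable_EFinP; exact: measurable_comp_addl.
- by move=> y; rewrite lee_fin.
- apply/measurable_EFinP.
  apply: (@measurableT_comp _ _ _ _ _ _ (fun y => f (x + y)%R) _ (fun z => c * z)%R).
    exact: measurable_comp_addl.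
  exact: measurable_funM.
- by move=> y; rewrite lee_fin.
under [RHS]eq_integral do rewrite -EFinM.
rewrite [RHS](@ge0_integral_dilation c) //.
- apply: eq_integral => z _; rewrite -EFinM; congr EFin.
  by rewrite -[RHS]mulrA normal_pdf_dilation.
- move=> y; apply: cvgM; first exact: continuous_comp_addl.
  by apply: continuous_normal_pdf; rewrite gt_eqF.
- by move=> y; rewrite mulr_ge0 // normal_pdf_ge0.
Qed.

Lemma ge0_integral_normal_prob_conv (f : R -> R) (s t x : R) :
  (0 < s)%R -> (0 < t)%R -> continuous f -> (forall y, 0 <= f y)%R ->
  \int[normal_prob 0 s]_z (\int[normal_prob 0 t]_y (f (x + z + y)%R)%:E) =
  \int[normal_prob 0 (Num.sqrt (s ^+ 2 + t ^+ 2))]_u (f (x + u)%R)%:E.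
Proof.
move=> s0 t0 cf f0; have mf := continuous_measurable_fun cf.
set r := Num.sqrt _.
(* The integrand in the coordinates (first summand, sum). Once the integrals are exchanged, the
   conditional density of the first summand integrates to 1. *)
pose H (p : R * R) := (f (x + p.2) * (normal_pdf 0 s p.1 * normal_pdf 0 t (p.2 - p.1)))%R.
have mH : measurable_fun setT (EFin \o H).
  apply/measurable_EFinP; apply: measurable_funM.
    exact: (measurableT_comp (measurable_comp_addl x mf)).
  apply: measurable_funM.
    exact: (measurableT_comp (measurable_normal_pdf 0 s)).
  apply: (measurableT_comp (measurable_normal_pdf 0 t)).
  exact: measurable_funB.
have H0 p : 0 <= (EFin \o H) p.
  by rewrite lee_fin !mulr_ge0 // normal_pdf_ge0.
have inner z : \int[normal_prob 0 t]_y (f (x + z + y)%R)%:E * (normal_pdf 0 s z)%:E =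
    \int[mu]_u (EFin \o H) (z, u).
  rewrite ge0_integral_normal_prob//; last 2 first.
  - by apply/measurable_EFinP; exact: measurable_comp_addl.
  - by move=> y; rewrite lee_fin.
  under eq_integral do rewrite -EFinM.
  rewrite (@ge0_integral_translation (- z)); last 2 first.
  - move=> y; apply: cvgM; first exact: continuous_comp_addl.
    by apply: continuous_normal_pdf; rewrite gt_eqF.
  - by move=> y; rewrite mulr_ge0 // normal_pdf_ge0.
  rewrite muleC -ge0_integralZl//=; last 3 first.
  - apply/measurable_EFinP; apply: measurable_funM.
      apply: (measurableT_comp (measurable_comp_addl (x + z) mf)).
      exact: measurable_funD.
    apply: (measurableT_comp (measurable_normal_pdf 0 t)).
    exact: measurable_funD.
  - by move=> y _; rewrite lee_fin mulr_ge0 // normal_pdf_ge0.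
  - by rewrite lee_fin normal_pdf_ge0.
  apply: eq_integral => u _; rewrite -EFinM /H /=; congr EFin.
  by rewrite mulrCA (_ : x + z + (u - z) = x + u)%R //; ring.
have -> : \int[normal_prob 0 s]_z \int[normal_prob 0 t]_y (f (x + z + y)%R)%:E =
    \int[mu]_z \int[mu]_u (EFin \o H) (z, u).
  rewrite ge0_integral_normal_prob.
  - by apply: eq_integral => z _; rewrite inner.
  - apply: (@measurable_fun_fubini_tonelli_F _ _ _ _ _ (normal_prob 0 t)
      (fun p => (f (x + p.1 + p.2)%R)%:E)).
    + apply/measurable_EFinP/(measurableT_comp mf).
      by apply: measurable_funD => //; exact: measurable_funD.
    + by move=> p; rewrite lee_fin.
  - by move=> z; apply: integral_ge0 => y _; rewrite lee_fin.
rewrite (@fubini_tonelli _ _ _ _ _ mu mu _ mH H0).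
rewrite ge0_integral_normal_prob//; last 2 first.
- by apply/measurable_EFinP; exact: measurable_comp_addl.
- by move=> y; rewrite lee_fin.
apply: eq_integral => u _; rewrite /fubini_G /=.
under eq_integral do rewrite /H /= normal_pdf_conv// mulrA EFinM.
rewrite ge0_integralZl//; last 3 first.
- by apply/measurable_EFinP; exact: measurable_normal_pdf.
- by move=> z _; rewrite lee_fin normal_pdf_ge0.
- by rewrite lee_fin mulr_ge0 // normal_pdf_ge0.
by rewrite integral_normal_pdf mule1 EFinM.
Qed.

End gaussian.

(** * First two moments of the centered normal law *)

Section gaussian_moments.
Context {R : realType}.
Local Notation mu := (@lebesgue_measure R).
Local Open Scope ereal_scope.

Lemma is_derive_normal_pdf (s z : R) : (0 < s)%R ->
  is_derive z (1%R : R) (normal_pdf 0 s) (- (z / s ^+ 2) * normal_pdf 0 s z)%R.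
Proof.
move=> s0; rewrite normal_pdfE ?gt_eqF//.
have -> : (fun x => normal_peak s * normal_fun 0 s x)%R =
  (cst (normal_peak s) * (expR \o (cst (- (s ^+ 2 *+ 2)^-1) * ((@id R) ^+ 2))))%R.
  apply/funext => x; rewrite !fctE /normal_fun /= subr0.
  by congr (_ * expR _)%R; rewrite mulNr mulrC mulNr.
apply: is_derive_eq; rewrite !fctE /GRing.scale /=.
rewrite (_ : - (s ^+ 2 *+ 2)^-1 * z ^+ 2 = - z ^+ 2 / (s ^+ 2 *+ 2))%R; last by ring.
rewrite /normal_fun subr0; field; rewrite ?gt_eqF //.
Qed.

Lemma cvg_id_normal_pdf (s : R) : (0 < s)%R ->
  (z * normal_pdf 0 s z)%R @[z --> +oo%R] --> (0%R : R).
Proof.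
(* With w = z^2 / (2 s^2), the inequality exp(-w) <= 1/w bounds [z * normal_pdf 0 s z] by K / z. *)
move=> s0; pose K := (normal_peak s * (s ^+ 2 *+ 2))%R.
have K0 : (0 <= K)%R by rewrite mulr_ge0 ?normal_peak_ge0 // mulrn_wge0 // sqr_ge0.
apply: (@squeeze_cvgr _ _ _ _ (cst 0%R) (fun z => K * z^-1)%R) => //.
- near=> z; have z0 : (0 < z)%R by near: z; exact: nbhs_pinfty_gt.
  apply/andP; split; first by rewrite mulr_ge0 ?normal_pdf_ge0 // ltW.
  rewrite normal_pdfE ?gt_eqF// /K /normal_fun subr0.
  rewrite mulrCA -!mulrA ler_wpM2l ?normal_peak_ge0 //.
  rewrite mulNr expRN.
  have h := expR_ge1Dx (z ^+ 2 / (s ^+ 2 *+ 2)).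
  have w0 : (0 < z ^+ 2 / (s ^+ 2 *+ 2))%R.
    by rewrite divr_gt0 ?exprn_gt0 // mulrn_wgt0 // exprn_gt0.
  apply: (@le_trans _ _ (z * (z ^+ 2 / (s ^+ 2 *+ 2))^-1)%R).
    rewrite ler_pM2l // lef_pV2 ?posrE ?expR_gt0 //; lra.
  rewrite le_eqVlt; apply/orP; left; apply/eqP; field.
  by rewrite !gt_eqF.
- exact: cvg_cst.
- rewrite -[X in _ --> X](mulr0 K); apply: cvgM; first exact: cvg_cst.
  have /gtr0_cvgV0 : \forall a \near +oo%R, (0 < @id R a)%R by exact: nbhs_pinfty_gt.
  by move=> [_]; apply; exact: cvg_id.
Unshelve. all: by end_near. Qed.

Lemma ge0_integral_split_itvy (s : R) (g : R -> R) : (0 < s)%R ->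
  measurable_fun setT g -> (forall x, 0 <= g x)%R ->
  \int[mu]_(x in `[0%R, +oo[) (g x)%:E =
  \int[mu]_(x in `[0%R, s]) (g x)%:E + \int[mu]_(x in `[s, +oo[) (g x)%:E.
Proof.
move=> s0 mg g0; rewrite -(@integral_itv_bndo_bndc _ _ s); last first.
  by apply/measurable_EFinP; exact: measurable_funTS.
rewrite -ge0_integral_setU//=.
- by rewrite -itv_bndbnd_setU// bnd_simp ltW.
- by apply/measurable_EFinP; exact: measurable_funTS.
- by move=> x _; rewrite lee_fin.
- apply/disj_setPS => x [/=]; rewrite !in_itv /= andbT => /andP[_ xs] sx.
  by move: xs; rewrite ltNge sx.
Qed.

(** Integration by parts: [G] has derivative (s^2 - z^2) e(z) and vanishes at 0 and at infinity, so
    z^2 e and s^2 e have the same integral over the half-line. To integrate only nonnegative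
    functions, the half-line is cut at [s], where this derivative changes sign; the two boundary
    terms [G s] cancel. *)
Lemma integral_normal_prob_sqr (s : R) : (0 < s)%R ->
  \int[normal_prob 0 s]_z (z ^+ 2)%:E = (s ^+ 2)%:E.
Proof.
move=> s0; pose e : R -> R := normal_pdf 0 s.
have e0 z : (0 <= e z)%R by exact: normal_pdf_ge0.
have ce : continuous e by apply: continuous_normal_pdf; rewrite gt_eqF.
have cX : continuous (fun z : R => z ^+ 2)%R by exact: sqr_continuous.
have cze : continuous (fun z : R => z ^+ 2 * e z)%R.
  by move=> z; apply: cvgM; [exact: cX|exact: ce].
have cse : continuous (fun z : R => s ^+ 2 * e z)%R.
  by move=> z; apply: cvgM; [exact: cvg_cst|exact: ce].
have mze := continuous_measurable_fun cze.
have mse := continuous_measurable_fun cse.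
have ze0 z : (0 <= z ^+ 2 * e z)%R by rewrite mulr_ge0 // sqr_ge0.
have se0 z : (0 <= s ^+ 2 * e z)%R by rewrite mulr_ge0 // sqr_ge0.
pose F z := (- s ^+ 2 * (z * e z))%R.
pose G z := (s ^+ 2 * (z * e z))%R.
have de z : is_derive z (1%R : R) e (- (z / s ^+ 2) * e z)%R.
  exact: is_derive_normal_pdf.
have dG z : is_derive z (1%R : R) G (s ^+ 2 * e z - z ^+ 2 * e z)%R.
  have -> : G = (cst (s ^+ 2) * (@id R * e))%R by [].
  by apply: is_derive_eq; rewrite !fctE /GRing.scale /=; field; rewrite gt_eqF.
have dF z : is_derive z (1%R : R) F (z ^+ 2 * e z - s ^+ 2 * e z)%R.
  have -> : F = (- G)%R by apply/funext => u; rewrite /F /G !fctE mulNr.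
  by apply: is_derive_eq; rewrite opprB.
have cF : continuous F.
  by move=> z; apply/differentiable_continuous/derivable1_diffP; case: (dF z).
have cG : continuous G.
  by move=> z; apply/differentiable_continuous/derivable1_diffP; case: (dG z).
have I1 : \int[mu]_(z in `[s, +oo[) (z ^+ 2 * e z - s ^+ 2 * e z)%:E = (G s)%:E.
  rewrite (@ge0_continuous_FTC2y _ _ F s 0%R).
  - by rewrite sub0e /F /G mulNr EFinN oppeK.
  - by move=> x sx; rewrite -mulrBl mulr_ge0 // subr_ge0 lerXn2r // nnegrE ltW // (lt_le_trans s0).
  - apply: continuous_subspaceT => z; apply: cvgB; [exact: cze|exact: cse].
  - rewrite -[X in _ --> X](mulr0 (- s ^+ 2)%R); apply: cvgM; first exact: cvg_cst.
    exact: cvg_id_normal_pdf.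
  - by move=> x _; case: (dF x).
  - exact/cvg_at_right_filter/cF.
  - by move=> x _; rewrite derive1E derive_val.
have I2 : \int[mu]_(z in `[0%R, s]) (s ^+ 2 * e z - z ^+ 2 * e z)%:E = (G s)%:E.
  rewrite (@continuous_FTC2 _ _ G 0%R s) //.
  - by rewrite /G mul0r mulr0 sube0.
  - apply: continuous_subspaceT => z; apply: cvgB; [exact: cse|exact: cze].
  - split.
    + by move=> x _; case: (dG x).
    + exact/cvg_at_right_filter/cG.
    + exact/cvg_at_left_filter/cG.
  - by move=> x _; rewrite derive1E derive_val.
have J1 : \int[mu]_(z in `[s, +oo[) (z ^+ 2 * e z)%:E =
    \int[mu]_(z in `[s, +oo[) (s ^+ 2 * e z)%:E + (G s)%:E.
  rewrite -I1 -ge0_integralD//=.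
  - by apply: eq_integral => z _; rewrite -EFinD; congr EFin; ring.
  - by move=> x _; rewrite lee_fin.
  - by apply/measurable_EFinP; exact: measurable_funTS.
  - move=> x; rewrite in_itv /= andbT => sx.
    by rewrite lee_fin -mulrBl mulr_ge0 // subr_ge0 lerXn2r // nnegrE ltW // (lt_le_trans s0).
  - by apply/measurable_EFinP/measurable_funTS/measurable_funB.
have J2 : \int[mu]_(z in `[0%R, s]) (s ^+ 2 * e z)%:E =
    \int[mu]_(z in `[0%R, s]) (z ^+ 2 * e z)%:E + (G s)%:E.
  rewrite -I2 -ge0_integralD//=.
  - by apply: eq_integral => z _; rewrite -EFinD; congr EFin; ring.
  - by move=> x _; rewrite lee_fin.
  - by apply/measurable_EFinP; exact: measurable_funTS.
  - move=> x; rewrite in_itv /= => /andP[x0 xs].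
    by rewrite lee_fin -mulrBl mulr_ge0 // subr_ge0 lerXn2r // nnegrE // ltW.
  - by apply/measurable_EFinP/measurable_funTS/measurable_funB.
have esym z : e (- z)%R = e z.
  by rewrite /e !normal_pdfE ?gt_eqF// /normal_fun !subr0 sqrrN.
rewrite ge0_integral_normal_prob//; last 2 first.
- by apply/measurable_EFinP; exact: continuous_measurable_fun.
- by move=> x; rewrite lee_fin sqr_ge0.
under eq_integral do rewrite -EFinM.
rewrite ge0_symfun_integralT//; last by move=> z /=; rewrite -/e esym sqrrN.
rewrite -set_itvcy (ge0_integral_split_itvy s0)// -/e J1 addeA [_ + (G s)%:E]addeAC -J2.
rewrite -(ge0_integral_split_itvy s0)// set_itvcy -ge0_symfun_integralT//; last first.
  by move=> z /=; rewrite esym.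
under eq_integral do rewrite EFinM.
rewrite ge0_integralZl//.
- by rewrite integral_normal_pdf mule1.
- by apply/measurable_EFinP; exact: measurable_normal_pdf.
- by move=> x _; rewrite lee_fin.
- by rewrite lee_fin sqr_ge0.
Qed.

Lemma integrable_normal_prob_id (s : R) : (0 < s)%R ->
  (normal_prob 0 s).-integrable setT (EFin \o @id R).
Proof.
move=> s0; apply/integrableP; split; first exact/measurable_EFinP.
apply: (@le_lt_trans _ _ (\int[normal_prob 0 s]_z ((1 + z ^+ 2)%R)%:E)).
  apply: ge0_le_integral => //=.
  - by apply/measurable_EFinP; exact: normr_measurable.
  - by apply/measurable_EFinP; apply: measurable_funD => //; exact: measurable_funX.
  - move=> z _; rewrite lee_fin; have := sqr_ge0 (`|z| - 1)%R.
    rewrite sqrrB real_normK ?num_real //; have := normr_ge0 z; lra.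
under eq_integral do rewrite EFinD.
rewrite ge0_integralD//=;
  do ?[by move=> x _; rewrite lee_fin sqr_ge0
      |by apply/measurable_EFinP; exact: measurable_funX].
rewrite integral_normal_prob_sqr // integral_cst//
  [X in 1 * X + _](_ : _ = 1%:E) ?mul1e -?EFinD ?ltry //.
exact: (@probability_setT _ _ _ (normal_prob 0 s : probability _ _)).
Qed.

(** The law is invariant under reflection because Lebesgue measure and the density are, so the
    integral equals its own opposite. *)
Lemma integral_normal_prob_id (s : R) : (0 < s)%R ->
  \int[normal_prob 0 s]_z z%:E = 0.
Proof.
move=> s0; have i0 := integrable_normal_prob_id s0.
have fin := integrable_fin_num measurableT i0.
have sym (f : R -> R) : measurable_fun setT f -> (forall x, 0 <= f x)%R ->
   \int[normal_prob 0 s]_z (f z)%:E = \int[normal_prob 0 s]_z (f (- z)%R)%:E.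
  move=> mf f0.
  have mN : measurable_fun setT (fun z : R => f (- z)%R) by exact: measurableT_comp.
  have mNN : measurable_fun [set: R] (-%R : R -> R) by exact: measurable_funN.
  rewrite !ge0_integral_normal_prob;
    do ?[by apply/measurable_EFinP|by move=> x; rewrite lee_fin].
  pose g x := (f x)%:E * (normal_pdf 0 s x)%:E.
  have mg : measurable_fun setT g.
    apply: emeasurable_funM; first exact/measurable_EFinP.
    by apply/measurable_EFinP; exact: measurable_normal_pdf.
  rewrite -[LHS]/(\int[mu]_x g x).
  rewrite (@eq_measure_integral _ _ _ _
    (pushforward mu (-%R : R -> measurableTypeR R))); last first.
    by move=> A mA _; apply/esym; exact: lebesgue_measureN.
  rewrite ge0_integral_pushforward//=; last first.
    by move=> x _; rewrite /g mule_ge0 // lee_fin // normal_pdf_ge0.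
  apply: eq_integral => x _; rewrite /g /= !normal_pdfE ?gt_eqF//.
  by rewrite /normal_fun !subr0 sqrrN.
have symN (A : set R) : measurable A ->
    pushforward (normal_prob 0 s) (-%R : R -> measurableTypeR R) A = normal_prob 0 s A.
  move=> mA.
  have mNA : measurable ((-%R : R -> R) @^-1` A).
    rewrite -[X in measurable X]setTI; exact: (@measurable_funN _ _ _ _ (@id R)).
  have -> : normal_prob 0 s A = \int[normal_prob 0 s]_z (\1_A z)%:E.
    by rewrite integral_indic// setIT.
  rewrite (sym (\1_A))//.
  have -> : \int[normal_prob 0 s]_z (\1_A (- z)%R)%:E =
      \int[normal_prob 0 s]_z (\1_((-%R : R -> R) @^-1` A) z)%:E by [].
  by rewrite integral_indic// setIT.
have h : \int[normal_prob 0 s]_z z%:E = - \int[normal_prob 0 s]_z z%:E.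
  rewrite [LHS](@eq_measure_integral _ _ _ _
    (pushforward (normal_prob 0 s) (-%R : R -> measurableTypeR R))); last first.
    by move=> A mA _; apply/esym; exact: symN.
  rewrite integral_pushforward//=; last first.
    rewrite (_ : _ \o _ = -%E \o (EFin \o @id R))//; exact: integrableN.
  by rewrite -integralN //; exact: integrable_add_def.
move: fin h; case: (\int[_]_z _) => // r _ [h].
by congr EFin; move: h; rewrite -/(r%R); lra.
Qed.

End gaussian_moments.

(** * Integration over an i.i.d. sample *)

Section independence.
Context {R : realType} {d dW : measure_display}.
Context {Omega : measurableType d} {TW : measurableType dW}.
Context {P : probability Omega R} {F0 : probability TW R}.
Context {W : nat -> {RV P >-> TW}}.
Hypothesis hW : iid_copies F0 W.

(** An arbitrary selection [e] of observations is allowed so that one member of the sample can later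
    be exchanged for an observation outside it. *)
Definition subsample n (e : 'I_n -> nat) (om : Omega) : n.-tuple TW :=
  [tuple W (e i) om | i < n].

Lemma measurable_subsample n (e : 'I_n -> nat) : measurable_fun setT (subsample e).
Proof.
apply/measurable_fun_tnthP => i.
rewrite (_ : _ \o _ = W (e i)) //.
by apply/funext => om /=; rewrite tnth_mktuple.
Qed.

(** A pi-system generating the sigma-algebra on tuples: independence is first known on boxes, and
    uniqueness of measures extends it to all measurable sets. *)
Definition boxes n : set (set (n.-tuple TW)) :=
  [set A | exists2 D : 'I_n -> set TW, (forall i, measurable (D i)) &
     A = [set s | forall i, D i (tnth s i)]].
Arguments boxes : clear implicits.

Lemma measurable_box n (D : 'I_n -> set TW) : (forall i, measurable (D i)) ->
  measurable [set s : n.-tuple TW | forall i, D i (tnth s i)].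
Proof.
move=> mD.
have -> : [set s : n.-tuple TW | forall i, D i (tnth s i)] =
    \bigcap_(i in [set: 'I_n]) ((fun s => tnth s i) @^-1` D i).
  by apply/seteqP; split => [s sD i _|s sD i]; [exact: sD|exact: (sD i)].
apply: fin_bigcap_measurable => // i _.
by rewrite -[X in measurable X]setTI; apply: measurable_tnth.
Qed.

Lemma measurable_boxesE n : @measurable _ (n.-tuple TW) = <<s boxes n >>.
Proof.
apply/seteqP; split; last first.
  apply: smallest_sub; first exact: sigma_algebra_measurable.
  by move=> _ [D mD ->]; exact: measurable_box.
move=> A mA.
have mid : measurable_fun setT (fun s : g_sigma_algebraType (boxes n) => (s : n.-tuple TW)).
  apply/measurable_fun_tnthP => i _ B mB; rewrite setTI.
  apply: sub_sigma_algebra.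
  exists (fun j => if j == i then B else setT); first by move=> j; case: ifP.
  apply/seteqP; split => [s /= sB j|s /= /(_ i)]; last by rewrite eqxx.
  by case: eqP => [->|].
by have := mid measurableT A mA; rewrite setTI.
Qed.

Lemma setI_closed_boxes n : setI_closed (boxes n).
Proof.
move=> _ _ [D mD ->] [E mE ->].
exists (fun i => D i `&` E i); first by move=> i; exact: measurableI.
apply/seteqP; split => [s [sD sE] i|s sDE]; first by split.
by split => i; have [] := sDE i.
Qed.

Lemma fresh_box n (e : 'I_n -> nat) k (D : 'I_n -> set TW) (B : set TW) :
  (forall i, e i != k) -> (forall i, measurable (D i)) -> measurable B ->
  (P ([set om | forall i, D i (W (e i) om)] `&` W k @^-1` B) =
   P [set om | forall i, D i (W (e i) om)] * F0 B)%E.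
Proof.
move=> ek mD mB; have [ind law] := hW.
pose J0 := [fset m | m in map e (enum 'I_n)]%fset.
have J0E m : m \in J0 <-> exists i, e i = m.
  split; first by rewrite !inE => /mapP[i _ ->]; exists i.
  by move=> [i <-]; rewrite !inE; apply/mapP; exists i => //; rewrite mem_enum.
have kJ0 : k \notin J0.
  by apply/negP => /J0E[i eik]; have := ek i; rewrite eik eqxx.
(* [e] may take the same value twice. The conditions bearing on one observation are intersected, so
   that the event is a product over distinct indices, as [mutually_independent] requires. *)
pose A m := if m == k then B else \bigcap_(i in [set i | e i = m]) D i.
have mA m : measurable (A m).
  by rewrite /A; case: ifP => // _; apply: fin_bigcap_measurable.
have E0 : [set om | forall i, D i (W (e i) om)] = \bigcap_(m in [set` J0]) W m @^-1` A m.
  apply/seteqP; split => [om h m /= /J0E[i <-]|om h i].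
    by rewrite /A (negbTE (ek i)) => j /= ej; rewrite -ej; exact: h.
  have eiJ : e i \in J0 by apply/J0E; exists i.
  by have := h _ eiJ; rewrite /A (negbTE (ek i)) => /(_ i); apply.
rewrite E0.
have -> : \bigcap_(m in [set` J0]) W m @^-1` A m `&` W k @^-1` B =
    \bigcap_(m in [set` (k |` J0)%fset]) W m @^-1` A m.
  apply/seteqP; split => [om [h hB] m /=|om h].
    rewrite in_fset1U => /orP[/eqP ->|mJ]; last exact: h.
    by rewrite /A eqxx.
  split => [m /= mJ|]; first by apply: h; rewrite /= in_fset1U mJ orbT.
  by have := h k; rewrite /A eqxx /=; apply; rewrite in_fset1U eqxx.
rewrite !ind // big_fsetU1//= muleC; congr (_ * _)%E.
by rewrite /A eqxx -(law k).
Qed.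

Lemma fresh n (e : 'I_n -> nat) k (A : set (n.-tuple TW)) (B : set TW) :
  (forall i, e i != k) -> measurable A -> measurable B ->
  (P (subsample e @^-1` A `&` W k @^-1` B) = P (subsample e @^-1` A) * F0 B)%E.
Proof.
move=> ek mA mB.
have mWB : measurable (W k @^-1` B) by apply: measurable_funPTI.
have mS := measurable_subsample e.
pose S := @subsample n e.
(* [m1] is the law of the subsample restricted to the event that [W k] lies in [B], and [m2] is the
   full law scaled by [F0 B]. By [fresh_box] these finite measures agree on boxes. *)
pose m1 : {measure set (n.-tuple TW) -> \bar R} := pushforward (mrestr P mWB) S.
pose FB : {nonneg R} := NngNum (fine_ge0 (measure_ge0 F0 B)).
pose m2 : {measure set (n.-tuple TW) -> \bar R} := mscale FB (pushforward P S).
rewrite -[LHS]/(m1 mS A).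
have -> : (P (subsample e @^-1` A) * F0 B)%E = m2 mS A.
  rewrite /m2 /= /mscale /= fineK; last exact: fin_num_measure.
  by rewrite muleC.
apply: (@measure_unique _ _ _ (boxes n) (fun=> setT)) => //.
- exact: measurable_boxesE.
- exact: setI_closed_boxes.
- by move=> _; exists (fun=> setT) => //; apply/seteqP; split.
- by rewrite bigcup_const //; exists 0%N.
- move=> _ [D mD ->]; rewrite /m1 /m2 /= /mscale /= /mrestr /pushforward.
  rewrite fineK; last exact: fin_num_measure.
  have -> : S @^-1` [set s | forall i, D i (tnth s i)] =
      [set om | forall i, D i (W (e i) om)].
    by apply/seteqP; split => om /= h i; have := h i; rewrite tnth_mktuple.
  by rewrite muleC; exact: (fresh_box ek mD mB).
- move=> _; rewrite /m1 /= /pushforward /mrestr.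
  rewrite preimage_setT setTI -ge0_fin_numE //.
  exact: fin_num_measure.
Qed.
HB.instance Definition _ n (e : 'I_n -> nat) :=
  isMeasurableFun.Build _ _ _ _ (subsample e) (measurable_subsample e).

Let pair_fun n (e : 'I_n -> nat) k (om : Omega) : n.-tuple TW * TW :=
  (subsample e om, W k om).

Let measurable_pair_fun n (e : 'I_n -> nat) k : measurable_fun setT (pair_fun e k).
Proof. exact: measurable_fun_pair. Qed.

HB.instance Definition _ n (e : 'I_n -> nat) k :=
  isMeasurableFun.Build _ _ _ _ (pair_fun e k) (measurable_pair_fun e k).

Local Open Scope ereal_scope.

Let fresh_law n (e : 'I_n -> nat) k (A : set (n.-tuple TW * TW)) :
  (forall i, e i != k) -> measurable A ->
  distribution P (pair_fun e k) A = (distribution P (subsample e) \x F0) A.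
Proof.
move=> ek mA; apply/esym/product_measure_unique => // A1 A2 mA1 mA2.
exact: (fresh ek mA1 mA2).
Qed.

Lemma fresh_ge0_integral n (e : 'I_n -> nat) k (G : n.-tuple TW * TW -> \bar R) :
  (forall i, e i != k) -> measurable_fun setT G -> (forall p, 0 <= G p) ->
  \int[P]_om G (subsample e om, W k om) =
  \int[P]_om \int[F0]_w G (subsample e om, w).
Proof.
move=> ek mG G0.
rewrite -[LHS](@ge0_integral_distribution _ _ _ _ _ P (pair_fun e k))//.
rewrite (@eq_measure_integral _ _ _ _ (distribution P (subsample e) \x F0)); last first.
  by move=> A mA _; exact: fresh_law.
rewrite (fubini_tonelli1 _ mG G0).
rewrite (@ge0_integral_distribution _ _ _ _ _ P (subsample e))//.
- exact: measurable_fun_fubini_tonelli_F.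
- by move=> s; apply: integral_ge0.
Qed.

Lemma fresh_integral n (e : 'I_n -> nat) k (G : n.-tuple TW * TW -> \bar R) :
  (forall i, e i != k) -> measurable_fun setT G ->
  P.-integrable setT (fun om => G (subsample e om, W k om)) ->
  \int[P]_om G (subsample e om, W k om) =
  \int[P]_om \int[F0]_w G (subsample e om, w).
Proof.
move=> ek mG iG.
pose m := distribution P (subsample e) \x F0.
have iGm : m.-integrable setT G.
  apply/integrableP; split => //.
  rewrite (@eq_measure_integral _ _ _ _ (distribution P (pair_fun e k))); last first.
    by move=> A mA _; apply/esym; exact: fresh_law.
  rewrite (@ge0_integral_distribution _ _ _ _ _ P (pair_fun e k))//; last exact: measurableT_comp.
  by have /integrableP[] := iG.
rewrite -[LHS](@integral_distribution _ _ _ _ _ P (pair_fun e k))//.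
rewrite (@eq_measure_integral _ _ _ _ m); last first.
  by move=> A mA _; exact: fresh_law.
rewrite -integral12_prod_meas1 //.
have mF := measurable_fubini_F iGm.
rewrite (@integral_distribution _ _ _ _ _ P (subsample e))//.
have := integrable_fubini_F iGm.
move=> /integrableP[_ h]; apply/integrableP; split; first exact: measurableT_comp.
rewrite ge0_integral_distribution in h => //; exact: measurableT_comp.
Qed.

Definition ignores n (i : 'I_n) U (G : n.-tuple TW -> U) :=
  forall s t, (forall j, j != i -> tnth s j = tnth t j) -> G s = G t.

(* Replacing the i-th observation by the fresh one W n does not change a function
   ignoring coordinate i, and makes the tuple independent of W i. *)
Let swap n (i j : 'I_n) : nat := if j == i then n else j.

Let ignores_swap n (i : 'I_n) U (G : n.-tuple TW -> U) om : ignores i G ->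
  G (sample W n om) = G (subsample (swap i) om).
Proof.
move=> iG; apply: iG => j ji; rewrite !tnth_mktuple /swap.
by rewrite (negbTE ji).
Qed.

Let swap_neq n (i j : 'I_n) : swap i j != i.
Proof.
rewrite /swap; case: ifPn => [_|ji]; first by rewrite gt_eqF // ltEnat /= ltn_ord.
by apply: contra ji => /eqP/val_inj ->.
Qed.

Lemma sample_ge0_integral n (i : 'I_n) (G : n.-tuple TW -> TW -> \bar R) :
  ignores i G -> measurable_fun setT (fun p => G p.1 p.2) ->
  (forall s w, 0 <= G s w) ->
  \int[P]_om G (sample W n om) (W i om) =
  \int[P]_om \int[F0]_w G (sample W n om) w.
Proof.
move=> iG mG G0.
under eq_integral do rewrite (ignores_swap _ iG).
under [RHS]eq_integral do rewrite (ignores_swap _ iG).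
exact: (@fresh_ge0_integral _ (swap i) i (fun p => G p.1 p.2)).
Qed.

Lemma sample_integral n (i : 'I_n) (G : n.-tuple TW -> TW -> \bar R) :
  ignores i G -> measurable_fun setT (fun p => G p.1 p.2) ->
  P.-integrable setT (fun om => G (sample W n om) (W i om)) ->
  \int[P]_om G (sample W n om) (W i om) =
  \int[P]_om \int[F0]_w G (sample W n om) w.
Proof.
move=> iG mG intG.
have intG' : P.-integrable setT (fun om => G (subsample (swap i) om) (W i om)).
  by apply: eq_integrable intG => // om _; rewrite (ignores_swap _ iG).
under eq_integral do rewrite (ignores_swap _ iG).
under [RHS]eq_integral do rewrite (ignores_swap _ iG).
exact: (@fresh_integral _ (swap i) i (fun p => G p.1 p.2)).
Qed.

End independence.

(** * Convergence in probability *)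

Section in_probability.
Context {R : realType} {d : measure_display} {Omega : measurableType d}.
Variable P : probability Omega R.
Implicit Types (Z : nat -> Omega -> R) (c : R).

Lemma cvge_ge0P (u : nat -> \bar R) : (forall n, 0 <= u n)%E ->
  (u @ \oo --> 0%E) <->
  (forall e : R, 0 < e -> \forall n \near \oo, (u n <= e%:E)%E).
Proof.
move=> u0; split.
- move=> /fine_cvgP[ufin /cvgrPdist_le ucv] e e0.
  near=> n.
  have un : u n \is a fin_num by near: n.
  rewrite -(fineK un) lee_fin.
  have : `|0 - fine (u n)| <= e by near: n; exact: ucv.
  by rewrite sub0r normrN ger0_norm // fine_ge0.
- move=> h; apply/fine_cvgP; split.
    near=> n; have un : (u n <= 1%:E)%E by near: n; exact: h.
    by rewrite ge0_fin_numE // (le_lt_trans un) // ltry.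
  apply/cvgrPdist_le => e e0; near=> n.
  have un : (u n <= e%:E)%E by near: n; exact: h.
  have uf : u n \is a fin_num by rewrite ge0_fin_numE // (le_lt_trans un) // ltry.
  rewrite sub0r normrN ger0_norm /=; last by rewrite fine_ge0.
  by rewrite -lee_fin fineK.
Unshelve. all: by end_near. Qed.

Lemma measurable_dist_ge (Z : Omega -> R) c e : measurable_fun setT Z ->
  measurable [set om | e <= `|Z om - c|].
Proof.
move=> mZ; rewrite -[X in measurable X]setTI.
apply: (@measurable_fun_ler _ _ _ _ (cst e) (fun om => `|Z om - c|)) => //.
by apply: measurableT_comp => //; exact: measurable_funB.
Qed.

(** The form in which the estimates are carried out: the bad event [B] may be any measurable set
    containing the deviations, so the bad events of several estimates can simply be united. *)
Lemma cvg_in_probP Z c : (forall n, measurable_fun setT (Z n)) ->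
  cvg_in_prob P Z c <->
  forall e dl : R, 0 < e -> 0 < dl -> \forall n \near \oo,
    exists B, [/\ measurable B, (P B <= dl%:E)%E &
                  forall om, ~ B om -> `|Z n om - c| < e].
Proof.
move=> mZ; split=> [h e dl e0 dl0|h e e0].
- have := (cvge_ge0P (fun n => measure_ge0 P [set om | e <= `|Z n om - c|])).1
      (h _ e0) _ dl0.
  apply: filterS => n Pn; exists [set om | e <= `|Z n om - c|]; split => //.
    exact: measurable_dist_ge.
  by move=> om /= /negP; rewrite -ltNge.
- apply/cvge_ge0P => // dl dl0.
  apply: filterS (h _ _ e0 dl0) => n [B [mB PB hB]].
  apply: le_trans PB; apply: le_measure; rewrite ?inE //.
    exact: measurable_dist_ge.
  move=> om /= eZ; apply: contrapT => nB.
  by have := hB _ nB; rewrite ltNge eZ.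
Qed.

Lemma markov_ge0 (Z : Omega -> R) (e : R) : measurable_fun setT Z ->
  (forall om, 0 <= Z om) -> 0 < e ->
  (P [set om | (e <= Z om)%R] <= e^-1%:E * \int[P]_om (Z om)%:E)%E.
Proof.
move=> mZ Z0 e0.
have E : [set om | e <= Z om] = [set om | e <= `|Z om - 0|].
  by apply/seteqP; split => om /=; rewrite subr0 ger0_norm.
have mB : measurable [set om | e <= Z om] by rewrite E; exact: measurable_dist_ge.
rewrite -ge0_integralZl //; last 3 first.
- exact/measurable_EFinP.
- by move=> om _; rewrite lee_fin.
- by rewrite lee_fin invr_ge0 ltW.
rewrite -[X in (P X <= _)%E]setIT -integral_indic //.
apply: ge0_le_integral => //=.
- by apply/measurable_EFinP; exact: measurable_indic.
- by apply/measurable_EFinP; exact: measurable_funM.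
- move=> om _; rewrite lee_fin indicE.
  have [/set_mem /= eZ|_] := boolP (om \in _).
    by rewrite mulrC ler_pdivlMr // mul1r.
  by rewrite mulr_ge0 // invr_ge0 ltW.
Qed.

End in_probability.

(** * Second moments of sums over a fold *)

Section fold_sums.
Context {R : realType} {d dW : measure_display}.
Context {Omega : measurableType d} {TW : measurableType dW}.
Context {P : probability Omega R} {F0 : probability TW R}.
Context {W : nat -> {RV P >-> TW}}.
Hypothesis hW : iid_copies F0 W.

Lemma measurable_sample n : measurable_fun setT (sample W n).
Proof. exact: measurable_subsample. Qed.

Lemma measurable_sample_comp dU (U : measurableType dU) n (i : nat)
    (G : n.-tuple TW -> TW -> U) :
  measurable_fun setT (fun p => G p.1 p.2) ->
  measurable_fun setT (fun om => G (sample W n om) (W i om)).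
Proof.
move=> mG; apply: (@measurableT_comp _ _ _ _ _ _ (fun p => G p.1 p.2) _
  (fun om => (sample W n om, W i om))) => //.
by apply: measurable_fun_pair => //; exact: measurable_sample.
Qed.

(* The cross terms vanish: for i != j, D at W i is centered conditionally on all
   the other observations, while D at W j does not depend on the i-th one through
   its first argument. *)
Lemma sum_sample_sqr_integral n (I : pred 'I_n) (D : n.-tuple TW -> TW -> R) (c : R) :
  measurable_fun setT (fun p => D p.1 p.2) ->
  (forall i, I i -> ignores i D) ->
  (forall s, F0.-integrable setT (EFin \o D s)) ->
  (forall s, \int[F0]_w (D s w)%:E = 0)%E ->
  (forall s, \int[F0]_w (D s w ^+ 2)%:E <= c%:E)%E ->
  (\int[P]_om ((\sum_(i < n | I i) D (sample W n om) (W i om)) ^+ 2)%:E <=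
   (#|I|%:R * c)%:E)%E.
Proof.
move=> mD iD intD D0 Dc.
pose z (i : 'I_n) om := if I i then D (sample W n om) (W i om) else 0.
have mz i : measurable_fun setT (z i).
  by rewrite /z; case: (I i) => //; exact: measurable_sample_comp.
have zsq i : I i -> (\int[P]_om (z i om ^+ 2)%:E <= c%:E)%E.
  move=> Ii; rewrite /z Ii.
  rewrite (sample_ge0_integral hW (G := fun s w => (D s w ^+ 2)%:E) (i := i)).
  - apply: (@le_trans _ _ (\int[P]_om c%:E)%E); last first.
      by rewrite integral_cst //= probability_setT mule1.
    apply: ge0_le_integral => //=.
    + by move=> om _; apply: integral_ge0 => w _; rewrite lee_fin sqr_ge0.
    + apply: (@measurableT_comp _ _ _ _ _ _ (fun s => \int[F0]_w (D s w ^+ 2)%:E)%E);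
        last exact: measurable_sample.
      apply: (@measurable_fun_fubini_tonelli_F _ _ _ _ _ F0
         (fun p => (D p.1 p.2 ^+ 2)%:E)).
        by apply/measurable_EFinP; exact: measurable_funX.
      by move=> p; rewrite lee_fin sqr_ge0.
  - by move=> s t st; apply/funext => w; rewrite (iD _ Ii s t st).
  - by apply/measurable_EFinP; exact: measurable_funX.
  - by move=> s w; rewrite lee_fin sqr_ge0.
have zint i : P.-integrable setT (fun om => (z i om ^+ 2)%:E).
  apply/integrableP; split; first by apply/measurable_EFinP; exact: measurable_funX.
  under eq_integral do rewrite gee0_abs ?lee_fin ?sqr_ge0 //.
  have [Ii|nI] := boolP (I i); first by rewrite (le_lt_trans (zsq _ Ii)) // ltry.
  under eq_integral do rewrite /z (negbTE nI) expr0n /=.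
  by rewrite integral0 ltry.
have zzint i j : P.-integrable setT (fun om => (z i om * z j om)%:E).
  apply: (@le_integrable _ _ _ _ _ measurableT _
    (fun om => (z i om ^+ 2)%:E + (z j om ^+ 2)%:E)%E) => //.
  - by apply/measurable_EFinP; exact: measurable_funM.
  - move=> om _ /=; rewrite lee_fin normrM [leRHS]ger0_norm ?addr_ge0 ?sqr_ge0 //.
    rewrite -(real_normK (num_real (z i om))) -(real_normK (num_real (z j om))).
    by have := sqr_ge0 (`|z i om| - `|z j om|); have := normr_ge0 (z i om);
       have := normr_ge0 (z j om); nra.
  - exact: integrableD.
have zz0 i j : i != j -> (\int[P]_om (z i om * z j om)%:E = 0)%E.
  move=> ij; have [Ii|nI] := boolP (I i); last first.
    under eq_integral do rewrite /z (negbTE nI) mul0r.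
    by rewrite integral0.
  have [Ij|nI] := boolP (I j); last first.
    under eq_integral do rewrite {2}/z (negbTE nI) mulr0.
    by rewrite integral0.
  pose G s w := (D s w * D s (tnth s j))%:E.
  have zG om : (z i om * z j om)%:E = G (sample W n om) (W i om).
    by rewrite /z Ii Ij /G tnth_mktuple.
  under eq_integral do rewrite zG.
  rewrite (sample_integral hW (i := i)).
  - under eq_integral => om _.
      rewrite /G; under eq_integral do rewrite EFinM.
      rewrite integralZr //; last exact: intD.
      rewrite D0 mul0e.
      over.
    by rewrite integral0.
  - move=> s t st; apply/funext => w; rewrite /G (iD _ Ii s t st) st //.
    by rewrite eq_sym.
  - apply/measurable_EFinP; apply: measurable_funM => //.
    apply: (@measurableT_comp _ _ _ _ _ _ (fun p => D p.1 p.2) _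
      (fun p : n.-tuple TW * TW => (p.1, tnth p.1 j))) => //.
    apply: measurable_fun_pair => //.
    by apply: (measurableT_comp (measurable_tnth j)).
  - by apply: eq_integrable (zzint i j) => // om _; rewrite zG.
have sumE om : ((\sum_(i < n | I i) D (sample W n om) (W i om)) ^+ 2)%:E =
    (\sum_(i < n) \sum_(j < n) (z i om * z j om)%:E)%E.
  rewrite big_mkcond /= -/(\sum_(i < n) z i om) expr2 big_distrlr /= -sumEFin.
  by apply: eq_bigr => i _; rewrite -sumEFin.
under eq_integral do rewrite sumE.
rewrite integral_sum //; last by move=> i; exact: integrable_sum.
under eq_bigr => i _.
  rewrite integral_sum // (bigD1 i) //= big1 ?adde0; last first.
    by move=> j ji; apply: zz0; rewrite eq_sym.
  under eq_integral do rewrite -expr2.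
  over.
rewrite (bigID I) /= [X in (_ + X)%E]big1 ?adde0; last first.
  move=> i nI; under eq_integral do rewrite /z (negbTE nI) expr0n /=.
  by rewrite integral0.
apply: (@le_trans _ _ (\sum_(i < n | I i) c%:E)%E); first exact: lee_sum.
by rewrite sumEFin sumr_const mulr_natl.
Qed.

End fold_sums.

Lemma integral_probability_cst (R : realType) d (T : measurableType d)
  (P : probability T R) (r : R) : (\int[P]_x r%:E = r%:E)%E.
Proof. by rewrite integral_cst // [X in (_ * X)%E]probability_setT mule1. Qed.

Lemma Rintegral_probability_cst (R : realType) d (T : measurableType d)
  (P : probability T R) (r : R) : \int[P]_x r = r.
Proof. by rewrite /Rintegral integral_probability_cst. Qed.

(** * Weak law of large numbers under a first moment *)

Section wlln.
Context {R : realType} {d dW : measure_display}.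
Context {Omega : measurableType d} {TW : measurableType dW}.
Context {P : probability Omega R} {F0 : probability TW R}.
Context {W : nat -> {RV P >-> TW}}.
Hypothesis hW : iid_copies F0 W.

Lemma sum_sample_ge0_integral n (I : pred 'I_n) (G : n.-tuple TW -> TW -> R) (c : R) :
  measurable_fun setT (fun p => G p.1 p.2) ->
  (forall i, I i -> ignores i G) ->
  (forall s w, 0 <= G s w) ->
  (forall s, \int[F0]_w (G s w)%:E <= c%:E)%E ->
  (\int[P]_om (\sum_(i < n | I i) G (sample W n om) (W i om))%:E <=
   (#|I|%:R * c)%:E)%E.
Proof.
move=> mG iG G0 Gc.
under eq_integral do rewrite -sumEFin -big_filter.
rewrite ge0_integral_sum //; last 2 first.
- by move=> i; apply/measurable_EFinP; exact: measurable_sample_comp.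
- by move=> i om _; rewrite lee_fin.
rewrite big_filter; apply: (@le_trans _ _ (\sum_(i < n | I i) c%:E)%E); last first.
  by rewrite sumEFin sumr_const mulr_natl.
apply: lee_sum => i Ii.
rewrite (sample_ge0_integral hW (G := fun s w => (G s w)%:E) (i := i)).
- apply: (@le_trans _ _ (\int[P]_om c%:E)%E); last first.
    by rewrite integral_cst //= probability_setT mule1.
  apply: ge0_le_integral => //=.
  + by move=> om _; apply: integral_ge0 => w _; rewrite lee_fin.
  + apply: (@measurableT_comp _ _ _ _ _ _ (fun s => \int[F0]_w (G s w)%:E)%E);
      last exact: measurable_sample.
    apply: (@measurable_fun_fubini_tonelli_F _ _ _ _ _ F0
       (fun p => (G p.1 p.2)%:E)).
      exact/measurable_EFinP.
    by move=> p; rewrite lee_fin.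
- by move=> s t st; apply/funext => w; rewrite (iG _ Ii s t st).
- exact/measurable_EFinP.
- by move=> s w; rewrite lee_fin.
Qed.

Lemma truncation_L1 (h : TW -> R) : F0.-integrable setT (EFin \o h) ->
  (\int[F0]_w (`|h w - (if `|h w| <= k%:R then h w else 0)|)%:E @[k --> \oo] --> 0)%E.
Proof.
move=> ih; have /measurable_EFinP mh := measurable_int F0 ih.
pose hk (k : nat) w := if `|h w| <= k%:R then h w else 0.
have mhk k : measurable_fun setT (hk k).
  apply: measurable_fun_ifT => //.
  by apply: measurable_fun_ler => //; exact: measurableT_comp.
have cvhk : {ae F0, forall w, setT w -> (EFin \o hk k) w @[k --> \oo] --> (EFin \o h) w}.
  apply: aeW => w _; apply/cvg_EFin; first exact: nearW.
  apply: (@cvg_near_cst _ _ _ _ \oo); near=> k; rewrite /comp /= /hk ifT //.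
  by near: k; exact: nbhs_infty_ger.
have bhk : {ae F0, forall w (k : nat), setT w ->
    (`|(EFin \o hk k) w| <= (EFin \o (fun w => `|h w|)%R) w)%E}.
  apply: aeW => w k _ /=; rewrite lee_fin /hk; case: ifP => // _.
  by rewrite normr0.
have [_ h0 _] := @dominated_convergence _ _ _ F0 setT measurableT
  (fun k => EFin \o hk k) (EFin \o h) (EFin \o (fun w => `|h w|))
  (fun k => (measurable_EFinP _ _).2 (mhk k)) ((measurable_EFinP _ _).2 mh)
  cvhk (integrable_norm ih) bhk.
apply: cvg_trans h0; apply: near_eq_cvg; apply: nearW => k /=.
by apply: eq_integral => w _ /=; rewrite distrC.
Unshelve. all: by end_near. Qed.

(** [h] is truncated at a level [k] fixed before [n]. The part cut off is small in L^1 and is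
    handled by Markov's inequality; the centered truncation is bounded, so Chebyshev's inequality
    applies to it. The third error is the shift of the mean caused by truncation. *)
Lemma wlln (h : TW -> R) : F0.-integrable setT (EFin \o h) ->
  cvg_in_prob P (fun n om => n%:R^-1 * \sum_(i < n) h (W i om))
    (fine (\int[F0]_w (h w)%:E)).
Proof.
move=> ih; have /measurable_EFinP mh := measurable_int F0 ih.
have msum n (g : TW -> R) : measurable_fun setT g ->
    measurable_fun setT (fun om => n%:R^-1 * \sum_(i < n) g (W i om)).
  move=> mg; apply: measurable_funM => //; apply: measurable_sum => i.
  exact: measurableT_comp.
apply/cvg_in_probP; first by move=> n; exact: msum.
move=> e dl e0 dl0.
(* The first bound keeps the shift of the mean below e/4; the second makes Markov's inequality at
   level e/4 yield the probability dl/2. *)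
pose eta := Num.min (e / 4) (e * dl / 8).
have eta0 : 0 < eta by rewrite lt_min !divr_gt0 // mulr_gt0.
have e40 : 0 < e / 4 by rewrite divr_gt0.
have [k hk_eta] : exists k : nat,
    (\int[F0]_w (`|h w - (if `|h w| <= k%:R then h w else 0)|)%:E <= eta%:E)%E.
  have := (@cvge_ge0P _ _ _).1 (truncation_L1 ih) _ eta0.
  move=> /(_ _)/wrap[|[N _ hN]].
    by move=> n; apply: integral_ge0 => w _; rewrite lee_fin.
  by exists N; apply: hN => /=.
pose hk w := if `|h w| <= k%:R then h w else 0.
have hkb w : `|hk w| <= k%:R by rewrite /hk; case: ifP => // _; rewrite normr0.
have mhk : measurable_fun setT hk.
  apply: measurable_fun_ifT => //.
  by apply: measurable_fun_ler => //; exact: measurableT_comp.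
have ihk : F0.-integrable setT (EFin \o hk).
  apply: measurable_bounded_integrable => //.
    by rewrite -ge0_fin_numE //; exact: fin_num_measure.
  exists k%:R; split => // x kx w _; exact: le_trans (hkb w) (ltW kx).
pose mu := fine (\int[F0]_w (h w)%:E).
pose muk := fine (\int[F0]_w (hk w)%:E).
have fmuk : (\int[F0]_w (hk w)%:E = muk%:E)%E.
  by rewrite /muk fineK //; exact: integrable_fin_num ihk.
have mukb : `|mu - muk| <= eta.
  rewrite /mu /muk -RintegralB //; apply: (le_trans (le_normr_Rintegral _ _)) => //.
    exact: (integrableB measurableT ih ihk).
  rewrite -lee_fin /Rintegral fineK //.
  rewrite ge0_fin_numE; last by apply: integral_ge0 => w _; rewrite lee_fin.
  by rewrite (le_lt_trans hk_eta) // ltry.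
have hkmu w : `|hk w - muk| <= 2 * k%:R.
  rewrite mulr_natl mulr2n (le_trans (ler_normB _ _)) // lerD //.
  rewrite /muk; apply: (le_trans (le_normr_Rintegral _ _)) => //.
  apply: (@le_trans _ _ (\int[F0]_w k%:R)%R).
    apply: le_Rintegral => //; first exact: integrable_norm.
    exact: finite_measure_integrable_cst.
  by rewrite Rintegral_probability_cst.
have icst : F0.-integrable setT (EFin \o cst muk) by exact: finite_measure_integrable_cst.
pose B1 n := [set om | e / 4 <= n%:R^-1 * \sum_(i < n) `|h (W i om) - hk (W i om)|].
pose B2 n := [set om | (e / 4) ^+ 2 <= (n%:R^-1 * \sum_(i < n) (hk (W i om) - muk)) ^+ 2].
have mA1 n : measurable_fun setT (fun om => n%:R^-1 * \sum_(i < n) `|h (W i om) - hk (W i om)|).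
  apply: (msum _ (fun w => `|h w - hk w|)).
  by apply: measurableT_comp => //; exact: measurable_funB.
have mA2 n : measurable_fun setT (fun om => (n%:R^-1 * \sum_(i < n) (hk (W i om) - muk)) ^+ 2).
  apply: measurable_funX; apply: (msum _ (fun w => hk w - muk)).
  exact: measurable_funB.
have mB1 n : measurable (B1 n).
  rewrite -[X in measurable X]setTI.
  exact: (@measurable_fun_ler _ _ _ _ (cst (e / 4))).
have mB2 n : measurable (B2 n).
  rewrite -[X in measurable X]setTI.
  exact: (@measurable_fun_ler _ _ _ _ (cst ((e / 4) ^+ 2))).
near=> n.
have n0 : (0 < n)%N by near: n; exact: nbhs_infty_gt.
have n0R : 0 < n%:R :> R by rewrite ltr0n.
exists (B1 n `|` B2 n); split; first exact: measurableU.
- apply: (le_trans (measureU2 _ (mB1 n) (mB2 n))).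
  rewrite [dl]splitr EFinD; apply: leeD.
  + apply: (le_trans (markov_ge0 _ _ _ _)) => //.
    * by move=> om; rewrite mulr_ge0 // sumr_ge0.
    * under eq_integral do rewrite EFinM.
      rewrite ge0_integralZl //; last 2 first.
      - apply/measurable_EFinP; apply: measurable_sum => i.
        by apply: measurableT_comp => //; apply: measurable_funB; exact: measurableT_comp.
      - by move=> om _; rewrite lee_fin sumr_ge0.
      have := @sum_sample_ge0_integral n predT (fun _ w => `|h w - hk w|) eta.
      rewrite cardT size_enum_ord => H.
      apply: (@le_trans _ _ ((e / 4)^-1%:E * ((n%:R^-1)%:E * (n%:R * eta)%:E))%E).
        do 2 (apply: lee_wpmul2l; first by rewrite lee_fin invr_ge0 ltW).
        apply: H => //.
        apply: measurableT_comp => //; apply: measurable_funB => //; exact: measurableT_comp.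
      rewrite -!EFinM lee_fin mulKf ?gt_eqF // ler_pdivrMl //.
      apply: (@le_trans _ _ (e * dl / 8)); first by rewrite ge_min lexx orbT.
      rewrite le_eqVlt; apply/orP; left; apply/eqP; by field.
  + have e16 : 0 < (e / 4) ^+ 2 by rewrite exprn_gt0.
    have mk := markov_ge0 P (mA2 n) (fun om => sqr_ge0 _) e16.
    apply: (le_trans mk).
    * under eq_integral do rewrite exprMn EFinM.
      rewrite ge0_integralZl //; last 2 first.
      - apply/measurable_EFinP; apply: measurable_funX; apply: measurable_sum => i.
        by apply: measurable_funB => //; exact: measurableT_comp.
      - by move=> om _; rewrite lee_fin sqr_ge0.
      have := @sum_sample_sqr_integral _ _ _ _ _ _ _ _ hW n predT
         (fun _ w => hk w - muk) ((2 * k%:R) ^+ 2).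
      rewrite cardT size_enum_ord => H.
      apply: (@le_trans _ _ (((e / 4) ^+ 2)^-1%:E *
          ((n%:R^-1 ^+ 2)%:E * (n%:R * (2 * k%:R) ^+ 2)%:E))%E).
        apply: lee_wpmul2l; first by rewrite lee_fin invr_ge0 sqr_ge0.
        apply: lee_wpmul2l; first by rewrite lee_fin sqr_ge0.
        apply: H => //.
        - apply: measurable_funB => //; exact: measurableT_comp.
        - by move=> _; exact: (integrableB measurableT ihk icst).
        - move=> _; rewrite (integralB_EFin measurableT ihk icst).
          by rewrite fmuk integral_probability_cst subee.
        - move=> _; rewrite -[leRHS](integral_probability_cst F0).
          apply: ge0_le_integral => //=.
          + by move=> w _; rewrite lee_fin sqr_ge0.
          + by apply/measurable_EFinP; apply: measurable_funX; exact: measurable_funB.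
          + move=> w _; rewrite lee_fin -(real_normK (num_real (hk w - muk))).
            by rewrite lerXn2r // nnegrE mulr_ge0.
      rewrite -!EFinM lee_fin.
      (* The centered truncated terms are at most 2k in absolute value; this is the sample size from
         which Chebyshev's inequality at level e/4 yields at most dl/2. *)
      have hn : (2 * k%:R / (e / 4)) ^+ 2 / (dl / 2) <= n%:R.
        by near: n; exact: nbhs_infty_ger.
      rewrite ler_pdivrMr ?divr_gt0 // in hn.
      rewrite -(ler_pM2l n0R) (le_trans _ hn) // le_eqVlt; apply/orP; left; apply/eqP.
      by field; rewrite !gt_eqF.
- move=> om /not_orP[]; rewrite /B1 /B2 /=.
  move=> /negP; rewrite -ltNge => b1 /negP; rewrite -ltNge => b2.
  have b2' : `|n%:R^-1 * \sum_(i < n) (hk (W i om) - muk)| < e / 4.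
    by rewrite -(ltr_pXn2r (n := 2)) ?nnegrE // ?ltW // real_normK ?num_real.
  have b1' : `|n%:R^-1 * \sum_(i < n) (h (W i om) - hk (W i om))| < e / 4.
    apply: le_lt_trans b1; rewrite normrM ger0_norm ?invr_ge0 //.
    by rewrite ler_wpM2l ?invr_ge0 // ler_norm_sum.
  have b3 : `|muk - mu| <= e / 4 by rewrite distrC (le_trans mukb) // ge_min lexx.
  have -> : n%:R^-1 * (\sum_(i < n) h (W i om)) - mu =
      n%:R^-1 * (\sum_(i < n) (h (W i om) - hk (W i om))) +
      n%:R^-1 * (\sum_(i < n) (hk (W i om) - muk)) + (muk - mu).
    rewrite !sumrB sumr_const card_ord -mulr_natl; field.
    by rewrite gt_eqF.
  move: b1' b2' b3; rewrite !ltr_norml !ler_norml.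
  by move=> /andP[? ?] /andP[? ?] /andP[? ?]; apply/andP; split; lra.
Unshelve. all: by end_near. Qed.

End wlln.

Lemma cvg_inv_sqrtn (R : realType) : (Num.sqrt n%:R)^-1 @[n --> \oo] --> (0 : R).
Proof.
have inv0 : n%:R^-1 @[n --> \oo] --> (0 : R).
  have /gtr0_cvgV0 : \forall n \near \oo, (0 : R) < (fun n : nat => n%:R) n.
    by near=> n; rewrite ltr0n; near: n; exact: nbhs_infty_gt.
  by move=> [_]; apply; exact: cvgr_idn.
have : Num.sqrt (n%:R^-1 : R) @[n --> \oo] --> Num.sqrt (0 : R).
  exact: (continuous_cvg _ (@sqrt_continuous R 0) inv0).
by rewrite sqrtr0; apply: cvg_trans; apply: near_eq_cvg; apply: nearW => n; rewrite sqrtrV.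
Unshelve. all: by end_near. Qed.

(** * Central limit theorem *)

Section smoothing.
Context {R : realType} {d : measure_display} {T : measurableType d}.
Variables (nu : probability T R) (h : T -> R).
Hypothesis mh : measurable_fun setT h.
Implicit Types (f : R -> R) (c C : R).

(** The transition operator of a random walk with steps [c * h], [h] being drawn under [nu]. Adding
    independent steps to the argument of a test function amounts to iterating it. *)
Definition smooth c f x := \int[nu]_w f (x + c * h w).

Lemma probability_bounded_integrable (C : R) (g : T -> R) :
  measurable_fun setT g -> (forall w, `|g w| <= C) ->
  nu.-integrable setT (EFin \o g).
Proof.
move=> mg gC; apply: measurable_bounded_integrable => //.
  by rewrite -ge0_fin_numE //; exact: fin_num_measure.
exists C; split; first exact: num_real.
by move=> x Cx w _; exact: le_trans (gC w) (ltW Cx).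
Qed.

Lemma le_norm_Rintegral_cst (C : R) (g : T -> R) :
  measurable_fun setT g -> (forall w, `|g w| <= C) ->
  `|\int[nu]_w g w| <= C.
Proof.
move=> mg gC; have ig := probability_bounded_integrable mg gC.
apply: (le_trans (le_normr_Rintegral _ _)) => //.
rewrite -[leRHS](Rintegral_probability_cst nu); apply: le_Rintegral => //.
- exact: integrable_norm.
- exact: finite_measure_integrable_cst.
Qed.

Lemma measurable_affine_comp c f x : measurable_fun setT f ->
  measurable_fun setT (fun w => f (x + c * h w)).
Proof.
move=> mf; apply: measurableT_comp => //; apply: measurable_funD => //.
exact: measurable_funM.
Qed.

Lemma smooth_integrable c C f x : measurable_fun setT f -> (forall y, `|f y| <= C) ->
  nu.-integrable setT (EFin \o (fun w => f (x + c * h w))).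
Proof.
move=> mf fC; apply: (probability_bounded_integrable (C := C)) => //.
exact: measurable_affine_comp.
Qed.

Lemma le_norm_smooth c C f x : measurable_fun setT f -> (forall y, `|f y| <= C) ->
  `|smooth c f x| <= C.
Proof.
move=> mf fC; apply: le_norm_Rintegral_cst => //; exact: measurable_affine_comp.
Qed.

Lemma measurable_smooth c C f : measurable_fun setT f -> (forall y, `|f y| <= C) ->
  measurable_fun setT (smooth c f).
Proof.
move=> mf fC.
(* Adding [C] makes the integrand nonnegative, so that measurability of the partial integral follows
   from Tonelli's theorem. *)
have fC0 y : 0 <= f y + C by have := fC y; rewrite ler_norml => /andP[]; lra.
have -> : smooth c f = (fun x => fine (\int[nu]_w (f (x + c * h w) + C)%:E) - C).
  apply/funext => x; rewrite -[X in X - C]/(\int[nu]_w (f (x + c * h w) + C)).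
  rewrite RintegralD //.
  - by rewrite Rintegral_probability_cst addrK.
  - exact: smooth_integrable fC.
  - exact: finite_measure_integrable_cst.
apply: measurable_funB => //.
suff mI : measurable_fun setT (fun x : R => \int[nu]_w (f (x + c * h w) + C)%:E)%E.
  by have := measurableT_comp (fine_measurable measurableT) mI.
apply: (@measurable_fun_fubini_tonelli_F _ _ _ _ _ nu
   (fun p : R * T => (f (p.1 + c * h p.2) + C)%:E)) => [|p]; last by rewrite lee_fin.
apply/measurable_EFinP; apply: measurable_funD => //; apply: measurableT_comp => //.
apply: measurable_funD => //; apply: measurable_funM => //.
exact: measurableT_comp.
Qed.

(** The conditions of [testfun] are invariant under translation and are preserved by averaging
    against a probability, so the same constant [C] serves for every iterate. *)
Lemma testfun_smooth c C f f1 f2 : testfun C f f1 f2 ->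
  testfun C (smooth c f) (smooth c f1) (smooth c f2).
Proof.
move=> [mf mf1 mf2 b tay].
have b0 y : `|f y| <= C by case: (b y).
have b1 y : `|f1 y| <= C by case: (b y).
have b2 y : `|f2 y| <= C by case: (b y).
split; [exact: measurable_smooth b0|exact: measurable_smooth b1|
        exact: measurable_smooth b2| |].
  by move=> x; split; exact: le_norm_smooth.
move=> x y.
have i0 u := smooth_integrable c u mf b0.
have i1 u := smooth_integrable c u mf1 b1.
have i2 u := smooth_integrable c u mf2 b2.
have j1 := integrableB measurableT (i0 (x + y)) (i0 x).
have k1 : nu.-integrable setT (EFin \o (fun w => y * f1 (x + c * h w))).
  exact: (integrableZl measurableT y (i1 x)).
have k2 : nu.-integrable setT (EFin \o (fun w => y ^+ 2 / 2 * f2 (x + c * h w))).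
  exact: (integrableZl measurableT (y ^+ 2 / 2) (i2 x)).
have j2 := integrableB measurableT j1 k1.
have -> : smooth c f (x + y) - smooth c f x - y * smooth c f1 x -
    y ^+ 2 / 2 * smooth c f2 x =
    \int[nu]_w (f (x + y + c * h w) - f (x + c * h w) - y * f1 (x + c * h w) -
       y ^+ 2 / 2 * f2 (x + c * h w)).
  by rewrite RintegralB // RintegralB // RintegralB // RintegralZl // RintegralZl.
apply: le_norm_Rintegral_cst => [|w]; last first.
  by rewrite (_ : x + y + c * h w = x + c * h w + y) ?tay //; ring.
have ma (g : R -> R) u : measurable_fun setT g -> measurable_fun setT (fun w => g (u + c * h w)).
  by move=> mg; apply: measurable_affine_comp.
by repeat apply: measurable_funB => //; try apply: measurable_funM => //; exact: ma.
Qed.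

(** The Taylor remainder of one step, averaged over the law of the step. *)
Definition lindeberg_err c := \int[nu]_w Num.min ((c * h w) ^+ 2) (`|c * h w| ^+ 3).

Lemma measurable_lindeberg c :
  measurable_fun setT (fun w => Num.min ((c * h w) ^+ 2) (`|c * h w| ^+ 3)).
Proof.
apply: measurable_funTS.
apply: measurable_minr; apply: measurable_funX; last apply: measurableT_comp => //;
  exact: measurable_funM.
Qed.

Variable V : R.
Hypothesis h0 : (\int[nu]_w (h w)%:E = 0)%E.
Hypothesis hV : (\int[nu]_w (h w ^+ 2)%:E = V%:E)%E.

Lemma sqr_integrable : nu.-integrable setT (fun w => (h w ^+ 2)%:E).
Proof.
apply/integrableP; split; first by apply/measurable_EFinP; exact: measurable_funX.
under eq_integral do rewrite gee0_abs ?lee_fin ?sqr_ge0 //.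
by rewrite hV ltry.
Qed.

Lemma id_integrable : nu.-integrable setT (EFin \o h).
Proof.
apply: (@le_integrable _ _ _ _ _ measurableT _ (fun w => (1 + h w ^+ 2)%:E)) => //.
- exact/measurable_EFinP.
- move=> w _ /=; rewrite lee_fin [leRHS]ger0_norm ?addr_ge0 ?sqr_ge0 //.
  have := sqr_ge0 (`|h w| - 1); rewrite sqrrB real_normK ?num_real //.
  by have := normr_ge0 (h w); lra.
- have icst : nu.-integrable setT (EFin \o cst (1 : R)).
    exact: finite_measure_integrable_cst.
  exact: (integrableD measurableT icst sqr_integrable).
Qed.

Lemma lindeberg_integrable c :
  nu.-integrable setT (EFin \o (fun w => Num.min ((c * h w) ^+ 2) (`|c * h w| ^+ 3))).
Proof.
apply: (@le_integrable _ _ _ _ _ measurableT _ (fun w => ((c ^+ 2)%:E * (h w ^+ 2)%:E)%E)).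
- by apply/measurable_EFinP; exact: measurable_lindeberg.
- move=> w _ /=; rewrite lee_fin [leLHS]ger0_norm; last first.
    by rewrite le_min sqr_ge0 exprn_ge0.
  rewrite [leRHS]ger0_norm; last by rewrite mulr_ge0 // sqr_ge0.
  by rewrite exprMn ge_min lexx.
- exact: (integrableZl measurableT (c ^+ 2) sqr_integrable).
Qed.

Lemma smooth_expansion c C f f1 f2 x : testfun C f f1 f2 ->
  `|smooth c f x - f x - c ^+ 2 * V / 2 * f2 x| <= C * lindeberg_err c.
Proof.
move=> [mf mf1 mf2 b tay].
have b0 y : `|f y| <= C by case: (b y).
have i0 := smooth_integrable c x mf b0.
have icst : nu.-integrable setT (EFin \o cst (f x)).
  exact: finite_measure_integrable_cst.
have i1 : nu.-integrable setT (EFin \o (fun w => c * f1 x * h w)).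
  exact: (integrableZl measurableT (c * f1 x) id_integrable).
have i2 : nu.-integrable setT (EFin \o (fun w => c ^+ 2 / 2 * f2 x * h w ^+ 2)).
  exact: (integrableZl measurableT (c ^+ 2 / 2 * f2 x) sqr_integrable).
have i01 := integrableB measurableT i0 icst.
have i02 := integrableB measurableT i01 i1.
have i03 := integrableB measurableT i02 i2.
have -> : smooth c f x - f x - c ^+ 2 * V / 2 * f2 x =
    \int[nu]_w (f (x + c * h w) - f x - c * f1 x * h w - c ^+ 2 / 2 * f2 x * h w ^+ 2).
  rewrite RintegralB // RintegralB // RintegralB // Rintegral_probability_cst.
  rewrite RintegralZl //; last exact: id_integrable.
  rewrite RintegralZl //; last exact: sqr_integrable.
  have -> : \int[nu]_w h w = 0 by rewrite /Rintegral h0.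
  have -> : \int[nu]_w (h w ^+ 2) = V by rewrite /Rintegral hV.
  by rewrite mulr0 subr0; congr (_ - _); ring.
apply: (le_trans (le_normr_Rintegral _ _)) => //.
rewrite /lindeberg_err -RintegralZl //; last exact: lindeberg_integrable.
apply: le_Rintegral => //.
- exact: (integrable_norm i03).
- exact: (integrableZl measurableT C (lindeberg_integrable c)).
- move=> w _; have := tay x (c * h w).
  rewrite (_ : c * h w * f1 x = c * f1 x * h w); last by ring.
  by rewrite (_ : (c * h w) ^+ 2 / 2 * f2 x = c ^+ 2 / 2 * f2 x * h w ^+ 2); last by ring.
Qed.

(** After scaling, the integrand is the minimum of h^2 and |h|^3 / sqrt n. It tends to zero
    pointwise and is dominated by h^2, which is integrable. *)
Lemma cvg_lindeberg_err :
  n%:R * lindeberg_err (Num.sqrt n%:R)^-1 @[n --> \oo] --> (0 : R).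
Proof.
pose g (n : nat) w := Num.min (h w ^+ 2) (`|h w| ^+ 3 / Num.sqrt n%:R).
have gE (n : nat) w : (0 < n)%N ->
    n%:R * Num.min (((Num.sqrt n%:R)^-1 * h w) ^+ 2) (`|(Num.sqrt n%:R)^-1 * h w| ^+ 3) = g n w.
  move=> n0; have n0R : 0 < n%:R :> R by rewrite ltr0n.
  have s0 : 0 < Num.sqrt n%:R :> R by rewrite sqrtr_gt0.
  have s2 : n%:R = Num.sqrt n%:R ^+ 2 :> R by rewrite sqr_sqrtr // ltW.
  rewrite /g minr_pMr ?ltW //; congr Num.min.
    by rewrite {1}s2; field; rewrite gt_eqF.
  rewrite normrM (ger0_norm (x := _^-1)) ?invr_ge0 ?ltW // {1}s2.
  by field; rewrite gt_eqF.
have mg n : measurable_fun setT (EFin \o g n).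
  apply/measurable_EFinP; apply: measurable_minr; first exact: measurable_funX.
  by apply: measurable_funM => //; apply: measurable_funX; exact: measurableT_comp.
have g0 n w : 0 <= g n w.
  by rewrite le_min sqr_ge0 /= divr_ge0 ?sqrtr_ge0 ?exprn_ge0.
have gcvg : {ae nu, forall w, setT w -> (EFin \o g k) w @[k --> \oo] --> (0%:E : \bar R)}.
  apply: aeW => w _; apply/cvg_EFin; first exact: nearW.
  apply: (@squeeze_cvgr _ _ _ _ (cst 0) (fun n : nat => `|h w| ^+ 3 / Num.sqrt n%:R)).
  - by apply: nearW => n; rewrite g0 /= ge_min lexx orbT.
  - exact: cvg_cst.
  - rewrite -[X in _ --> X](mulr0 (`|h w| ^+ 3)); apply: cvgM; first exact: cvg_cst.
    exact: cvg_inv_sqrtn.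
have gb : {ae nu, forall w (k : nat), setT w -> (`|(EFin \o g k) w| <= (h w ^+ 2)%:E)%E}.
  by apply: aeW => w k _ /=; rewrite lee_fin ger0_norm // ge_min lexx.
have [_ _ H] := @dominated_convergence _ _ _ nu setT measurableT
  (fun k => EFin \o g k) (cst 0%:E) _ mg (measurable_cst _) gcvg sqr_integrable gb.
move: H; rewrite integral0 => /fine_cvgP[_ H].
apply: cvg_trans H; apply: near_eq_cvg; near=> n.
have n0 : (0 < n)%N by near: n; exact: nbhs_infty_gt.
rewrite /lindeberg_err -RintegralZl //; last exact: lindeberg_integrable.
by apply: eq_Rintegral => w _; rewrite gE.
Unshelve. all: by end_near. Qed.

End smoothing.

(** * Replacement of the summands by steps of another law *)

Section lindeberg.
Context {R : realType} {d dW : measure_display}.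
Context {Omega : measurableType d} {TW : measurableType dW}.
Context {P : probability Omega R} {F0 : probability TW R}.
Context {W : nat -> {RV P >-> TW}}.
Hypothesis hW : iid_copies F0 W.
Variables (xi : TW -> R) (V : R).
Hypothesis mxi : measurable_fun setT xi.
Hypothesis xi0 : (\int[F0]_w (xi w)%:E = 0)%E.
Hypothesis xiV : (\int[F0]_w (xi w ^+ 2)%:E = V%:E)%E.

Let S c k om := c * \sum_(i < k) xi (W i om).

Let mS c k : measurable_fun setT (S c k).
Proof.
apply: measurable_funM => //; apply: measurable_sum => i.
exact: measurableT_comp.
Qed.

Let mgS c k (g : R -> R) : measurable_fun setT g ->
  measurable_fun setT (fun om => g (S c k om)).
Proof. by move=> mg; apply: measurableT_comp. Qed.

(** The last summand is independent of the earlier ones, so it can be integrated out first. *)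
Lemma Rintegral_sum_step c C k (g : R -> R) :
  measurable_fun setT g -> (forall x, `|g x| <= C) ->
  \int[P]_om g (S c k.+1 om) = \int[P]_om smooth F0 xi c g (S c k om).
Proof.
move=> mg gC.
pose G (p : k.-tuple TW * TW) := (g (c * \sum_(i < k) xi (tnth p.1 i) + c * xi p.2))%:E.
have mG : measurable_fun setT G.
  apply/measurable_EFinP; apply: measurableT_comp => //; apply: measurable_funD.
    apply: measurable_funM => //; apply: measurable_sum => i.
    apply: measurableT_comp => //.
    by apply: (measurableT_comp (measurable_tnth i)).
  by apply: measurable_funM => //; exact: measurableT_comp.
have GE om : (g (S c k.+1 om))%:E = G (subsample (W := W) (fun i : 'I_k => i : nat) om, W k om).
  rewrite /G /S /= big_ord_recr /= mulrDr; congr (g (_ * _ + _))%:E.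
  by apply: eq_bigr => i _; rewrite tnth_mktuple.
rewrite /Rintegral; under eq_integral do rewrite GE.
rewrite (fresh_integral hW).
- congr fine; apply: eq_integral => om _.
  rewrite /smooth /Rintegral fineK; last first.
    exact: (integrable_fin_num measurableT (smooth_integrable F0 mxi c _ mg gC)).
  apply: eq_integral => w _; rewrite /G /S /=; congr (g (_ * _ + _))%:E.
  by apply: eq_bigr => i _; rewrite tnth_mktuple.
- by move=> i; rewrite ltn_eqF.
- exact: mG.
- apply: eq_integrable (probability_bounded_integrable P (mgS c k.+1 mg) _) => //.
    by move=> om _; rewrite -GE.
Qed.

Context {dN : measure_display} {TN : measurableType dN}.
Variables (nu : probability TN R) (eta : TN -> R).
Hypothesis meta : measurable_fun setT eta.
Hypothesis nu0 : (\int[nu]_z (eta z)%:E = 0)%E.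
Hypothesis nuV : (\int[nu]_z (eta z ^+ 2)%:E = V%:E)%E.

(* The steps of the sum are replaced one by one by steps of law nu; both
   one-step expansions agree up to order two because the first two moments of
   xi and eta do. *)
Lemma lindeberg_swap c C k f f1 f2 : testfun C f f1 f2 ->
  `|\int[P]_om f (S c k om) - iter k (smooth nu eta c) f 0| <=
  k%:R * (C * lindeberg_err F0 xi c + C * lindeberg_err nu eta c).
Proof.
elim: k f f1 f2 => [|k IH] f f1 f2 tf.
  rewrite /S mul0r /=; under eq_Rintegral do rewrite big_ord0 mulr0.
  by rewrite Rintegral_probability_cst subrr normr0.
have [mf _ _ b _] := tf.
have fC x : `|f x| <= C by case: (b x).
rewrite (Rintegral_sum_step c k mf fC) iterSr.
have mA := measurable_smooth F0 mxi c mf fC.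
have mB := measurable_smooth nu meta c mf fC.
have bA x := le_norm_smooth F0 mxi c x mf fC.
have bB x := le_norm_smooth nu meta c x mf fC.
have iA := probability_bounded_integrable P (mgS c k mA) (fun om => bA _).
have iB := probability_bounded_integrable P (mgS c k mB) (fun om => bB _).
(* The last summand is replaced first. The remaining ones are then treated with the smoothed
   function as test function, again of class [testfun] with constant [C]. *)
have := IH _ _ _ (testfun_smooth nu meta c tf).
have : `|\int[P]_om smooth F0 xi c f (S c k om) - \int[P]_om smooth nu eta c f (S c k om)| <=
    C * lindeberg_err F0 xi c + C * lindeberg_err nu eta c.
  rewrite -RintegralB //; apply: le_norm_Rintegral_cst.
    by apply: measurable_funB; exact: mgS.
  move=> om; set x := S c k om.
  have h1 := smooth_expansion mxi xi0 xiV c x tf.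
  have h2 := smooth_expansion meta nu0 nuV c x tf.
  rewrite -[X in `|X|](_ : smooth F0 xi c f x - f x - c ^+ 2 * V / 2 * f2 x -
     (smooth nu eta c f x - f x - c ^+ 2 * V / 2 * f2 x) = _); last by ring.
  by apply: (le_trans (ler_normB _ _)); exact: lerD.
move=> h1 h2; rewrite mulr_natl mulrS -mulr_natl.
rewrite -(subrKA (\int[P]_om smooth nu eta c f (S c k om))).
by apply: (le_trans (ler_normD _ _)); exact: lerD.
Qed.

Lemma cvg_lindeberg_swap C f f1 f2 : testfun C f f1 f2 ->
  \int[P]_om f (S (Num.sqrt n%:R)^-1 n om) - iter n (smooth nu eta (Num.sqrt n%:R)^-1) f 0
    @[n --> \oo] --> (0 : R).
Proof.
move=> tf.
pose c n := (Num.sqrt n%:R : R)^-1.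
have h : C * (n%:R * lindeberg_err F0 xi (c n)) + C * (n%:R * lindeberg_err nu eta (c n))
    @[n --> \oo] --> (0 : R).
  rewrite -[X in _ --> X](addr0 0) -{1}(mulr0 C) -{2}(mulr0 C).
  apply: cvgD; (apply: cvgM; first exact: cvg_cst).
    exact: (cvg_lindeberg_err mxi xiV).
  exact: (cvg_lindeberg_err meta nuV).
apply/cvgr0Pnorm_le => e e0.
have /cvgr0Pnorm_le := h => /(_ e e0); apply: filterS => n hn.
apply: (le_trans (lindeberg_swap _ _ tf)); apply: le_trans hn.
apply: le_trans (ler_norm _); rewrite le_eqVlt; apply/orP; left; apply/eqP.
by rewrite /c; ring.
Qed.

End lindeberg.

Section gaussian_iterates.
Context {R : realType}.

(** Variances of independent normal steps add up. At least one step is taken, since no step at all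
    would correspond to a point mass, which [normal_prob] with zero deviation is not. *)
Lemma iter_smooth_normal_prob (C s c x : R) (f : R -> R) j :
  0 < s -> 0 < c -> continuous f -> (forall y, 0 <= f y) -> (forall y, `|f y| <= C) ->
  ((iter j.+1 (smooth (normal_prob 0 s) id c) f x)%:E =
   \int[normal_prob 0 (c * s * Num.sqrt j.+1%:R)]_u (f (x + u))%:E)%E.
Proof.
move=> s0 c0 cf f0 fC; have mf := continuous_measurable_fun cf.
have mid : measurable_fun setT (@id R) by exact: measurable_id.
have cs : 0 < c * s by rewrite mulr_gt0.
have smoothE (g : R -> R) y : measurable_fun setT g -> (forall z, `|g z| <= C) ->
    ((smooth (normal_prob 0 s) id c g y)%:E = \int[normal_prob 0 s]_z (g (y + c * z))%:E)%E.
  move=> mg gC; rewrite /smooth /Rintegral fineK //.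
  exact: (integrable_fin_num measurableT (smooth_integrable (normal_prob 0 s) mid c y mg gC)).
have iterP i : measurable_fun setT (iter i (smooth (normal_prob 0 s) id c) f) /\
    (forall z, `|iter i (smooth (normal_prob 0 s) id c) f z| <= C).
  elim: i => [|i [mi bi]]; first by split.
  by split => [|z]; [exact: measurable_smooth bi|exact: le_norm_smooth].
elim: j x => [|j IH] x.
  have -> : c * s * Num.sqrt 1%:R = c * s by rewrite sqrtr1 mulr1.
  rewrite (smoothE f x mf fC).
  exact: ge0_integral_normal_prob_dilation.
rewrite iterS; have [mi bi] := iterP j.+1; rewrite (smoothE _ x mi bi).
under eq_integral do rewrite IH.
set t := c * s * Num.sqrt j.+1%:R.
have t0 : 0 < t by rewrite mulr_gt0 // sqrtr_gt0.
have mH : measurable_fun setT (fun p : R * R => (f (x + c * p.1 + p.2))%:E).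
  apply/measurable_EFinP; apply: measurableT_comp => //.
  by apply: measurable_funD => //; apply: measurable_funD => //; exact: measurable_funM.
have H0 (p : R * R) : (0 <= (f (x + c * p.1 + p.2))%:E)%E by rewrite lee_fin.
rewrite (@fubini_tonelli _ _ _ _ _ (normal_prob 0 s) (normal_prob 0 t) _ mH H0).
transitivity (\int[normal_prob 0 t]_u \int[normal_prob 0 (c * s)]_y (f (x + u + y))%:E)%E.
  apply: eq_integral => u _; rewrite -ge0_integral_normal_prob_dilation //.
  by apply: eq_integral => z _; rewrite addrAC.
have <- : Num.sqrt (t ^+ 2 + (c * s) ^+ 2) = c * s * Num.sqrt j.+2%:R.
  rewrite /t [in LHS]exprMn sqr_sqrtr // -[X in _ + X]mulr1 -mulrDr natr1.
  by rewrite sqrtrM ?sqr_ge0 // sqrtr_sqr gtr0_norm.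
exact: ge0_integral_normal_prob_conv.
Qed.

End gaussian_iterates.

Section clt.
Context {R : realType} {d dW : measure_display}.
Context {Omega : measurableType d} {TW : measurableType dW}.
Context {P : probability Omega R} {F0 : probability TW R}.
Context {W : nat -> {RV P >-> TW}}.
Hypothesis hW : iid_copies F0 W.
Variables (xi : TW -> R) (V : R).
Hypothesis mxi : measurable_fun setT xi.
Hypothesis xi0 : (\int[F0]_w (xi w)%:E = 0)%E.
Hypothesis xiV : (\int[F0]_w (xi w ^+ 2)%:E = V%:E)%E.

Let S n om := (Num.sqrt n%:R)^-1 * \sum_(i < n) xi (W i om).

(** For every n >= 1, the sum of n normal steps of variance [V] scaled by n^(-1/2) has law N(0, V)
    exactly, so the comparison term in [cvg_lindeberg_swap] does not depend on n. *)
Lemma clt_sigm_normal a b : 0 < V ->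
  \int[P]_om sigm a b (S n om) @[n --> \oo] -->
  \int[normal_prob 0 (Num.sqrt V)]_z sigm a b z.
Proof.
move=> V0; have s0 : 0 < Num.sqrt V by rewrite sqrtr_gt0.
have [C [f1 [f2 tf]]] := testfun_sigm a b.
have nuV := integral_normal_prob_sqr s0; rewrite sqr_sqrtr ?ltW // in nuV.
have mid : measurable_fun setT (@id R) by exact: measurable_id.
have H := cvg_lindeberg_swap hW mxi xi0 xiV (nu := normal_prob 0 (Num.sqrt V)) mid
  (integral_normal_prob_id s0) nuV tf.
apply/subr_cvg0; apply: cvg_trans H; apply: near_eq_cvg; near=> n.
have n0 : (0 < n)%N by near: n; exact: nbhs_infty_gt.
have sn0 : 0 < Num.sqrt n%:R :> R by rewrite sqrtr_gt0 ltr0n.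
congr (_ - _).
have tb y : `|sigm a b y| <= C by case: tf => _ _ _ h _; case: (h y).
have s0' : forall y, 0 <= sigm a b y by move=> y; rewrite ltW // sigm_gt0.
have c0 : 0 < (Num.sqrt n%:R)^-1 :> R by rewrite invr_gt0.
have := iter_smooth_normal_prob 0 n.-1 s0 c0 (@continuous_sigm _ a b) s0' tb.
rewrite (prednK n0).
have -> : (Num.sqrt n%:R)^-1 * Num.sqrt V * Num.sqrt n%:R = Num.sqrt V.
  by rewrite mulrAC mulVf ?mul1r // gt_eqF.
move=> /(congr1 fine) /= ->; rewrite /Rintegral; congr fine.
by apply: eq_integral => z _; rewrite add0r.
Unshelve. all: by end_near. Qed.

(** The same comparison with steps equal to zero: smoothing by the point mass is the identity. *)
Lemma clt_sigm_dirac a b : V = 0 ->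
  \int[P]_om sigm a b (S n om) @[n --> \oo] --> \int[\d_(0%R : R)]_z sigm a b z.
Proof.
move=> V0; have [C [f1 [f2 tf]]] := testfun_sigm a b.
have d0 : (\int[\d_(0%R : R)]_z z%:E = 0)%E by rewrite integral_dirac // diracT mul1e.
have dV : (\int[\d_(0%R : R)]_z (z ^+ 2)%:E = V%:E)%E.
  rewrite integral_dirac ?diracT ?mul1e ?V0 ?expr0n //.
  by apply/measurable_EFinP; exact: measurable_funX.
have mid : measurable_fun setT (@id R) by exact: measurable_id.
have H := cvg_lindeberg_swap hW mxi xi0 xiV mid d0 dV tf.
apply/subr_cvg0; apply: cvg_trans H; apply: near_eq_cvg; apply: nearW => n.
congr (_ - _).
have smE c g : measurable_fun setT g -> smooth \d_(0%R : R) id c g = g.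
  move=> mg; apply/funext => x; rewrite /smooth /Rintegral integral_dirac //.
    by rewrite diracT mul1e mulr0 addr0.
  by apply/measurable_EFinP; exact: (measurable_affine_comp mid c x mg).
have -> k : iter k (smooth \d_(0%R : R) id (Num.sqrt n%:R)^-1) (sigm a b) = sigm a b.
  by elim: k => //= k ->; rewrite smE //; exact: measurable_sigm.
rewrite /Rintegral integral_dirac // ?diracT ?mul1e //.
by apply/measurable_EFinP; exact: measurable_sigm.
Qed.

End clt.

(** * From sigmoid averages to distribution functions *)

Section portmanteau.
Context {R : realType}.

Lemma probability_le_sigm d (T : measurableType d) (Q : probability T R) (Z : T -> R) (a b e : R) :
  0 < a -> measurable_fun setT Z ->
  fine (Q [set w | Z w <= b - e]) <= \int[Q]_w sigm a b (Z w) + expR (- (a * e)).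
Proof.
move=> a0 mZ.
have mB : measurable [set w | Z w <= b - e].
  by rewrite -[X in measurable X]setTI; exact: (@measurable_fun_ler _ _ _ _ Z (cst (b - e))).
have i1 : Q.-integrable setT (EFin \o (fun w => sigm a b (Z w))).
  apply: (@probability_bounded_integrable _ _ _ Q 1).
    by apply: measurableT_comp => //; exact: measurable_sigm.
  by move=> w; rewrite ger0_norm ?ltW // ?sigm_lt1 // sigm_gt0.
have i2 : Q.-integrable setT (EFin \o cst (expR (- (a * e)))).
  exact: finite_measure_integrable_cst.
have -> : \int[Q]_w sigm a b (Z w) + expR (- (a * e)) =
    \int[Q]_w (sigm a b (Z w) + cst (expR (- (a * e))) w).
  by rewrite (RintegralD measurableT i1 i2) Rintegral_probability_cst.
have -> : fine (Q [set w | Z w <= b - e]) = \int[Q]_w \1_[set w | Z w <= b - e] w.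
  by rewrite /Rintegral integral_indic // setIT.
apply: le_Rintegral => //.
- exact: integrable_indic.
- exact: (integrableD measurableT i1 i2).
- move=> w _ /=; rewrite indicE; have [/set_mem /= h|_] := boolP (w \in _).
    by have := sigm_ge a0 h; lra.
  by rewrite addr_ge0 ?expR_ge0 // ltW // sigm_gt0.
Qed.

Lemma sigm_le_probability d (T : measurableType d) (Q : probability T R) (Z : T -> R) (a b e : R) :
  0 < a -> measurable_fun setT Z ->
  \int[Q]_w sigm a b (Z w) <= fine (Q [set w | Z w <= b + e]) + expR (- (a * e)).
Proof.
move=> a0 mZ.
have mB : measurable [set w | Z w <= b + e].
  by rewrite -[X in measurable X]setTI; exact: (@measurable_fun_ler _ _ _ _ Z (cst (b + e))).
have i1 : Q.-integrable setT (EFin \o (fun w => sigm a b (Z w))).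
  apply: (@probability_bounded_integrable _ _ _ Q 1).
    by apply: measurableT_comp => //; exact: measurable_sigm.
  by move=> w; rewrite ger0_norm ?ltW // ?sigm_lt1 // sigm_gt0.
have i2 : Q.-integrable setT (EFin \o cst (expR (- (a * e)))).
  exact: finite_measure_integrable_cst.
have i3 : Q.-integrable setT (EFin \o \1_[set w | Z w <= b + e]).
  exact: integrable_indic.
have -> : fine (Q [set w | Z w <= b + e]) + expR (- (a * e)) =
    \int[Q]_w (\1_[set w | Z w <= b + e] w + cst (expR (- (a * e))) w).
  rewrite (RintegralD measurableT i3 i2) Rintegral_probability_cst; congr (fine _ + _).
  by rewrite integral_indic // setIT.
apply: le_Rintegral => //.
- exact: (integrableD measurableT i3 i2).
- move=> w _ /=; rewrite indicE; have [_|] := boolP (w \in _).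
    by have := sigm_lt1 a b (Z w); have := expR_gt0 (- (a * e)); rewrite /=; lra.
  rewrite notin_setE /= => /negP; rewrite -ltNge add0r => /ltW h.
  exact: sigm_le.
Qed.

Context {d : measure_display} {Omega : measurableType d}.
Variable P : probability Omega R.

(** The event that Z <= x is enclosed, up to a bad event, between events on [S], these between
    sigmoid averages, and those between values of the limiting distribution function near [x].
    Slutsky's lemma is built in through the last hypothesis. *)
Lemma cvg_in_distr_sigm (mu : probability (measurableTypeR R) R) (S Z : nat -> Omega -> R) :
  (forall n, measurable_fun setT (S n)) -> (forall n, measurable_fun setT (Z n)) ->
  (forall a b, \int[P]_om sigm a b (S n om) @[n --> \oo] --> \int[mu]_z sigm a b z) ->
  cvg_in_prob P (fun n om => Z n om - S n om) 0 ->
  cvg_in_distr P Z mu.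
Proof.
move=> mS mZ cS cZ x cF.
pose F y := fine (mu [set y' | y' <= y]).
have FE y : mu [set` `]-oo, y]] = (F y)%:E.
  by rewrite set_itvNyc fineK //; apply: fin_num_measure; rewrite -set_itvNyc.
have mZx n y (Q : nat -> Omega -> R) : (forall n, measurable_fun setT (Q n)) ->
    measurable [set om | Q n om <= y].
  move=> mQ; rewrite -[X in measurable X]setTI.
  exact: (@measurable_fun_ler _ _ _ _ (Q n) (cst y)).
rewrite FE; apply/fine_cvgP; split.
  by apply: nearW => n; apply: fin_num_measure; exact: mZx.
apply/cvgrPdist_le => e0 e00.
(* Five errors occur on each side: the bad event, two sigmoid tails, the convergence of the
   averages, and the variation of [F] near [x]. *)
pose e := e0 / 5; have e_gt0 : 0 < e by rewrite divr_gt0.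
have [dl dl0 Fdl] : exists2 dl : R, 0 < dl & forall y, `|x - y| <= 3 * dl -> `|F x - F y| <= e.
  have : F y @[y --> x] --> F x.
    have : (F y)%:E @[y --> x] --> (F x)%:E.
      rewrite -FE (_ : (fun y => (F y)%:E) = (fun y => mu [set` `]-oo, y]])); first exact: cF.
      by apply/funext => y; rewrite FE.
    by move=> /fine_cvgP[].
  move=> /cvgrPdist_le/(_ _ e_gt0)[r /= r0 hr].
  exists (r / 4); first by rewrite divr_gt0.
  by move=> y hy; apply: hr => /=; apply: (le_lt_trans hy); lra.
(* The slope for which the sigmoid tail at distance [dl] is at most [e]. The cap 1/2 keeps the
   logarithm negative and hence [a] positive. *)
pose a := - ln (Num.min e (1 / 2)) / dl.
have m0 : 0 < Num.min e (1 / 2) by rewrite lt_min e_gt0 divr_gt0.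
have a0 : 0 < a.
  by rewrite divr_gt0 // oppr_gt0 ln_lt0 // m0 /= gt_min; apply/orP; right; lra.
have ae : expR (- (a * dl)) <= e.
  by rewrite /a divfK ?gt_eqF // opprK lnK ?posrE // ge_min lexx.
(* The upper sigmoid is centered at x + 2 dl, at distance [dl] from both x + dl, which allows for
   the gap between [Z] and [S], and x + 3 dl, where [F] is evaluated. The lower one is symmetric. *)
have [b1 b1E] : exists b, b = x + 2 * dl by exists (x + 2 * dl).
have [b2 b2E] : exists b, b = x - 2 * dl by exists (x - 2 * dl).
have [Iu IuE] : exists I, I = \int[mu]_z sigm a b1 z by eexists.
have [Il IlE] : exists I, I = \int[mu]_z sigm a b2 z by eexists.
have c1 : \forall n \near \oo, `|Iu - \int[P]_om sigm a b1 (S n om)| <= e.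
  by rewrite IuE; have /cvgrPdist_le/(_ _ e_gt0) := cS a b1.
have c2 : \forall n \near \oo, `|Il - \int[P]_om sigm a b2 (S n om)| <= e.
  by rewrite IlE; have /cvgrPdist_le/(_ _ e_gt0) := cS a b2.
have c3 := (cvg_in_probP P 0 (fun n => measurable_funB (mZ n) (mS n))).1 cZ _ _ dl0 e_gt0.
have mid : measurable_fun setT (@id R) by exact: measurable_id.
apply: filterS3 c1 c2 c3 => n d1 d2 [B [mB PB hB]].
have u1 := probability_le_sigm P b1 dl a0 (mS n).
have u2 : Iu <= F (x + 3 * dl) + expR (- (a * dl)).
  rewrite (_ : x + 3 * dl = b1 + dl); last by rewrite b1E; ring.
  by rewrite IuE; exact: (sigm_le_probability mu b1 dl a0 mid).
have l1 : F (x - 3 * dl) <= Il + expR (- (a * dl)).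
  rewrite (_ : x - 3 * dl = b2 - dl); last by rewrite b2E; ring.
  by rewrite IlE; exact: (probability_le_sigm mu b2 dl a0 mid).
have l2 := sigm_le_probability P b2 dl a0 (mS n).
rewrite (_ : b1 - dl = x + dl) in u1; last by rewrite b1E; ring.
rewrite (_ : b2 + dl = x - dl) in l2; last by rewrite b2E; ring.
have Fu : `|F x - F (x + 3 * dl)| <= e.
  by apply: Fdl; rewrite opprD addNKr normrN ger0_norm // mulr_ge0 // ltW.
have Fl : `|F x - F (x - 3 * dl)| <= e.
  by apply: Fdl; rewrite opprB addrCA subrr addr0 ger0_norm // mulr_ge0 // ltW.
have PBf : fine (P B) <= e by rewrite -lee_fin fineK //; exact: fin_num_measure.
have le_fine (A1 A2 : set Omega) : measurable A1 -> measurable A2 -> A1 `<=` A2 `|` B ->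
    fine (P A1) <= fine (P A2) + fine (P B).
  move=> m1 m2 A12.
  have f1 := fin_num_measure P _ m1; have f2 := fin_num_measure P _ m2.
  have f3 := fin_num_measure P _ mB.
  rewrite -lee_fin EFinD !fineK //; apply: le_trans (measureU2 _ m2 mB).
  by apply: le_measure; rewrite ?inE //; exact: measurableU.
have U : fine (P [set om | Z n om <= x]) <= fine (P [set om | S n om <= x + dl]) + fine (P B).
  apply: le_fine; [exact: mZx|exact: mZx|] => om /= Zx.
  have [|nB] := pselect (B om); first by right.
  have /= := hB _ nB; rewrite subr0 ltr_norml => /andP[h1 h2]; left => /=.
  lra.
have Lw : fine (P [set om | S n om <= x - dl]) <= fine (P [set om | Z n om <= x]) + fine (P B).
  apply: le_fine; [exact: mZx|exact: mZx|] => om /= Zx.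
  have [|nB] := pselect (B om); first by right.
  have /= := hB _ nB; rewrite subr0 ltr_norml => /andP[h1 h2]; left => /=.
  lra.
have e5 : e0 = 5 * e by rewrite /e; field.
rewrite /= e5; clearbody e F; clear - U Lw d1 d2 u1 u2 l1 l2 PBf ae Fu Fl.
move: U Lw d1 d2 u1 u2 l1 l2 PBf ae Fu Fl.
move: (fine _) (fine _) (fine _) (fine _) (Rintegral _ _ _) (Rintegral _ _ _) (expR _).
move=> ? ? ? ? ? ? ?; rewrite !ler_norml.
move=> ? ? /andP[? ?] /andP[? ?] ? ? ? ? ? ? /andP[? ?] /andP[? ?].
by apply/andP; split; lra.
Qed.

End portmanteau.

(** * Square-integrable functions and conditional expectation *)

Section square_integrable.
Context {R : realType} {d : measure_display} {T : measurableType d}.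
Variable Q : probability T R.
Implicit Types f g : T -> R.

Definition sqr_int f :=
  measurable_fun setT f /\ Q.-integrable setT (fun w => (f w ^+ 2)%:E).

Lemma sqr_int_lty f : measurable_fun setT f ->
  (\int[Q]_w (f w ^+ 2)%:E < +oo)%E -> sqr_int f.
Proof.
move=> mf fy; split => //; apply/integrableP; split.
  by apply/measurable_EFinP; exact: measurable_funX.
by under eq_integral do rewrite gee0_abs ?lee_fin ?sqr_ge0 //.
Qed.

Lemma sqr_int_dominated f g c : measurable_fun setT f -> sqr_int g ->
  {ae Q, forall w, `|f w| <= c * `|g w|} -> sqr_int f.
Proof.
move=> mf [mg ig] fg; apply: sqr_int_lty => //.
apply: (@le_lt_trans _ _ (\int[Q]_w ((c ^+ 2)%:E * (g w ^+ 2)%:E))%E); last first.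
  by have /integrable_lty := integrableZl measurableT (c ^+ 2) ig; apply.
apply: ae_ge0_le_integral => //=.
- by move=> w _; rewrite lee_fin sqr_ge0.
- by apply/measurable_EFinP; exact: measurable_funX.
- by move=> w _; rewrite mule_ge0 // lee_fin sqr_ge0.
- by apply/measurable_EFinP; apply: measurable_funM => //; exact: measurable_funX.
- apply: filterS fg => w h _; rewrite -EFinM lee_fin.
  rewrite -(real_normK (num_real (f w))) -(real_normK (num_real (g w))) -exprMn.
  by rewrite lerXn2r // nnegrE (le_trans _ h).
Qed.

Lemma sqr_intD f g : sqr_int f -> sqr_int g -> sqr_int (fun w => f w + g w).
Proof.
move=> [mf jf] [mg jg]; apply: sqr_int_lty; first exact: measurable_funD.
have i2 : Q.-integrable setT (fun w => (2%:E * ((f w ^+ 2)%:E + (g w ^+ 2)%:E))%E).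
  by apply: integrableZl => //; exact: integrableD.
apply: le_lt_trans (integrable_lty measurableT i2).
apply: ge0_le_integral => //=.
- by move=> w _; rewrite lee_fin sqr_ge0.
- by apply/measurable_EFinP; apply: measurable_funX; exact: measurable_funD.
- exact: measurable_int i2.
- move=> w _; rewrite -EFinD -EFinM lee_fin.
  by have := sqr_ge0 (f w - g w); rewrite sqrrB sqrrD; lra.
Qed.

Lemma sqr_intZ c f : sqr_int f -> sqr_int (fun w => c * f w).
Proof.
move=> sf; apply: (sqr_int_dominated (c := `|c|) _ sf).
  by case: sf => mf _; exact: measurable_funM.
by apply: aeW => w; rewrite normrM.
Qed.

Lemma sqr_intB f g : sqr_int f -> sqr_int g -> sqr_int (fun w => f w - g w).
Proof.
move=> sf sg; have := sqr_intD sf (sqr_intZ (-1) sg).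
by congr sqr_int; apply/funext => w; rewrite mulN1r.
Qed.

Lemma sqr_int_cst c : sqr_int (cst c).
Proof. by split => //; exact: (finite_measure_integrable_cst Q (c ^+ 2)). Qed.

Lemma sqr_int_mul f g : sqr_int f -> sqr_int g ->
  Q.-integrable setT (EFin \o (fun w => f w * g w)).
Proof.
move=> [mf jf] [mg jg].
apply: (@le_integrable _ _ _ _ _ measurableT _ (fun w => ((f w ^+ 2)%:E + (g w ^+ 2)%:E)%E)) => //.
- by apply/measurable_EFinP; exact: measurable_funM.
- move=> w _ /=; rewrite lee_fin normrM [leRHS]ger0_norm ?addr_ge0 ?sqr_ge0 //.
  rewrite -(real_normK (num_real (f w))) -(real_normK (num_real (g w))).
  by have := sqr_ge0 (`|f w| - `|g w|); have := normr_ge0 (f w);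
     have := normr_ge0 (g w); nra.
- exact: integrableD.
Qed.

Lemma sqr_int_integrable f : sqr_int f -> Q.-integrable setT (EFin \o f).
Proof.
move=> sf; have := sqr_int_mul sf (sqr_int_cst 1).
by congr (Q.-integrable _ _); apply/funext => w /=; rewrite mulr1.
Qed.

Lemma Rintegral_sqr_ge0 f : 0 <= \int[Q]_w (f w ^+ 2).
Proof. by apply: Rintegral_ge0 => w _; exact: sqr_ge0. Qed.

Lemma Rintegral_sqrE f : sqr_int f ->
  (\int[Q]_w (f w ^+ 2)%:E = (\int[Q]_w (f w ^+ 2))%:E)%E.
Proof. by move=> [_ jf]; rewrite /Rintegral fineK //; exact: (integrable_fin_num _ jf). Qed.

Lemma cauchy_schwarz f g : sqr_int f -> sqr_int g ->
  `|\int[Q]_w (f w * g w)| <=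
  Num.sqrt (\int[Q]_w (f w ^+ 2)) * Num.sqrt (\int[Q]_w (g w ^+ 2)).
Proof.
move=> sf sg; have [[mf jf] [mg jg]] := (sf, sg).
set A := \int[Q]_w (f w ^+ 2); set B := \int[Q]_w (g w ^+ 2).
set C := \int[Q]_w (f w * g w).
have young l : 0 < l -> 2 * `|C| <= l * A + l^-1 * B.
  move=> l0; rewrite /A /B -!RintegralZl // -RintegralD //; last 2 first.
  - exact: (integrableZl measurableT l jf).
  - exact: (integrableZl measurableT l^-1 jg).
  apply: (@le_trans _ _ (2 * \int[Q]_w `|f w * g w|)).
    by rewrite ler_pM2l //; apply: le_normr_Rintegral => //; exact: sqr_int_mul.
  rewrite -RintegralZl //; last exact: (integrable_norm (sqr_int_mul sf sg)).
  apply: le_Rintegral => //.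
  - exact: (integrableZl measurableT 2 (integrable_norm (sqr_int_mul sf sg))).
  - exact: (integrableD measurableT (integrableZl measurableT l jf)
      (integrableZl measurableT l^-1 jg)).
  - move=> w _; rewrite normrM.
    have l1 : l * l^-1 = 1 by rewrite divff // gt_eqF.
    have li : 0 < l^-1 by rewrite invr_gt0.
    rewrite -(real_normK (num_real (f w))) -(real_normK (num_real (g w))).
    have := mulr_ge0 (ltW li) (sqr_ge0 (l * `|f w| - `|g w|)).
    rewrite (_ : l^-1 * _ = (l * l^-1) * (l * `|f w| ^+ 2) - (l * l^-1) * (2 * (`|f w| * `|g w|)) +
       l^-1 * `|g w| ^+ 2); last by ring.
    by rewrite l1; lra.
have A0 : 0 <= A by exact: Rintegral_sqr_ge0.
have B0 : 0 <= B by exact: Rintegral_sqr_ge0.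
set a := Num.sqrt A; set b := Num.sqrt B.
have AE : A = a ^+ 2 by rewrite sqr_sqrtr.
have BE : B = b ^+ 2 by rewrite sqr_sqrtr.
have a0 : 0 <= a by exact: sqrtr_ge0.
have b0 : 0 <= b by exact: sqrtr_ge0.
(* Young's inequality with the nearly optimal weight (b + e)/(a + e); adding [e] avoids division by
   zero when a norm vanishes. *)
have eta_bound e : 0 < e -> `|C| <= (a + e) * (b + e).
  move=> e0; have ae : 0 < a + e by rewrite ltr_wpDl.
  have be : 0 < b + e by rewrite ltr_wpDl.
  have := young ((b + e) / (a + e)) (divr_gt0 be ae); rewrite AE BE invf_div.
  have h1 : (b + e) / (a + e) * a ^+ 2 <= (b + e) * (a + e).
    rewrite -mulrA ler_pM2l // mulrC ler_pdivrMr // -expr2.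
    by rewrite lerXn2r // ?nnegrE ?(ltW ae) // lerDl ltW.
  have h2 : (a + e) / (b + e) * b ^+ 2 <= (a + e) * (b + e).
    rewrite -mulrA ler_pM2l // mulrC ler_pdivrMr // -expr2.
    by rewrite lerXn2r // ?nnegrE ?(ltW be) // lerDl ltW.
  lra.
apply/ler_addgt0Pl => e e0.
(* For h <= 1 the product (a + h)(b + h) exceeds ab by at most h (a + b + 1), hence by at most
   [e]. *)
pose h := Num.min 1 (e / (a + b + 1)).
have ab1 : 0 < a + b + 1 by rewrite ltr_wpDl // addr_ge0.
have h0 : 0 < h by rewrite lt_min ltr01 divr_gt0.
have h1 : h <= 1 by rewrite ge_min lexx.
have h2 : h * (a + b + 1) <= e by rewrite -ler_pdivlMr // ge_min lexx orbT.
by have := eta_bound _ h0; nra.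
Qed.

End square_integrable.

Section conditional_expectation.
Context {R : realType} {dW dX : measure_display}.
Context {TW : measurableType dW} {TX : measurableType dX}.
Context {F0 : probability TW R}.
Variable X : {RV F0 >-> TX}.
Import HBNNSimple.

Lemma nnsfun_approximation (b : TX -> R) : measurable_fun setT b ->
  (forall x, 0 <= b x) -> exists s : {nnsfun TX >-> R} ^nat,
  [/\ forall n x, s n x <= b x, forall x, {homo s ^~ x : n m / (n <= m)%N >-> n <= m} &
      forall x, s n x @[n --> \oo] --> b x].
Proof.
move=> mb b0; have /measurable_EFinP mb' := mb.
have b0' : forall x, setT x -> (0 <= (EFin \o b) x)%E by move=> x _; rewrite lee_fin.
pose s := nnsfun_approx measurableT mb'.
have nd x : {homo s ^~ x : n m / (n <= m)%N >-> n <= m}.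
  by move=> n m nm; have /lefP := nd_nnsfun_approx measurableT mb' nm; exact.
have cv x : s n x @[n --> \oo] --> b x.
  by have /fine_cvgP[_] := cvg_nnsfun_approx measurableT mb' b0' (I : setT x).
exists s; split => // n x.
have := @nondecreasing_cvgn_le R (s ^~ x) (nd x) (cvgP _ (cv x)) n.
by rewrite (cvg_lim _ (cv x)).
Qed.

Lemma sub_condexp Z Z' g g' : is_condexp F0 X Z g -> is_condexp F0 X Z' g' ->
  is_condexp F0 X (fun w => Z w - Z' w) (fun x => g x - g' x).
Proof.
move=> [iZ mg ig h] [iZ' mg' ig' h']; split.
- exact: (integrableB measurableT iZ iZ').
- exact: measurable_funB.
- exact: (integrableB measurableT ig ig').
- move=> B mB; have mXB : measurable (X @^-1` B) by apply: measurable_funPTI.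
  have iS f : F0.-integrable setT f -> F0.-integrable (X @^-1` B) f.
    by apply: integrableS.
  rewrite (integralB_EFin mXB (iS _ ig) (iS _ ig')).
  by rewrite (integralB_EFin mXB (iS _ iZ) (iS _ iZ')) h // h'.
Qed.

Variables (Z : TW -> R) (g : TX -> R).
Hypothesis cZ : is_condexp F0 X Z g.

Let iZ : F0.-integrable setT (EFin \o Z). Proof. by case: cZ. Qed.
Let ig : F0.-integrable setT (EFin \o (g \o X)). Proof. by case: cZ. Qed.

Let set_integralE (B : set TX) (f : TW -> R) : 
  (\int[F0]_(w in X @^-1` B) (f w)%:E = \int[F0]_w (\1_B (X w) * f w)%:E)%E.
Proof.
rewrite integral_mkcond; apply: eq_integral => w _; rewrite patchE indicE.
have [h|h] := boolP (w \in _).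
  by rewrite (mem_set (set_mem h : B (X w))) mul1r.
rewrite (_ : (X w \in B) = false) ?mul0r //; apply/negbTE.
by rewrite notin_setE => h'; move: h; rewrite notin_setE; exact.
Qed.

Let int_indic (B : set TX) (f : TW -> R) : measurable B ->
  F0.-integrable setT (EFin \o f) ->
  F0.-integrable setT (EFin \o (fun w => \1_B (X w) * f w)).
Proof.
move=> mB jf; have /measurable_EFinP mf := measurable_int F0 jf.
have mI : measurable_fun setT (fun w => \1_B (X w) : R).
  by apply: (measurableT_comp (measurable_indic mB)).
apply: le_integrable jf => //.
- by apply/measurable_EFinP; exact: measurable_funM.
- move=> w _ /=; rewrite lee_fin normrM ler_piMl //.
  by rewrite indicE; case: (_ \in _); rewrite ?normr1 ?normr0.
Qed.

Let sfunE (s : {nnsfun TX >-> R}) (f : TW -> R) w :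
  (s (X w) * f w)%:E =
  (\sum_(k <- fset_set (range s)) (k%:E * (\1_(s @^-1` [set k]) (X w) * f w)%:E))%E.
Proof.
rewrite (fimfunE s (X w)) fsbig_finite // mulr_suml -sumEFin.
by apply: eq_bigr => k _; rewrite -mulrA EFinM.
Qed.

Lemma condexp_nnsfun (s : {nnsfun TX >-> R}) :
  (\int[F0]_w (s (X w) * Z w)%:E = \int[F0]_w (s (X w) * g (X w))%:E)%E.
Proof.
under eq_integral do rewrite sfunE.
under [RHS]eq_integral do rewrite (sfunE s (g \o X)).
have mk k : measurable (s @^-1` [set k]) by exact: measurable_sfunP.
rewrite !integral_sum //; last 2 first.
- by move=> k; apply: integrableZl => //; exact: (int_indic (mk k) ig).
- by move=> k; apply: integrableZl => //; exact: (int_indic (mk k) iZ).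
apply: eq_bigr => k _; rewrite !integralZl //; last 2 first.
- exact: (int_indic (mk k) ig).
- exact: (int_indic (mk k) iZ).
congr (_ * _)%E; have [_ _ _ h] := cZ.
by rewrite -(set_integralE _ Z) -(set_integralE _ (g \o X)) h.
Qed.

Let condexp_ge0_mul (b : TX -> R) : measurable_fun setT b -> (forall x, 0 <= b x) ->
  F0.-integrable setT (EFin \o (fun w => b (X w) * Z w)) ->
  F0.-integrable setT (EFin \o (fun w => b (X w) * g (X w))) ->
  (\int[F0]_w (b (X w) * Z w)%:E = \int[F0]_w (b (X w) * g (X w))%:E)%E.
Proof.
move=> mb b0 jZ jg; have [s [sb snd scv]] := nnsfun_approximation mb b0.
have lim (f : TW -> R) : F0.-integrable setT (EFin \o f) ->
    F0.-integrable setT (EFin \o (fun w => b (X w) * f w)) ->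
    (\int[F0]_w (s n (X w) * f w)%:E @[n --> \oo] --> \int[F0]_w (b (X w) * f w)%:E)%E.
  move=> jf jbf; have /measurable_EFinP mf := measurable_int F0 jf.
  have ms n : measurable_fun setT (fun w => (s n (X w) * f w)%:E).
    apply/measurable_EFinP; apply: measurable_funM => //.
    by apply: measurableT_comp.
  have cvs : {ae F0, forall w, setT w -> 
      (fun w => (s n (X w) * f w)%:E) w @[n --> \oo] --> (b (X w) * f w)%:E}.
    apply: aeW => w _; apply/cvg_EFin; first exact: nearW.
    by apply: cvgM; [exact: scv|exact: cvg_cst].
  have bds : {ae F0, forall w n, setT w ->
      (`|(s n (X w) * f w)%:E| <= `|(b (X w) * f w)|%:E)%E}.
    apply: aeW => w n _; rewrite lee_fin !normrM ler_wpM2r //.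
    by rewrite !ger0_norm.
  by have [] := @dominated_convergence _ _ _ F0 setT measurableT
    (fun n w => (s n (X w) * f w)%:E) (fun w => (b (X w) * f w)%:E) _
    ms (measurable_int F0 jbf) cvs (integrable_norm jbf) bds.
have l1 := lim Z iZ jZ; have l2 := lim (fun w => g (X w)) ig jg.
have E : (fun n => \int[F0]_w (s n (X w) * Z w)%:E)%E =
    (fun n => \int[F0]_w (s n (X w) * g (X w))%:E)%E.
  by apply/funext => n; exact: condexp_nnsfun.
rewrite E in l1; exact: (cvg_unique _ l1 l2).
Qed.

(** Passage from indicators to simple functions, then to nonnegative and signed multipliers. Since
    [b] may be unbounded, integrability of both products is a hypothesis; it supplies the domination
    in the limits. *)
Lemma condexp_mul (b : TX -> R) : measurable_fun setT b ->
  F0.-integrable setT (EFin \o (fun w => b (X w) * Z w)) ->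
  F0.-integrable setT (EFin \o (fun w => b (X w) * g (X w))) ->
  (\int[F0]_w (b (X w) * Z w)%:E = \int[F0]_w (b (X w) * g (X w))%:E)%E.
Proof.
move=> mb jZ jg.
pose bp x := Num.max (b x) 0; pose bn x := Num.max (- b x) 0.
have mbp : measurable_fun setT bp by exact: measurable_maxr.
have mbn : measurable_fun setT bn.
  by apply: measurable_maxr => //; exact: measurableT_comp.
have bp0 x : 0 <= bp x by rewrite le_max lexx orbT.
have bn0 x : 0 <= bn x by rewrite le_max lexx orbT.
have bE x : b x = bp x - bn x.
  by rewrite /bp /bn; have [h|h] := leP 0 (b x); have [h'|h'] := leP 0 (- b x); lra.
have bpb x : `|bp x| <= `|b x|.
  by rewrite ger0_norm // /bp ge_max ler_norm normr_ge0.
have bnb x : `|bn x| <= `|b x|.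
  by rewrite ger0_norm // /bn ge_max -normrN ler_norm normr_ge0.
have dom (c : TX -> R) (f : TW -> R) : measurable_fun setT c -> (forall x, `|c x| <= `|b x|) ->
    F0.-integrable setT (EFin \o f) ->
    F0.-integrable setT (EFin \o (fun w => b (X w) * f w)) ->
    F0.-integrable setT (EFin \o (fun w => c (X w) * f w)).
  move=> mc cb jf jbf; have /measurable_EFinP mf := measurable_int F0 jf.
  apply: le_integrable jbf => //.
  - by apply/measurable_EFinP; apply: measurable_funM => //; exact: measurableT_comp.
  - by move=> w _ /=; rewrite lee_fin !normrM ler_wpM2r.
have split (f : TW -> R) : F0.-integrable setT (EFin \o f) ->
    F0.-integrable setT (EFin \o (fun w => b (X w) * f w)) ->
    (\int[F0]_w (b (X w) * f w)%:E = \int[F0]_w (bp (X w) * f w)%:E -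
       \int[F0]_w (bn (X w) * f w)%:E)%E.
  move=> jf jbf; under eq_integral do rewrite bE mulrBl.
  by rewrite (integralB_EFin measurableT (dom _ _ mbp bpb jf jbf) (dom _ _ mbn bnb jf jbf)).
rewrite (split _ iZ jZ) (split _ ig jg).
rewrite (condexp_ge0_mul mbp bp0 (dom _ _ mbp bpb iZ jZ) (dom _ _ mbp bpb ig jg)).
by rewrite (condexp_ge0_mul mbn bn0 (dom _ _ mbn bnb iZ jZ) (dom _ _ mbn bnb ig jg)).
Qed.

Lemma condexp_le_bound (K : R) (u : TX -> R) : measurable_fun setT u ->
  (forall x, 0 <= u x) -> (forall w, 0 <= Z w) -> 0 <= K ->
  {ae F0, forall w, `|g (X w)| <= K} ->
  (\int[F0]_w (u (X w) * Z w)%:E <= K%:E * \int[F0]_w (u (X w))%:E)%E.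
Proof.
move=> mu u0 Z0 K0 gK; have [s [su snd scv]] := nnsfun_approximation mu u0.
have /measurable_EFinP mZ := measurable_int F0 iZ.
have muX : measurable_fun setT (fun w => u (X w)) by exact: measurableT_comp.
have msX n : measurable_fun setT (fun w => s n (X w)) by exact: measurableT_comp.
have mg : measurable_fun setT (fun w => g (X w)).
  by case: cZ => _ mg _ _; exact: measurableT_comp.
have cv : (\int[F0]_w (s n (X w) * Z w)%:E @[n --> \oo] --> \int[F0]_w (u (X w) * Z w)%:E)%E.
  have -> : (\int[F0]_w (u (X w) * Z w)%:E =
      \int[F0]_w limn (fun n => (s n (X w) * Z w)%:E))%E.
    apply: eq_integral => w _; apply/esym/cvg_lim => //.
    apply/cvg_EFin; first exact: nearW.
    by apply: cvgM; [exact: scv|exact: cvg_cst].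
  apply: cvg_monotone_convergence => //.
  - by move=> n; apply/measurable_EFinP; exact: measurable_funM.
  - by move=> n w _; rewrite lee_fin mulr_ge0.
  - by move=> w _ n m nm; rewrite lee_fin ler_wpM2r //; exact: snd.
rewrite -(cvg_lim _ cv) //; apply: lime_le; first exact: cvgP cv.
apply: nearW => n; rewrite condexp_nnsfun; apply: (le_trans (lee_abs _)).
have msg : measurable_fun setT (EFin \o (fun w => s n (X w) * g (X w))).
  by apply/measurable_EFinP; exact: measurable_funM.
apply: (le_trans (le_abse_integral _ measurableT msg)).
rewrite -ge0_integralZl //; last 2 first.
- exact/measurable_EFinP.
- by move=> w _; rewrite lee_fin.
apply: ae_ge0_le_integral => //=.
- by apply/measurable_EFinP; apply: measurableT_comp => //; exact: measurable_funM.
- by move=> w _; rewrite lee_fin mulr_ge0.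
- by apply/measurable_EFinP; exact: measurable_funM.
- apply: filterS gK => w gw _; rewrite lee_fin normrM mulrC ler_pM //.
  by rewrite ger0_norm.
Qed.

End conditional_expectation.

Lemma expectationE (R : realType) d (T : measurableType d) (Q : probability T R) (f : T -> R) :
  ('E_Q[f] = \int[Q]_w (f w)%:E)%E.
Proof. by rewrite unlock. Qed.

Lemma l2normE (R : realType) d (T : measurableType d) (Q : probability T R) (f : T -> R) :
  l2norm Q f = Num.sqrt (\int[Q]_w (f w ^+ 2)).
Proof. by rewrite /l2norm expectationE. Qed.

Lemma sqr_l2norm (R : realType) d (T : measurableType d) (Q : probability T R) (f : T -> R) :
  l2norm Q f ^+ 2 = \int[Q]_w (f w ^+ 2).
Proof. by rewrite l2normE sqr_sqrtr // Rintegral_sqr_ge0. Qed.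

(** * Generalized regression *)

Section generalized_regression.
Context {R : realType} {dW dX : measure_display}.
Context {TW : measurableType dW} {TX : measurableType dX}.
Context {F0 : probability TW R} {X : {RV F0 >-> TX}}.
Context {Gamma : set (TX -> R)}.
Hypothesis hGamma : closed_L2_subspace (distribution F0 X) Gamma.
Context {rho : TW -> (TX -> R) -> R}.
Hypothesis rho_meas : forall g, Gamma g -> measurable_fun setT (rho ^~ g).
Context {gamma0 : TX -> R}.
Hypothesis gamma0_in : Gamma gamma0.
Hypothesis hgamma0 : forall b, Gamma b ->
  ('E_F0[fun w => (rho w gamma0 * b (X w))%R] = 0)%E.
Context {m : TW -> (TX -> R) -> R}.
Hypothesis m_int : forall g, Gamma g -> F0.-integrable setT (EFin \o m ^~ g).
Hypothesis m_lin : forall (a : R) g h, Gamma g -> Gamma h ->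
  {ae F0, forall w, m w (fun x => a * g x + h x) = a * m w g + m w h}.
Context {theta0 : R}.
Hypothesis htheta0 : ('E_F0[m ^~ gamma0] = theta0%:E)%E.
Context {alpha0 : TX -> R}.
Hypothesis alpha0_in : Gamma alpha0.
Context {M : R}.
Hypothesis m_bound : forall a, Gamma a ->
  ('E_F0[fun w => (m w a ^+ 2)%R] <= (M * l2norm F0 (a \o X) ^+ 2)%:E)%E.
Context {C0 : R}.
Hypothesis alpha0_bounded : ae_bounded F0 (alpha0 \o X) C0.
Context {g2 : TX -> R} {K : R}.
Hypothesis condexp_rho2 : is_condexp F0 X (fun w => rho w gamma0 ^+ 2) g2.
Hypothesis g2_bounded : ae_bounded F0 (g2 \o X) K.
Hypothesis m0_sqr : ('E_F0[fun w => (m w gamma0 ^+ 2)%R] < +oo)%E.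

Lemma Gamma_measurable g : Gamma g -> measurable_fun setT g.
Proof.
case: hGamma => hL _ _ _ /hL; rewrite inE => /andP[+ _].
by rewrite inE.
Qed.

Lemma Gamma_measurable_comp g : Gamma g -> measurable_fun setT (fun w => g (X w)).
Proof. by move=> /Gamma_measurable mg; exact: measurableT_comp. Qed.

Lemma Gamma_sqr_int g : Gamma g -> sqr_int F0 (fun w => g (X w)).
Proof.
move=> Gg; apply: sqr_int_lty; first exact: Gamma_measurable_comp.
have mg := Gamma_measurable Gg.
case: hGamma => hL _ _ _; have := Lfun2_integrable_sqr (hL _ Gg).
move=> /integrableP[_].
rewrite ge0_integral_distribution //; last first.
  by apply: measurableT_comp => //; apply/measurable_EFinP; exact: measurable_funX.
apply: le_lt_trans; rewrite le_eqVlt; apply/orP; left; apply/eqP.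
by apply: eq_integral => w _ /=; rewrite ger0_norm // sqr_ge0.
Qed.

Lemma GammaD r g h : Gamma g -> Gamma h -> Gamma (fun x => r * g x + h x).
Proof. by case: hGamma => _ _ h3 _; exact: h3. Qed.

Lemma GammaB g h : Gamma g -> Gamma h -> Gamma (g \- h).
Proof.
move=> Gg Gh; have := GammaD (-1) Gh Gg.
by congr Gamma; apply/funext => x /=; rewrite mulN1r addrC.
Qed.

Lemma rho0_sqr_int : sqr_int F0 (rho ^~ gamma0).
Proof. by split; [exact: rho_meas|case: condexp_rho2]. Qed.

Lemma m0_sqr_int : sqr_int F0 (m ^~ gamma0).
Proof.
have h := m0_sqr; rewrite expectationE in h; apply: sqr_int_lty h.
by apply/measurable_EFinP; exact: measurable_int (m_int gamma0_in).
Qed.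

Lemma bounded_mul_sqr_int (a : TX -> R) (c : R) (f : TW -> R) : Gamma a ->
  ae_bounded F0 (a \o X) c -> sqr_int F0 f -> sqr_int F0 (fun w => a (X w) * f w).
Proof.
move=> Ga ac sf; apply: (sqr_int_dominated (c := c) _ sf).
  by apply: measurable_funM; [exact: Gamma_measurable_comp|case: sf].
by apply: filterS ac => w /= h; rewrite normrM ler_wpM2r.
Qed.

Lemma measurable_m g : Gamma g -> measurable_fun setT (m ^~ g).
Proof. by move=> Gg; apply/measurable_EFinP; exact: measurable_int (m_int Gg). Qed.

Lemma measurable_psi theta g a : Gamma g -> Gamma a ->
  measurable_fun setT (psi X m rho theta g a).
Proof.
move=> Gg Ga; apply: measurable_funD.
  by apply: measurable_funB => //; exact: measurable_m.
by apply: measurable_funM; [exact: Gamma_measurable_comp|exact: rho_meas].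
Qed.

Let psi0 := psi X m rho theta0 gamma0 alpha0.

Lemma psi0_sqr_int : sqr_int F0 psi0.
Proof.
apply: sqr_intD.
  by apply: sqr_intB; [exact: m0_sqr_int|exact: sqr_int_cst].
exact: (bounded_mul_sqr_int alpha0_in alpha0_bounded rho0_sqr_int).
Qed.

Lemma Rintegral_rho0_mul b : Gamma b -> \int[F0]_w (b (X w) * rho w gamma0) = 0.
Proof.
move=> Gb; have := hgamma0 Gb; rewrite expectationE /Rintegral => h.
under eq_integral do rewrite mulrC.
by rewrite h.
Qed.

Lemma Rintegral_psi0 : \int[F0]_w psi0 w = 0.
Proof.
have im := sqr_int_integrable m0_sqr_int.
have ir := sqr_int_integrable (bounded_mul_sqr_int alpha0_in alpha0_bounded rho0_sqr_int).
have ic : F0.-integrable setT (EFin \o cst theta0) by exact: finite_measure_integrable_cst.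
rewrite /psi0 /psi (RintegralD measurableT (integrableB measurableT im ic) ir).
rewrite Rintegral_rho0_mul // addr0 (RintegralB measurableT im ic).
rewrite Rintegral_probability_cst /Rintegral.
by move: htheta0; rewrite expectationE => ->; rewrite subrr.
Qed.

Section perturbation.
Variables g a : TX -> R.
Hypotheses (Gg : Gamma g) (Ga : Gamma a).
Hypothesis rho_sqr : sqr_int F0 (fun w => rho w g - rho w gamma0).

Let dg := l2norm F0 ((g \- gamma0) \o X).
Let da := l2norm F0 ((a \- alpha0) \o X).

Lemma m_diff : {ae F0, forall w, m w g - m w gamma0 = m w (g \- gamma0)}.
Proof.
have := m_lin (-1) gamma0_in Gg; apply: filterS => w h.
rewrite (_ : g \- gamma0 = fun x => -1 * gamma0 x + g x).
  by rewrite h mulN1r addrC.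
by apply/funext => x /=; rewrite mulN1r addrC.
Qed.

Lemma m_diff_sqr_bound : (\int[F0]_w ((m w g - m w gamma0) ^+ 2)%:E <= (M * dg ^+ 2)%:E)%E.
Proof.
have Gd := GammaB Gg gamma0_in.
have := m_bound Gd; rewrite expectationE; apply: le_trans.
apply: ae_ge0_le_integral => //=.
- by move=> w _; rewrite lee_fin sqr_ge0.
- apply/measurable_EFinP; apply: measurable_funX.
  by apply: measurable_funB; exact: measurable_m.
- by move=> w _; rewrite lee_fin sqr_ge0.
- by apply/measurable_EFinP; apply: measurable_funX; exact: measurable_m.
- by apply: filterS m_diff => w -> _.
Qed.

Lemma m_diff_sqr_int : sqr_int F0 (fun w => m w g - m w gamma0).
Proof.
apply: sqr_int_lty; first by apply: measurable_funB; exact: measurable_m.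
by rewrite (le_lt_trans m_diff_sqr_bound) // ltry.
Qed.

(** The factor a - alpha0 depends on X only, so the square of the residual can be replaced by its
    conditional mean, which is at most [K]. *)
Lemma alpha_diff_rho_bound : 0 <= K ->
  (\int[F0]_w (((a (X w) - alpha0 (X w)) * rho w gamma0) ^+ 2)%:E <= (K * da ^+ 2)%:E)%E.
Proof.
move=> K0; have Gd := GammaB Ga alpha0_in.
have := @condexp_le_bound _ _ _ _ _ _ X _ _ condexp_rho2 K (fun x => (a x - alpha0 x) ^+ 2).
move=> H; under eq_integral do rewrite exprMn.
apply: (le_trans (H _ _ _ K0 g2_bounded)).
- by apply: measurable_funX; exact: (Gamma_measurable Gd).
- by move=> x; exact: sqr_ge0.
- by move=> w; exact: sqr_ge0.
- by rewrite EFinM /da sqr_l2norm (Rintegral_sqrE (Gamma_sqr_int Gd)).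
Qed.

Lemma alpha_diff_rho_sqr_int : 0 <= K ->
  sqr_int F0 (fun w => (a (X w) - alpha0 (X w)) * rho w gamma0).
Proof.
move=> K0; have Gd := GammaB Ga alpha0_in; apply: sqr_int_lty.
  by apply: measurable_funM; [exact: (Gamma_measurable_comp Gd)|exact: rho_meas].
by rewrite (le_lt_trans (alpha_diff_rho_bound K0)) // ltry.
Qed.

Variable Ca : R.
Hypothesis a_bounded : ae_bounded F0 (a \o X) Ca.

(** The error of [rho] is paired with [a], which is bounded, and the error of [a] with the residual
    at [gamma0], whose conditional second moment is bounded. No product of two errors is left, so
    each square can be integrated. *)
Lemma psi_diffE theta w : psi X m rho theta g a w - psi X m rho theta gamma0 alpha0 w =
  (m w g - m w gamma0) + a (X w) * (rho w g - rho w gamma0) +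
  (a (X w) - alpha0 (X w)) * rho w gamma0.
Proof. by rewrite /psi; ring. Qed.

Lemma psi_diff_sqr_int theta : 0 <= K ->
  sqr_int F0 (fun w => psi X m rho theta g a w - psi X m rho theta gamma0 alpha0 w).
Proof.
move=> K0.
have := sqr_intD (sqr_intD m_diff_sqr_int (bounded_mul_sqr_int Ga a_bounded rho_sqr))
  (alpha_diff_rho_sqr_int K0).
by congr sqr_int; apply/funext => w; rewrite psi_diffE.
Qed.

Lemma psi_diff_sqr_bound theta (r : R) : 0 <= K ->
  (\int[F0]_w ((rho w g - rho w gamma0) ^+ 2)%:E <= r%:E)%E ->
  (\int[F0]_w ((psi X m rho theta g a w - psi X m rho theta gamma0 alpha0 w) ^+ 2)%:E <=
   (3 * (M * dg ^+ 2 + Ca ^+ 2 * r + K * da ^+ 2))%:E)%E.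
Proof.
move=> K0 hr.
have s1 := m_diff_sqr_int.
have s2 := bounded_mul_sqr_int Ga a_bounded rho_sqr.
have s3 := alpha_diff_rho_sqr_int K0.
have b1 := m_diff_sqr_bound; have b3 := alpha_diff_rho_bound K0.
have b2 : (\int[F0]_w ((a (X w) * (rho w g - rho w gamma0)) ^+ 2)%:E <= (Ca ^+ 2 * r)%:E)%E.
  rewrite EFinM; apply: le_trans (lee_wpmul2l _ hr); last by rewrite lee_fin sqr_ge0.
  rewrite -ge0_integralZl //=; last 3 first.
  - by case: rho_sqr => mr _; apply/measurable_EFinP; exact: measurable_funX.
  - by move=> w _; rewrite lee_fin sqr_ge0.
  - by rewrite lee_fin sqr_ge0.
  apply: ae_ge0_le_integral => //=.
  - by move=> w _; rewrite lee_fin sqr_ge0.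
  - by case: s2 => ms2 _; apply/measurable_EFinP; exact: measurable_funX.
  - by move=> w _; rewrite mule_ge0 // lee_fin sqr_ge0.
  - case: rho_sqr => mr _; apply/measurable_EFinP; apply: measurable_funM => //.
    exact: measurable_funX.
  - apply: filterS a_bounded => w /= h _; rewrite -EFinM lee_fin exprMn ler_wpM2r ?sqr_ge0 //.
    by rewrite -(real_normK (num_real (a (X w)))) lerXn2r // nnegrE (le_trans _ h).
rewrite (Rintegral_sqrE s1) in b1; rewrite (Rintegral_sqrE s2) in b2.
rewrite (Rintegral_sqrE s3) in b3.
rewrite (Rintegral_sqrE (psi_diff_sqr_int theta K0)) lee_fin.
rewrite !lee_fin in b1 b2 b3.
apply: le_trans (ler_wpM2l _ (lerD (lerD b1 b2) b3)); last by [].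
have i12 := integrableD measurableT s1.2 s2.2.
rewrite -(RintegralD measurableT s1.2 s2.2) -(RintegralD measurableT i12 s3.2).
have i123 := integrableD measurableT i12 s3.2.
rewrite -RintegralZl //.
apply: le_Rintegral => //.
- by case: (psi_diff_sqr_int theta K0).
- exact: (integrableZl measurableT 3 i123).
move=> w _; rewrite psi_diffE.
set u := m w g - _; set v := a (X w) * _; set z := (_ - _) * rho w gamma0.
(* The factor 3: the gap between 3 (u^2 + v^2 + z^2) and (u + v + z)^2 is the sum of these three
   squares. *)
have := sqr_ge0 (u - v); have := sqr_ge0 (v - z); have := sqr_ge0 (u - z).
rewrite !expr2; lra.
Qed.

End perturbation.

Section mean_perturbation.
Variables g a : TX -> R.
Hypotheses (Gg : Gamma g) (Ga : Gamma a).
Hypothesis rho_sqr : sqr_int F0 (fun w => rho w g - rho w gamma0).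

Let dg := l2norm F0 ((g \- gamma0) \o X).
Let da := l2norm F0 ((a \- alpha0) \o X).

Lemma rho_sqr_int : sqr_int F0 (rho ^~ g).
Proof.
have := sqr_intD rho_sqr rho0_sqr_int.
by congr sqr_int; apply/funext => w; rewrite subrK.
Qed.

Lemma psi_alpha0_sqr_int : 0 <= K -> sqr_int F0 (psi X m rho theta0 g alpha0).
Proof.
move=> K0.
have := sqr_intD (psi_diff_sqr_int Gg alpha0_in rho_sqr alpha0_bounded theta0 K0) psi0_sqr_int.
by congr sqr_int; apply/funext => w; rewrite /psi0 subrK.
Qed.

Variables (rhobar : (TX -> R) -> TX -> R) (C : R).
Hypothesis hrhobar : forall g, F0.-integrable setT (EFin \o rho ^~ g) ->
  is_condexp F0 X (rho ^~ g) (rhobar g).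
Hypothesis rhobar_bound :
  ('E_F0[fun w => ((rhobar g (X w) - rhobar gamma0 (X w)) ^+ 2)%R] <= (C * dg ^+ 2)%:E)%E.

(** A bound linear in the distance to [gamma0] is assumed for [rhobar] only, while [rho] converges
    without a rate. As a - alpha0 is a function of X, the increment of [rho] is replaced by that of
    [rhobar] before the Cauchy-Schwarz inequality is applied. *)
Lemma rho_mul_bound : 0 <= C ->
  `|\int[F0]_w ((a (X w) - alpha0 (X w)) * (rho w g - rho w gamma0))| <=
  Num.sqrt C * (da * dg).
Proof.
move=> C0'; have Gd := GammaB Ga alpha0_in.
have sb : sqr_int F0 (fun w => a (X w) - alpha0 (X w)) := Gamma_sqr_int Gd.
have cd := sub_condexp (hrhobar (sqr_int_integrable rho_sqr_int))
  (hrhobar (sqr_int_integrable rho0_sqr_int)).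
have mrb : measurable_fun setT (fun w => rhobar g (X w) - rhobar gamma0 (X w)).
  by case: cd => _ mc _ _; exact: (measurableT_comp mc).
have hb := rhobar_bound; rewrite expectationE in hb.
have srb : sqr_int F0 (fun w => rhobar g (X w) - rhobar gamma0 (X w)).
  by apply: sqr_int_lty => //; rewrite (le_lt_trans hb) // ltry.
have i1 := sqr_int_mul sb rho_sqr; have i2 := sqr_int_mul sb srb.
have e := condexp_mul cd (Gamma_measurable Gd) i1 i2.
rewrite /Rintegral
  (e : (\int[F0]_w ((a (X w) - alpha0 (X w)) * (rho w g - rho w gamma0))%:E = _)%E).
apply: (le_trans (cauchy_schwarz sb srb)).
rewrite -/(Rintegral _ _ _) mulrCA ler_pM ?sqrtr_ge0 //.
  by rewrite /da l2normE.
rewrite (Rintegral_sqrE srb) lee_fin in hb.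
apply: (le_trans (ler_wsqrtr hb)); rewrite sqrtrM // sqrtr_sqr ger0_norm //.
by rewrite /dg l2normE sqrtr_ge0.
Qed.

Variable Ca : R.
Hypothesis a_bounded : ae_bounded F0 (a \o X) Ca.

(* Given X, rho w gamma0 averages to zero against Gamma and rho w g - rho w gamma0
   to the difference of the rhobar: hence the product of the two errors. *)
Lemma psi_diff_mean_bound : 0 <= K -> 0 <= C ->
  `|\int[F0]_w (psi X m rho theta0 g a w - psi0 w)| <=
  `|\int[F0]_w psi X m rho theta0 g alpha0 w| + Num.sqrt C * (da * dg).
Proof.
move=> K0 C0'; have Gd := GammaB Ga alpha0_in.
have sb : sqr_int F0 (fun w => a (X w) - alpha0 (X w)) := Gamma_sqr_int Gd.
have ip := sqr_int_integrable (psi_alpha0_sqr_int K0).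
have ip0 := sqr_int_integrable psi0_sqr_int.
have ib0 := sqr_int_mul sb rho0_sqr_int.
have ib1 := sqr_int_mul sb rho_sqr.
have j1 := integrableB measurableT ip ip0.
have j2 := integrableD measurableT j1 ib0.
have -> : \int[F0]_w (psi X m rho theta0 g a w - psi0 w) =
    \int[F0]_w (psi X m rho theta0 g alpha0 w - psi0 w +
      (a (X w) - alpha0 (X w)) * rho w gamma0 +
      (a (X w) - alpha0 (X w)) * (rho w g - rho w gamma0)).
  by apply: eq_Rintegral => w _; rewrite /psi0 /psi; ring.
rewrite (RintegralD measurableT j2 ib1) (RintegralD measurableT j1 ib0).
rewrite (RintegralB measurableT ip ip0) Rintegral_psi0 subr0.
rewrite (Rintegral_rho0_mul Gd) addr0.
by apply: (le_trans (ler_normD _ _)); rewrite lerD2l rho_mul_bound.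
Qed.

End mean_perturbation.

Section affine.
Hypothesis rho_affine : forall (t : R) g h, Gamma g -> Gamma h ->
  {ae F0, forall w, rho w (fun x => (1 - t) * g x + t * h x) =
                    (1 - t) * rho w g + t * rho w h}.
Hypothesis psi_derive : forall delta, Gamma delta ->
  is_derive (0 : R) (1 : R)
    (fun r : R => fine 'E_F0[psi X m rho theta0
                               (fun x => gamma0 x + r * delta x) alpha0]) 0.

(* The mean is an affine function of g, so it is determined along the segment
   from gamma0 to g by its derivative at gamma0, which is zero. *)
Lemma affine_psi_mean0 g : 0 <= K -> Gamma g ->
  sqr_int F0 (fun w => rho w g - rho w gamma0) ->
  \int[F0]_w psi X m rho theta0 g alpha0 w = 0.
Proof.
move=> K0 Gg rho_sqr; have Gd := GammaB Gg gamma0_in.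
have ip := sqr_int_integrable (psi_alpha0_sqr_int Gg rho_sqr K0).
have ip0 := sqr_int_integrable psi0_sqr_int.
set A := \int[F0]_w _.
have path_mean r : fine 'E_F0[psi X m rho theta0
    (fun x => gamma0 x + r * (g \- gamma0) x) alpha0] = r * A.
  have -> : (fun x => gamma0 x + r * (g \- gamma0) x) =
      (fun x => r * (g \- gamma0) x + gamma0 x).
    by apply/funext => x; rewrite addrC.
  have Gr := GammaD r Gd gamma0_in.
  rewrite expectationE.
  have -> : (\int[F0]_w (psi X m rho theta0 (fun x => r * (g \- gamma0) x + gamma0 x) alpha0 w)%:E
      = \int[F0]_w ((1 - r) * psi0 w + r * psi X m rho theta0 g alpha0 w)%:E)%E.
    apply: ae_eq_integral => //.
    - by apply/measurable_EFinP; exact: measurable_psi.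
    - apply/measurable_EFinP; apply: measurable_funD; apply: measurable_funM => //.
        exact: measurable_psi.
      exact: measurable_psi.
    - have h1 := m_lin r Gd gamma0_in; have h2 := m_diff Gg.
      have h3 := rho_affine r gamma0_in Gg.
      have E : (fun x => (1 - r) * gamma0 x + r * g x) = (fun x => r * (g \- gamma0) x + gamma0 x).
        by apply/funext => x /=; ring.
      rewrite E in h3.
      near=> w => _; congr EFin; rewrite /psi0 /psi.
      have -> : m w (fun x => r * (g \- gamma0) x + gamma0 x) =
          r * m w (g \- gamma0) + m w gamma0 by near: w.
      have <- : m w g - m w gamma0 = m w (g \- gamma0) by near: w.
      have -> : rho w (fun x => r * (g \- gamma0) x + gamma0 x) =
          (1 - r) * rho w gamma0 + r * rho w g by near: w.
      by ring.
  have j1 := integrableZl measurableT (1 - r) ip0.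
  have j2 := integrableZl measurableT r ip.
  rewrite -/(Rintegral F0 setT _) (RintegralD measurableT j1 j2).
  rewrite (RintegralZl _ measurableT ip0) (RintegralZl _ measurableT ip).
  by rewrite Rintegral_psi0 mulr0 add0r.
have := psi_derive Gd.
under eq_fun do rewrite path_mean.
move=> [_]; have -> : (fun r : R => r * A) = (@id R * cst A) by [].
rewrite derive_val !fctE /GRing.scale /= mulr0 add0r mulr1.
by move=> ->.
Unshelve. all: by end_near. Qed.

End affine.

End generalized_regression.

(** * Cross-fitting *)

Section fold_remainder.
Context {R : realType} {d dW : measure_display}.
Context {Omega : measurableType d} {TW : measurableType dW}.
Context {P : probability Omega R} {F0 : probability TW R}.
Context {W : nat -> {RV P >-> TW}}.
Hypothesis hW : iid_copies F0 W.

Lemma sqr_int_center (f : TW -> R) : sqr_int F0 f ->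
  (\int[F0]_w ((f w - \int[F0]_w f w) ^+ 2)%:E <= \int[F0]_w (f w ^+ 2)%:E)%E.
Proof.
move=> sf; set mu := (\int[F0]_w f w)%R.
have sc := sqr_intB sf (sqr_int_cst F0 mu).
have jf := sqr_int_integrable sf.
have i2 := integrableZl measurableT (- 2 * mu) jf.
have i3 : F0.-integrable setT (EFin \o cst (mu ^+ 2)).
  exact: finite_measure_integrable_cst.
rewrite (Rintegral_sqrE sf) (Rintegral_sqrE sc) lee_fin.
have -> : \int[F0]_w ((f w - cst mu w) ^+ 2) =
    \int[F0]_w (f w ^+ 2 + (- 2 * mu * f w) + mu ^+ 2).
  by apply: eq_Rintegral => w _ /=; ring.
rewrite (RintegralD measurableT (integrableD measurableT sf.2 i2) i3).
rewrite (RintegralD measurableT sf.2 i2) (RintegralZl _ measurableT jf).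
rewrite Rintegral_probability_cst -/mu -addrA gerDl.
by rewrite (_ : - 2 * mu * mu + mu ^+ 2 = - (mu ^+ 2)); [rewrite oppr_le0 sqr_ge0|ring].
Qed.

Variable I : forall n, pred 'I_n.
Variable D : forall n, n.-tuple TW -> TW -> R.
Hypothesis mD : forall n, measurable_fun setT (fun p => D (n := n) p.1 p.2).
Hypothesis iD : forall n i, I i -> ignores i (D (n := n)).

Let q n (s : n.-tuple TW) : \bar R := (\int[F0]_w (D s w ^+ 2)%:E)%E.
Let Dbar n (s : n.-tuple TW) : R := \int[F0]_w D s w.

Let mDs n (s : n.-tuple TW) : measurable_fun setT (D s).
Proof.
apply: (@measurableT_comp _ _ _ _ _ _ (fun p => D (n := n) p.1 p.2) _ (fun w => (s, w))).
  exact: mD.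
exact: pair1_measurable.
Qed.

Let mq n : measurable_fun setT (@q n).
Proof.
apply: (@measurable_fun_fubini_tonelli_F _ _ _ _ _ F0 (fun p => (D p.1 p.2 ^+ 2)%:E)).
  by apply/measurable_EFinP; apply: measurable_funX; exact: mD.
by move=> p; rewrite lee_fin sqr_ge0.
Qed.

Let mDbar n : measurable_fun setT (@Dbar n).
Proof.
suff h : measurable_fun setT (fun s : n.-tuple TW => \int[F0]_w (D s w)%:E)%E.
  by have := measurableT_comp (fine_measurable measurableT) h.
(* [D s] need not be integrable for every [s], so measurability is obtained from Tonelli's theorem
   on the positive and negative parts. *)
under eq_fun do rewrite integralE.
have mDE : measurable_fun setT (fun p => (D (n := n) p.1 p.2)%:E).
  by apply/measurable_EFinP; exact: mD.
pose F p := (D (n := n) p.1 p.2)%:E.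
apply: emeasurable_funB.
- have mFp : measurable_fun setT (F^\+)%E by exact: measurable_funepos.
  have H := @measurable_fun_fubini_tonelli_F _ _ _ _ _ F0 _ mFp (funepos_ge0 F).
  congr (measurable_fun _ _): H; apply/funext => s; apply: eq_integral => w _.
  by rewrite !funeposE.
- have mFn : measurable_fun setT (F^\-)%E by exact: measurable_funeneg.
  have H := @measurable_fun_fubini_tonelli_F _ _ _ _ _ F0 _ mFn (funeneg_ge0 F).
  congr (measurable_fun _ _): H; apply/funext => s; apply: eq_integral => w _.
  by rewrite !funenegE.
Qed.

Let sqr_int_q n (s : n.-tuple TW) (e : R) : (q s <= e%:E)%E -> sqr_int F0 (D s).
Proof. by move=> qe; apply: sqr_int_lty => //; rewrite (le_lt_trans qe) // ltry. Qed.

Let ignores_q n i : I i -> ignores i (@q n).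
Proof. by move=> Ii s t st; rewrite /q (iD Ii st). Qed.

Hypothesis hq : forall e dl : R, 0 < e -> 0 < dl -> \forall n \near \oo,
  exists B, [/\ measurable B, (P B <= dl%:E)%E &
    forall om, ~ B om -> (q (sample W n om) <= e%:E)%E].

Let measurable_sum_fold n (G : n.-tuple TW -> TW -> R) :
  measurable_fun setT (fun p => G p.1 p.2) ->
  measurable_fun setT (fun om => \sum_(i < n | I i) G (sample W n om) (W i om)).
Proof.
move=> mG; under eq_fun do rewrite -big_filter.
by apply: measurable_sum => i; exact: measurable_sample_comp.
Qed.

Let card_fold n : #|I (n := n)|%:R <= n%:R :> R.
Proof. by rewrite ler_nat -[leqRHS]card_ord max_card. Qed.

(** Markov's inequality given the observations outside the fold. The squares are set to zero where
    [q] exceeds [eps], which bounds the expectation over all samples by at most n times [eps]; since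
    [q] ignores the coordinates in the fold, the cut-off function still does. *)
Lemma fold_mean_sqr_cvg0 :
  cvg_in_prob P (fun n om =>
    n%:R^-1 * \sum_(i < n | I i) D (sample W n om) (W i om) ^+ 2) 0.
Proof.
have mD2 n : measurable_fun setT (fun p => D (n := n) p.1 p.2 ^+ 2).
  by apply: measurable_funX; exact: mD.
apply/cvg_in_probP => [n|e dl e0 dl0].
  apply: measurable_funM => //.
  exact: (@measurable_sum_fold n (fun s w => D s w ^+ 2)).
pose eps := e * (dl / 2).
have eps0 : 0 < eps by rewrite mulr_gt0 // divr_gt0.
have dl2 : 0 < dl / 2 by rewrite divr_gt0.
near=> n.
have n0 : 0 < n%:R :> R by rewrite ltr0n; near: n; exact: nbhs_infty_gt.
have [B [mB PB hB]] : exists B, [/\ measurable B, (P B <= (dl / 2)%:E)%E &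
    forall om, ~ B om -> (q (sample W n om) <= eps%:E)%E].
  by near: n; exact: hq.
pose G (s : n.-tuple TW) w := if (q s <= eps%:E)%E then D s w ^+ 2 else 0.
have mqe : measurable_fun setT (fun p : n.-tuple TW * TW => (q p.1 <= eps%:E)%E).
  by apply: measurable_fun_lee => //; apply: (measurableT_comp (@mq n)); exact: measurable_fst.
have mG : measurable_fun setT (fun p => G p.1 p.2).
  by apply: measurable_fun_ifT => //; exact: mD2.
have G0 s w : 0 <= G s w by rewrite /G; case: ifP => // _; exact: sqr_ge0.
pose Z om := n%:R^-1 * \sum_(i < n | I i) G (sample W n om) (W i om).
have mZ : measurable_fun setT Z.
  by apply: measurable_funM => //; exact: (measurable_sum_fold mG).
have Z0 om : 0 <= Z om by rewrite /Z mulr_ge0 ?invr_ge0 // sumr_ge0.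
pose B' := [set om | e <= Z om].
have mB' : measurable B'.
  by rewrite -[X in measurable X]setTI; exact: (@measurable_fun_ler _ _ _ _ (cst e) Z).
exists (B `|` B'); split; first exact: measurableU.
- apply: (le_trans (measureU2 _ mB mB')); rewrite [dl]splitr EFinD; apply: leeD => //.
  apply: (le_trans (markov_ge0 P mZ Z0 e0)).
  under eq_integral do rewrite EFinM.
  rewrite ge0_integralZl //; last 2 first.
  - by apply/measurable_EFinP; exact: (measurable_sum_fold mG).
  - by move=> om _; rewrite lee_fin sumr_ge0.
  have H : (\int[P]_om (\sum_(i < n | I i) G (sample W n om) (W i om))%:E <=
      (#|I (n := n)|%:R * eps)%:E)%E.
    apply: (sum_sample_ge0_integral hW) => // [i Ii s t st|s].
      by apply/funext => w; rewrite /G (ignores_q Ii st) (iD Ii st).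
    rewrite /G; have [qe|_] := boolP (q s <= eps%:E)%E; first exact: qe.
    by rewrite integral0 lee_fin ltW.
  apply: (@le_trans _ _ (e^-1%:E * (n%:R^-1%:E * (#|I (n := n)|%:R * eps)%:E))%E).
    do 2 (apply: lee_wpmul2l; first by rewrite lee_fin invr_ge0 ltW).
    exact: H.
  rewrite -!EFinM lee_fin ler_pdivrMl // ler_pdivrMl //.
  by rewrite ler_wpM2r // ltW.
- move=> om /not_orP[nB nB']; have hZ : Z om < e by rewrite ltNge; apply/negP.
  rewrite subr0 ger0_norm; last first.
    by rewrite mulr_ge0 ?invr_ge0 // sumr_ge0 // => i _; exact: sqr_ge0.
  by move: hZ; rewrite /Z /G (hB _ nB).
Unshelve. all: by end_near. Qed.

Hypothesis hm : forall e dl : R, 0 < e -> 0 < dl -> \forall n \near \oo,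
  exists B, [/\ measurable B, (P B <= dl%:E)%E &
    forall om, ~ B om -> Num.sqrt n%:R * `|Dbar (sample W n om)| < e].

(** Chebyshev's inequality controls the sum centered by [Dbar]. The centering itself contributes
    n^(-1/2) |I| |Dbar|, at most sqrt n |Dbar| because a fold has at most n elements; this is the
    scale at which [hm] is stated. *)
Lemma fold_sum_cvg0 :
  cvg_in_prob P (fun n om =>
    (Num.sqrt n%:R)^-1 * \sum_(i < n | I i) D (sample W n om) (W i om)) 0.
Proof.
apply/cvg_in_probP => [n|e dl e0 dl0].
  by apply: measurable_funM => //; exact: (measurable_sum_fold (@mD n)).
(* The level at which Chebyshev's inequality for a deviation e/2 gives probability dl/3; the other
   two thirds go to the bad events of [hq] and [hm]. *)
pose eps := (e / 2) ^+ 2 * (dl / 3).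
have e2 : 0 < e / 2 by rewrite divr_gt0.
have e4 : 0 < (e / 2) ^+ 2 by rewrite exprn_gt0.
have dl3 : 0 < dl / 3 by rewrite divr_gt0.
have eps0 : 0 < eps by rewrite mulr_gt0.
near=> n.
have n0 : 0 < n%:R :> R by rewrite ltr0n; near: n; exact: nbhs_infty_gt.
have sn0 : 0 < Num.sqrt n%:R :> R by rewrite sqrtr_gt0.
have sn2 : Num.sqrt n%:R ^+ 2 = n%:R :> R by rewrite sqr_sqrtr // ltW.
have [B1 [mB1 PB1 hB1]] : exists B, [/\ measurable B, (P B <= (dl / 3)%:E)%E &
    forall om, ~ B om -> (q (sample W n om) <= eps%:E)%E].
  by near: n; exact: hq.
have [B2 [mB2 PB2 hB2]] : exists B, [/\ measurable B, (P B <= (dl / 3)%:E)%E &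
    forall om, ~ B om -> Num.sqrt n%:R * `|Dbar (sample W n om)| < e / 2].
  by near: n; exact: hm.
(* Truncating on an event which depends only on the observations outside the
   fold preserves centering. *)
pose G (s : n.-tuple TW) w := if (q s <= eps%:E)%E then D s w - Dbar s else 0.
have mqe : measurable_fun setT (fun p : n.-tuple TW * TW => (q p.1 <= eps%:E)%E).
  by apply: measurable_fun_lee => //; apply: (measurableT_comp (@mq n)); exact: measurable_fst.
have mG : measurable_fun setT (fun p => G p.1 p.2).
  apply: measurable_fun_ifT => //; apply: measurable_funB.
    exact: mD.
  by apply: (measurableT_comp (@mDbar n)); exact: measurable_fst.
pose Z om := ((Num.sqrt n%:R)^-1 * \sum_(i < n | I i) G (sample W n om) (W i om)) ^+ 2.
have mZ : measurable_fun setT Z.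
  by apply: measurable_funX; apply: measurable_funM => //; exact: (measurable_sum_fold mG).
have Z0 om : 0 <= Z om by exact: sqr_ge0.
pose B' := [set om | (e / 2) ^+ 2 <= Z om].
have mB' : measurable B'.
  by rewrite -[X in measurable X]setTI; exact: (@measurable_fun_ler _ _ _ _ (cst _) Z).
exists (B1 `|` B2 `|` B'); split; first by apply: measurableU => //; exact: measurableU.
- have mB12 : measurable (B1 `|` B2) by exact: measurableU.
  apply: (le_trans (measureU2 _ mB12 mB')).
  rewrite (_ : dl = dl / 3 + dl / 3 + dl / 3); last by field.
  rewrite EFinD; apply: leeD.
    by apply: (le_trans (measureU2 _ mB1 mB2)); rewrite EFinD; exact: leeD.
  apply: (le_trans (markov_ge0 P mZ Z0 e4)).
  under eq_integral do rewrite /Z exprMn EFinM.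
  rewrite ge0_integralZl //; last 2 first.
  - by apply/measurable_EFinP; apply: measurable_funX; exact: (measurable_sum_fold mG).
  - by move=> om _; rewrite lee_fin sqr_ge0.
  have H : (\int[P]_om ((\sum_(i < n | I i) G (sample W n om) (W i om)) ^+ 2)%:E <=
      (#|I (n := n)|%:R * eps)%:E)%E.
    apply: (sum_sample_sqr_integral hW) => // [i Ii s t st|s|s|s].
    + by apply/funext => w; rewrite /G (ignores_q Ii st) /Dbar (iD Ii st).
    + rewrite /G; have [qe|_] := boolP (q s <= eps%:E)%E; last first.
        exact: integrable0.
      have sD := sqr_int_q qe.
      exact: (sqr_int_integrable (sqr_intB sD (sqr_int_cst F0 (Dbar s)))).
    + rewrite /G; have [qe|_] := boolP (q s <= eps%:E)%E; last first.
        by rewrite integral0.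
      have sD := sqr_int_q qe.
      have jD := sqr_int_integrable sD.
      have jc := sqr_int_integrable (sqr_int_cst F0 (Dbar s)).
      rewrite (integralB_EFin measurableT jD jc) integral_probability_cst.
      by rewrite /Dbar /Rintegral fineK ?subee //; exact: (integrable_fin_num measurableT jD).
    + rewrite /G; have [qe|_] := boolP (q s <= eps%:E)%E.
        exact: (le_trans (sqr_int_center (sqr_int_q qe)) qe).
      under eq_integral do rewrite expr0n /=.
      by rewrite integral0 lee_fin ltW.
  apply: (@le_trans _ _ (((e / 2) ^+ 2)^-1%:E *
      (((Num.sqrt n%:R)^-1 ^+ 2)%:E * (#|I (n := n)|%:R * eps)%:E))%E).
    apply: lee_wpmul2l; first by rewrite lee_fin invr_ge0 ltW.
    by apply: lee_wpmul2l; first by rewrite lee_fin sqr_ge0.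
  rewrite exprVn sn2 -!EFinM lee_fin ler_pdivrMl // ler_pdivrMl //.
  by rewrite ler_wpM2r // ltW.
- move=> om /not_orP[/not_orP[nB1 nB2] nB'].
  have hZ : Z om < (e / 2) ^+ 2 by rewrite ltNge; apply/negP.
  have {}hZ : `|(Num.sqrt n%:R)^-1 * \sum_(i < n | I i) G (sample W n om) (W i om)| < e / 2.
    by rewrite -(ltr_pXn2r (n := 2)) ?nnegrE // ?ltW // real_normK ?num_real.
  have GE : \sum_(i < n | I i) G (sample W n om) (W i om) =
      \sum_(i < n | I i) D (sample W n om) (W i om) - #|I (n := n)|%:R * Dbar (sample W n om).
    rewrite /G (hB1 _ nB1) sumrB sumr_const mulr_natl //.
  have hD := hB2 _ nB2.
  rewrite subr0 (_ : _ * _ = (Num.sqrt n%:R)^-1 * \sum_(i < n | I i) G (sample W n om) (W i om) +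
    (Num.sqrt n%:R)^-1 * (#|I (n := n)|%:R * Dbar (sample W n om))); last first.
    by rewrite GE; ring.
  apply: (le_lt_trans (ler_normD _ _)); rewrite [e]splitr; apply: ltrD => //.
  apply: le_lt_trans hD; have ci : 0 <= #|I (n := n)|%:R :> R by [].
  have si : 0 <= (Num.sqrt n%:R)^-1 :> R by rewrite invr_ge0 ltW.
  rewrite !normrM (ger0_norm ci) (ger0_norm si).
  rewrite mulrA ler_wpM2r // ler_pdivrMl // -expr2 sn2.
  exact: card_fold.
Unshelve. all: by end_near. Qed.

End fold_remainder.

(** * Calculus of sequences small in probability *)

Section small_in_probability.
Context {R : realType} {d : measure_display} {Omega : measurableType d}.
Variable P : probability Omega R.
Implicit Types Z : nat -> Omega -> R.

(** Convergence to zero in outer probability. Comparison, sums and products then hold without any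
    measurability of [Z n]. *)
Definition small_in_prob Z := forall e dl : R, 0 < e -> 0 < dl ->
  \forall n \near \oo, exists B, [/\ measurable B, (P B <= dl%:E)%E &
    forall om, ~ B om -> `|Z n om| < e].

Lemma cvg_in_prob_small Z c : (forall n, measurable_fun setT (Z n)) ->
  cvg_in_prob P Z c <-> small_in_prob (fun n om => Z n om - c).
Proof. exact: cvg_in_probP. Qed.

Lemma small_in_prob_both Z1 Z2 e1 e2 dl :
  small_in_prob Z1 -> small_in_prob Z2 -> 0 < e1 -> 0 < e2 -> 0 < dl ->
  \forall n \near \oo, exists B, [/\ measurable B, (P B <= dl%:E)%E &
    forall om, ~ B om -> `|Z1 n om| < e1 /\ `|Z2 n om| < e2].
Proof.
move=> h1 h2 e10 e20 dl0; have dl2 : 0 < dl / 2 by rewrite divr_gt0.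
move: (h1 _ _ e10 dl2) (h2 _ _ e20 dl2).
apply: filterS2 => n [B1 [mB1 PB1 hB1]] [B2 [mB2 PB2 hB2]].
exists (B1 `|` B2); split; first exact: measurableU.
- apply: (le_trans (measureU2 _ mB1 mB2)).
  by rewrite [dl]splitr EFinD; exact: leeD.
- by move=> om /not_orP[n1 n2]; split; [exact: hB1|exact: hB2].
Qed.

Lemma small_in_prob_le Z1 Z2 : (forall n om, `|Z2 n om| <= `|Z1 n om|) ->
  small_in_prob Z1 -> small_in_prob Z2.
Proof.
move=> h h1 e dl e0 dl0; apply: filterS (h1 _ _ e0 dl0) => n [B [mB PB hB]].
by exists B; split => // om nB; exact: le_lt_trans (h n om) (hB _ nB).
Qed.

Lemma small_in_probD Z1 Z2 : small_in_prob Z1 -> small_in_prob Z2 ->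
  small_in_prob (fun n om => Z1 n om + Z2 n om).
Proof.
move=> h1 h2 e dl e0 dl0; have e2 : 0 < e / 2 by rewrite divr_gt0.
apply: filterS (small_in_prob_both h1 h2 e2 e2 dl0) => n [B [mB PB hB]].
exists B; split => // om /hB[l1 l2].
by rewrite (le_lt_trans (ler_normD _ _)) // [e]splitr ltrD.
Qed.

Lemma small_in_probM Z1 Z2 : small_in_prob Z1 -> small_in_prob Z2 ->
  small_in_prob (fun n om => Z1 n om * Z2 n om).
Proof.
move=> h1 h2 e dl e0 dl0.
apply: filterS (small_in_prob_both h1 h2 e0 ltr01 dl0) => n [B [mB PB hB]].
exists B; split => // om /hB[l1 l2]; rewrite normrM.
by rewrite (le_lt_trans _ l1) // ler_piMr // ltW.
Qed.

Lemma small_in_probZ (c : R) Z : small_in_prob Z ->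
  small_in_prob (fun n om => c * Z n om).
Proof.
move=> h e dl e0 dl0; have c1 : 0 < `|c| + 1 by rewrite ltr_wpDl.
have ec : 0 < e / (`|c| + 1) by rewrite divr_gt0.
apply: filterS (h _ _ ec dl0) => n [B [mB PB hB]].
exists B; split => // om /hB; rewrite normrM ltr_pdivlMr // mulrC.
by apply: le_lt_trans; rewrite ler_wpM2r // lerDl.
Qed.

Lemma small_in_prob_sum (L : nat) (Z : 'I_L -> nat -> Omega -> R) :
  (forall l, small_in_prob (Z l)) ->
  small_in_prob (fun n om => \sum_(l < L) Z l n om).
Proof.
move=> h; elim: L Z h => [|L IH] Z h.
  move=> e dl e0 dl0; near=> n; exists set0; split => // [|om _].
    by rewrite measure0 lee_fin ltW.
  by rewrite big_ord0 normr0.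
have := small_in_probD (IH _ (fun l => h (widen_ord (leqnSn L) l))) (h ord_max).
by apply: small_in_prob_le => n om; rewrite big_ord_recr.
Unshelve. all: by end_near. Qed.

End small_in_probability.

Lemma sum_by_fibre (R : realType) n L (p : 'I_n -> 'I_L) (F : 'I_n -> R) :
  \sum_(l < L) \sum_(i < n | p i == l) F i = \sum_(i < n) F i.
Proof. by rewrite [RHS](partition_big p xpredT). Qed.

(** * Limit law and variance of an abstract cross-fitted mean *)

Section cross_fitted_mean.
Context {R : realType} {d dW : measure_display}.
Context {Omega : measurableType d} {TW : measurableType dW}.
Context {P : probability Omega R} {F0 : probability TW R}.
Context {W : nat -> {RV P >-> TW}}.
Hypothesis hW : iid_copies F0 W.
Context {L : nat} {fold : forall n, 'I_n -> 'I_L}.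
Arguments fold : clear implicits.
Context {D : forall n, 'I_L -> n.-tuple TW -> TW -> R} {xi : TW -> R}.
Arguments D : clear implicits.
Hypothesis mD : forall n l, measurable_fun setT (fun p => D n l p.1 p.2).
Hypothesis iD : forall l n i, fold n i == l -> ignores i (D n l).
Hypothesis hq : forall l (e dl : R), 0 < e -> 0 < dl -> \forall n \near \oo,
  exists B, [/\ measurable B, (P B <= dl%:E)%E &
    forall om, ~ B om -> (\int[F0]_w (D n l (sample W n om) w ^+ 2)%:E <= e%:E)%E].
Hypothesis hm : forall l (e dl : R), 0 < e -> 0 < dl -> \forall n \near \oo,
  exists B, [/\ measurable B, (P B <= dl%:E)%E &
    forall om, ~ B om -> Num.sqrt n%:R * `|\int[F0]_w D n l (sample W n om) w| < e].
Hypothesis sxi : sqr_int F0 xi.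
Hypothesis xi0 : \int[F0]_w xi w = 0.

Let xiD n l om i := xi (W i om) + D n l (sample W n om) (W i om).

(** The estimation error with the regression structure removed: [xi] stands for psi0, and [D] for
    the perturbation due to the learners. *)
Definition cross_fitted_mean n om : R :=
  n%:R^-1 * \sum_(l < L) \sum_(i < n | fold n i == l) xiD n l om i.

Definition cross_fitted_variance n om : R :=
  n%:R^-1 * \sum_(l < L) \sum_(i < n | fold n i == l)
    (xiD n l om i - cross_fitted_mean n om) ^+ 2.

Let T := cross_fitted_mean.

Let mDW n l (i : nat) : measurable_fun setT (fun om => D n l (sample W n om) (W i om)).
Proof. exact: (measurable_sample_comp i (@mD n l)). Qed.

Let mxi : measurable_fun setT xi. Proof. by case: sxi. Qed.

Let mxiW i : measurable_fun setT (fun om => xi (W i om)).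
Proof. exact: measurableT_comp. Qed.

Let measurable_fold_sum n (G : 'I_L -> 'I_n -> Omega -> R) :
  (forall l i, measurable_fun setT (G l i)) ->
  measurable_fun setT (fun om => \sum_(l < L) \sum_(i < n | fold n i == l) G l i om).
Proof.
move=> mG; apply: measurable_sum => l; under eq_fun do rewrite -big_filter.
by apply: measurable_sum => i; exact: mG.
Qed.

Let mT n : measurable_fun setT (T n).
Proof.
apply: measurable_funM => //.
by apply: (measurable_fold_sum (G := fun l i om => xiD n l om i)) => l i; exact: measurable_funD.
Qed.

Let S n om := (Num.sqrt n%:R)^-1 * \sum_(i < n) xi (W i om).
Let r l n om := (Num.sqrt n%:R)^-1 * \sum_(i < n | fold n i == l) D n l (sample W n om) (W i om).

Let r_small : small_in_prob P (fun n om => \sum_(l < L) r l n om).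
Proof.
apply: small_in_prob_sum => l.
have h := fold_sum_cvg0 hW (I := fun n i => fold n i == l) (D := fun n => D n l)
  (fun n => @mD n l) (@iD l) (@hq l) (@hm l).
have mr n : measurable_fun setT (r l n).
  apply: measurable_funM => //; under eq_fun do rewrite -big_filter.
  by apply: measurable_sum => i; exact: mDW.
have := (cvg_in_prob_small P 0 mr).1 h.
by apply: small_in_prob_le => n om; rewrite subr0.
Qed.

Let sqrt_n_T n om : Num.sqrt n%:R * T n om = S n om + \sum_(l < L) r l n om.
Proof.
have -> : Num.sqrt n%:R * T n om = (Num.sqrt n%:R)^-1 *
    \sum_(l < L) \sum_(i < n | fold n i == l) xiD n l om i.
  rewrite /T /cross_fitted_mean mulrA; congr (_ * _).
  (* For n = 0 both factors vanish, the inverse of 0 being 0. *)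
  case: n => [|n]; first by rewrite sqrtr0 mul0r invr0.
  have n0 : 0 < n.+1%:R :> R by rewrite ltr0n.
  rewrite -[X in _ * X^-1](sqr_sqrtr (ltW n0)).
  by rewrite expr2 invfM mulrA divff ?mul1r // gt_eqF // sqrtr_gt0.
rewrite /S /r -mulr_sumr -mulrDr; congr (_ * _).
rewrite -(sum_by_fibre (fold n) (fun i => xi (W i om))) -big_split /=.
by apply: eq_bigr => l _; rewrite -big_split.
Qed.

Let V := fine (\int[F0]_w (xi w ^+ 2)%:E).

Let VE : (\int[F0]_w (xi w ^+ 2)%:E = V%:E)%E.
Proof. exact: Rintegral_sqrE. Qed.

Let xi0E : (\int[F0]_w (xi w)%:E = 0)%E.
Proof.
have := integrable_fin_num measurableT (sqr_int_integrable sxi).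
by move=> /fineK /= <-; move: xi0; rewrite /Rintegral => ->.
Qed.

Theorem cross_fitted_clt :
  cvg_in_distr P (fun n om => Num.sqrt n%:R * T n om) (centered_normal V).
Proof.
have mS n : measurable_fun setT (S n).
  by apply: measurable_funM => //; apply: measurable_sum => i.
have mZ n : measurable_fun setT (fun om => Num.sqrt n%:R * T n om).
  exact: measurable_funM.
have ZS : cvg_in_prob P (fun n om => Num.sqrt n%:R * T n om - S n om) 0.
  apply/cvg_in_prob_small; first by move=> n; exact: measurable_funB.
  apply: small_in_prob_le r_small => n om.
  by rewrite subr0 sqrt_n_T addrAC subrr add0r.
rewrite /centered_normal; have [V0|V0] := eqVneq V 0.
  apply: (@cvg_in_distr_sigm R d Omega P (\d_(0%R : measurableTypeR R)) S _ mS mZ _ ZS) => a b.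
  (* The point mass at 0 on the two measurable types used for the real line gives the same
     averages. *)
  have -> : \int[\d_(0%R : measurableTypeR R)]_z sigm a b z = \int[\d_(0%R : R)]_z sigm a b z.
    rewrite /Rintegral !integral_dirac ?diracT //; apply/measurable_EFinP; exact: measurable_sigm.
  exact: (clt_sigm_dirac hW mxi xi0E VE V0).
have Vpos : 0 < V.
  rewrite lt_neqAle eq_sym V0 /V; apply: fine_ge0; apply: integral_ge0 => w _.
  by rewrite lee_fin sqr_ge0.
apply: (@cvg_in_distr_sigm _ _ _ P (normal_prob 0 (Num.sqrt V)) S _ mS mZ _ ZS) => a b.
exact: (clt_sigm_normal hW mxi xi0E VE Vpos).
Qed.

(** The law of large numbers handles [xi]; the remainder is n^(-1/2) times the one in [r_small], and
    this factor is at most 1. *)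
Let mean_small : small_in_prob P T.
Proof.
have h := wlln hW (sqr_int_integrable sxi); rewrite xi0E /= in h.
have mA n : measurable_fun setT (fun om => n%:R^-1 * \sum_(i < n) xi (W i om)).
  by apply: measurable_funM => //; apply: measurable_sum => i.
have {}h := (cvg_in_prob_small P 0 mA).1 h.
have h2 : small_in_prob P (fun n om =>
    `|n%:R^-1 * (\sum_(i < n) xi (W i om)) - 0| + `|\sum_(l < L) r l n om|).
  apply: small_in_probD.
    by apply: small_in_prob_le h => n om; rewrite normr_id.
  by apply: small_in_prob_le r_small => n om; rewrite normr_id.
apply: small_in_prob_le h2 => -[|n] om.
  by rewrite /T /cross_fitted_mean invr0 !mul0r normr0.
have sn1 : 1 <= Num.sqrt n.+1%:R :> R.
  by rewrite -[X in X <= _]sqrtr1; apply: ler_wsqrtr; rewrite ler1n.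
have sn0 := lt_le_trans ltr01 sn1.
have sn2 : Num.sqrt n.+1%:R ^+ 2 = n.+1%:R :> R by rewrite sqr_sqrtr.
have -> : T n.+1 om = n.+1%:R^-1 * (\sum_(i < n.+1) xi (W i om)) +
    (Num.sqrt n.+1%:R)^-1 * \sum_(l < L) r l n.+1 om.
  apply: (mulfI (lt0r_neq0 sn0)); rewrite sqrt_n_T mulrDr mulVKf ?gt_eqF //.
  congr (_ + _); rewrite /S mulrA; congr (_ * _).
  by apply: (mulfI (lt0r_neq0 sn0)); rewrite mulrA -expr2 sn2 !divff // gt_eqF.
rewrite subr0 [leRHS]ger0_norm ?addr_ge0 //.
apply: (le_trans (ler_normD _ _)); rewrite lerD2l normrM.
by rewrite ler_piMl // ger0_norm ?invr_ge0 ?(ltW sn0) // invf_le1.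
Qed.

(** Twice the mean squares of [D] plus twice T^2: it dominates the mean square of D - T, by which
    the centered scores differ from [xi]. *)
Let Q n om := 2 * (\sum_(l < L) n%:R^-1 *
  \sum_(i < n | fold n i == l) D n l (sample W n om) (W i om) ^+ 2) + 2 * (T n om * T n om).

Let Q_small : small_in_prob P Q.
Proof.
apply: small_in_probD; apply: small_in_probZ; last exact: small_in_probM.
apply: small_in_prob_sum => l.
have h := fold_mean_sqr_cvg0 hW (I := fun n i => fold n i == l) (D := fun n => D n l)
  (fun n => @mD n l) (@iD l) (@hq l).
have mr n : measurable_fun setT (fun om => n%:R^-1 *
    \sum_(i < n | fold n i == l) D n l (sample W n om) (W i om) ^+ 2).
  apply: measurable_funM => //; under eq_fun do rewrite -big_filter.
  by apply: measurable_sum => i; apply: measurable_funX; exact: mDW.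
have := (cvg_in_prob_small P 0 mr).1 h.
by apply: small_in_prob_le => n om; rewrite subr0.
Qed.

Let A n om := n%:R^-1 * \sum_(i < n) xi (W i om) ^+ 2.

(* Young's inequality with parameter t, applied to the cross term of (xi + r)^2. *)
Let variance_bound (t : R) n om : 0 < t ->
  `|cross_fitted_variance n om - A n om| <= t * A n om + (1 + t^-1) * Q n om.
Proof.
move=> t0; pose b : R := n%:R^-1.
have b0 : 0 <= b :> R by rewrite invr_ge0.
have QE : b * \sum_(l < L) \sum_(i < n | fold n i == l)
    (D n l (sample W n om) (W i om) - T n om) ^+ 2 <= Q n om.
  have [n0|n0] := posnP n.
    rewrite /b {1}n0 invr0 mul0r; apply: addr_ge0; apply: mulr_ge0 => //.
    - apply: sumr_ge0 => l _; apply: mulr_ge0 => //.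
      by apply: sumr_ge0 => i _; exact: sqr_ge0.
    - by rewrite -expr2 sqr_ge0.
  have bn : b * n%:R = 1 by rewrite mulVf // pnatr_eq0 -lt0n.
  rewrite /Q (_ : 2 * (T n om * T n om) = b * \sum_(i < n) (2 * T n om ^+ 2)); last first.
    by rewrite sumr_const card_ord -[_ *+ n]mulr_natl [b * _]mulrA bn mul1r expr2.
  rewrite -(sum_by_fibre (fold n) (fun=> 2 * T n om ^+ 2)) -mulr_sumr mulrCA -mulrDr.
  apply: ler_wpM2l => //; rewrite mulr_sumr -big_split /=; apply: ler_sum => l _.
  rewrite mulr_sumr -big_split /=; apply: ler_sum => i _.
  set x := D _ _ _ _; set y := T n om.
  by have := sqr_ge0 (x + y); rewrite sqrrD sqrrB; lra.
have c0 : 0 <= 1 + t^-1 by rewrite addr_ge0 // invr_ge0 ltW.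
apply: le_trans (lerD (lexx _) (ler_wpM2l c0 QE)).
rewrite /cross_fitted_variance /A -/b -(sum_by_fibre (fold n) (fun i => xi (W i om) ^+ 2)).
rewrite -mulrBr normrM (ger0_norm b0) (mulrCA t b) (mulrCA (1 + t^-1) b) -mulrDr.
apply: ler_wpM2l => //; rewrite -sumrB !mulr_sumr -big_split /=.
apply: (le_trans (ler_norm_sum _ _ _)); apply: ler_sum => l _.
rewrite -sumrB !mulr_sumr -big_split /=.
apply: (le_trans (ler_norm_sum _ _ _)); apply: ler_sum => i _.
rewrite /xiD -/T; set x := D _ _ _ _; set y := T n om; set z := xi _.
rewrite -[z + x - y]addrA; move: (x - y) => u.
have tt : t * t^-1 = 1 by rewrite divff // gt_eqF.
have ti : 0 < t^-1 by rewrite invr_gt0.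
have h1 := mulr_ge0 (ltW ti) (sqr_ge0 (t * z - u)).
have h2 := mulr_ge0 (ltW ti) (sqr_ge0 (t * z + u)).
have e1 : t^-1 * (t * z - u) ^+ 2 =
    (t * t^-1) * (t * z ^+ 2) - 2 * (t * t^-1) * (z * u) + t^-1 * u ^+ 2.
  by ring.
have e2 : t^-1 * (t * z + u) ^+ 2 =
    (t * t^-1) * (t * z ^+ 2) + 2 * (t * t^-1) * (z * u) + t^-1 * u ^+ 2.
  by ring.
rewrite e1 tt in h1; rewrite e2 tt in h2.
have u0 := sqr_ge0 u.
rewrite sqrrD ler_norml; apply/andP; split; lra.
Qed.

Theorem cross_fitted_variance_cvg : cvg_in_prob P cross_fitted_variance V.
Proof.
have mV n : measurable_fun setT (cross_fitted_variance n).
  apply: measurable_funM => //.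
  apply: (measurable_fold_sum (G := fun l i om => (xiD n l om i - T n om) ^+ 2)) => l i.
  by apply: measurable_funX; apply: measurable_funB => //; exact: measurable_funD.
have mA n : measurable_fun setT (A n).
  apply: measurable_funM => //; apply: measurable_sum => i.
  exact: measurable_funX.
have hA := (cvg_in_prob_small P V mA).1 (wlln hW sxi.2).
apply/cvg_in_prob_small => // e dl e0 dl0.
have V0 : 0 <= V by apply: fine_ge0; apply: integral_ge0 => w _; rewrite lee_fin sqr_ge0.
have V1 : 0 < V + 1 by rewrite ltr_wpDl.
(* Off the bad event [A] is below V + 1, so [t * A] is at most e/4. With [t] fixed, the factor 1 +
   1/t is a constant and is absorbed by the smallness of [Q]. *)
pose t := e / 4 / (V + 1).
have e4 : 0 < e / 4 by rewrite divr_gt0.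
have t0 : 0 < t by rewrite divr_gt0.
have c0 : 0 < 1 + t^-1 by rewrite addr_gt0 // invr_gt0.
have e1 : 0 < Num.min 1 (e / 4) by rewrite lt_min ltr01.
have e2 : 0 < e / 4 / (1 + t^-1) by rewrite divr_gt0.
apply: filterS (small_in_prob_both hA Q_small e1 e2 dl0) => n [B [mB PB hB]].
exists B; split => // om /hB[]; rewrite lt_min => /andP[A1 A2].
rewrite ltr_pdivlMr // mulrC => hQ.
have tA : t * A n om <= e / 4.
  rewrite [leRHS](_ : _ = t * (V + 1)); last by rewrite /t divfK // gt_eqF.
  rewrite ler_pM2l // -lerBlDl; exact: (le_trans (ler_norm _) (ltW A1)).
have hV := variance_bound n om t0.
have hQ' : (1 + t^-1) * Q n om < e / 4.
  by apply: le_lt_trans hQ; rewrite ler_pM2l // ler_norm.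
have -> : cross_fitted_variance n om - V =
    (cross_fitted_variance n om - A n om) + (A n om - V) by rewrite addrA subrK.
apply: (le_lt_trans (ler_normD _ _)).
move: (`|_ - A n om|) hV (`|A n om - V|) A1 A2 => x hx y y1 y2; lra.
Qed.

End cross_fitted_mean.

Lemma powR_quarter_sqr (R : realType) n : (n%:R `^ (4^-1)) ^+ 2 = Num.sqrt n%:R :> R.
Proof.
rewrite -powR_mulrn ?powR_ge0 // -powRrM (_ : 4^-1 * 2 = 2^-1); last by field.
by rewrite powR12_sqrt.
Qed.

Lemma sqr_le_of_lt_sqrt (R : realType) (x u : R) :
  0 <= x -> x < Num.sqrt u -> x ^+ 2 <= u.
Proof.
move=> x0 xu; have u0 : 0 < u by rewrite -sqrtr_gt0 (le_lt_trans x0).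
by rewrite -(sqr_sqrtr (ltW u0)) lerXn2r ?nnegrE ?sqrtr_ge0 // ltW.
Qed.

Lemma abse_fine_le (R : realType) (x : \bar R) (c : R) :
  (`|x| <= c%:E)%E -> `|fine x| <= c.
Proof. by case: x => [r||] //=; rewrite lee_fin. Qed.

(** * Measurability of the learners' errors *)

Section learners.
Context {R : realType} {dW dX : measure_display}.
Context {TW : measurableType dW} {TX : measurableType dX}.
Context {F0 : probability TW R} {X : {RV F0 >-> TX}}.

Lemma measurable_learner_X n (lrn : n.-tuple TW -> TX -> R) :
  measurable_fun setT (fun p => lrn p.1 p.2) ->
  measurable_fun setT (fun p : n.-tuple TW * TW => lrn p.1 (X p.2)).
Proof.
move=> ml; apply: (@measurableT_comp _ _ _ _ _ _ (fun p => lrn p.1 p.2) _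
  (fun p : n.-tuple TW * TW => (p.1, X p.2))) => //.
apply: measurable_fun_pair => //.
by apply: measurableT_comp.
Qed.

Lemma measurable_l2norm_learner n (lrn : n.-tuple TW -> TX -> R) (g0 : TX -> R) :
  measurable_fun setT (fun p => lrn p.1 p.2) -> measurable_fun setT g0 ->
  measurable_fun setT (fun s => l2norm F0 ((lrn s \- g0) \o X)).
Proof.
move=> ml mg; have mlX := measurable_learner_X ml.
have msqrt : measurable_fun setT (@Num.sqrt R).
  by apply: continuous_measurable_fun; exact: sqrt_continuous.
rewrite /l2norm; under eq_fun do rewrite expectationE.
apply: (measurableT_comp msqrt); apply: (measurableT_comp (fine_measurable measurableT)).
apply: (@measurable_fun_fubini_tonelli_F _ _ _ _ _ F0
  (fun p : n.-tuple TW * TW => ((lrn p.1 (X p.2) - g0 (X p.2)) ^+ 2)%:E)).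
  apply/measurable_EFinP; apply: measurable_funX; apply: measurable_funB => //.
  by apply: (measurableT_comp mg); apply: measurableT_comp.
by move=> p; rewrite lee_fin sqr_ge0.
Qed.

End learners.

Theorem theorem3p3 (R : realType)
  (* observations: W ranges over TW with law F0; outcome Y, regressors X *)
  (dW dX : measure_display)
  (TW : measurableType dW) (TX : measurableType dX)
  (F0 : probability TW R) (Y : {RV F0 >-> R}) (X : {RV F0 >-> TX})
  (* Gamma, a closed linear subspace of L^2(X) *)
  (Gamma : set (TX -> R))
  (hGamma : closed_L2_subspace (distribution F0 X) Gamma)
  (* generalized residual, and its conditional mean given X *)
  (rho : TW -> (TX -> R) -> R)
  (rho_meas : forall g, Gamma g -> measurable_fun setT (rho ^~ g))
  (rhobar : (TX -> R) -> TX -> R)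
  (hrhobar : forall g, F0.-integrable setT (EFin \o rho ^~ g) ->
     is_condexp F0 X (rho ^~ g) (rhobar g))
  (* generalized regression *)
  (gamma0 : TX -> R) (gamma0_in : Gamma gamma0)
  (hgamma0 : forall b, Gamma b ->
     ('E_F0[fun w => (rho w gamma0 * b (X w))%R] = 0)%E)
  (* the linear functional m and its representer v_m *)
  (m : TW -> (TX -> R) -> R)
  (m_int : forall g, Gamma g -> F0.-integrable setT (EFin \o m ^~ g))
  (m_lin : forall (a : R) g h, Gamma g -> Gamma h ->
     {ae F0, forall w, m w (fun x => a * g x + h x) = a * m w g + m w h})
  (m_cont : forall g, Gamma g -> forall e : R, 0 < e ->
     exists2 d : R, 0 < d & forall h, Gamma h -> l2norm F0 ((h \- g) \o X) < d ->
       (`| 'E_F0[m ^~ h] - 'E_F0[m ^~ g] | < e%:E)%E)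
  (v_m : TX -> R) (v_m_L2 : v_m \in Lfun (distribution F0 X) 2%:E)
  (hv_m : forall g, Gamma g ->
     ('E_F0[m ^~ g] = 'E_F0[fun w => (v_m (X w) * g (X w))%R])%E)
  (* v_rho(X), the derivative at 0 of a |-> E[rho(W, gamma0 + a) | X] *)
  (v_rho : TX -> R) (v_rho_meas : measurable_fun setT v_rho)
  (rho_shift_int : \forall a \near (0 : R),
     F0.-integrable setT (EFin \o rho ^~ (fun x => gamma0 x + a)))
  (hv_rho : {ae F0, forall w,
     is_derive (0 : R) (1 : R)
       (fun a : R => rhobar (fun x => gamma0 x + a) (X w)) (v_rho (X w))})
  (v_rho_le0 : {ae F0, forall w, v_rho (X w) <= 0})
  (* alpha0 and Neyman orthogonality *)
  (theta0 : R) (htheta0 : ('E_F0[m ^~ gamma0] = theta0%:E)%E)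
  (alpha0 : TX -> R) (alpha0_in : Gamma alpha0)
  (alpha0_argmin : forall a, Gamma a ->
     ('E_F0[fun w => (- 2 * m w alpha0 - v_rho (X w) * alpha0 (X w) ^+ 2)%R]
      <= 'E_F0[fun w => (- 2 * m w a - v_rho (X w) * a (X w) ^+ 2)%R])%E)
  (neyman_derive : forall delta, Gamma delta ->
     is_derive (0 : R) (1 : R)
       (fun r : R => fine 'E_F0[psi X m rho theta0
                                  (fun x => gamma0 x + r * delta x) alpha0])
       (fine 'E_F0[fun w =>
          (v_m (X w) + alpha0 (X w) * v_rho (X w)) * delta (X w)]))
  (neyman_orth : forall delta, Gamma delta ->
     ('E_F0[fun w =>
        ((v_m (X w) + alpha0 (X w) * v_rho (X w)) * delta (X w))%R] = 0)%E)
  (* i.i.d. observations; observation i + 1 of the text is W i *)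
  (d : measure_display) (Omega : measurableType d) (P : probability Omega R)
  (W : nat -> {RV P >-> TW}) (hW : iid_copies F0 W)
  (* folds and cross-fitted learners *)
  (L : nat) (L_gt0 : (0 < L)%N)
  (fold : forall n, 'I_n -> 'I_L) (hfold : about_equal_folds R fold)
  (ghat ahat : forall n, 'I_L -> n.-tuple TW -> TX -> R)
  (ghat_in : forall n l s, Gamma (@ghat n l s))
  (ahat_in : forall n l s, Gamma (@ahat n l s))
  (ghat_cf : cross_fitted fold ghat) (ahat_cf : cross_fitted fold ahat)
  (ghat_meas : forall n l,
     measurable_fun setT (fun p : n.-tuple TW * TX => @ghat n l p.1 p.2))
  (ahat_meas : forall n l,
     measurable_fun setT (fun p : n.-tuple TW * TX => @ahat n l p.1 p.2))
  (m_ghat_meas : forall n l,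
     measurable_fun setT (fun p : n.-tuple TW * TW => m p.2 (@ghat n l p.1)))
  (rho_ghat_meas : forall n l,
     measurable_fun setT (fun p : n.-tuple TW * TW => rho p.2 (@ghat n l p.1))) :
  let dist_g l n (om : Omega) : R :=
    l2norm F0 ((@ghat n l (sample W n om) \- gamma0) \o X) in
  let dist_a l n (om : Omega) : R :=
    l2norm F0 ((@ahat n l (sample W n om) \- alpha0) \o X) in
  (* (1) *)
  (exists2 M : R, 0 < M & forall a, Gamma a ->
     ('E_F0[fun w => (m w a ^+ 2)%R] <= (M * l2norm F0 (a \o X) ^+ 2)%:E)%E) ->
  (* (2) *)
  (forall l : 'I_L, cvg_in_prob P (dist_g l) 0) ->
  (forall l : 'I_L, cvg_in_prob P (dist_a l) 0) ->
  (forall l : 'I_L,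
     cvg_in_prob P
       (fun n om => Num.sqrt n%:R * dist_g l n om * dist_a l n om) 0) ->
  (forall l : 'I_L, exists C : R, forall n,
     {ae P, forall om, ae_bounded F0 (@ahat n l (sample W n om) \o X) C}) ->
  (* (3) *)
  (exists C : R, ae_bounded F0 (alpha0 \o X) C) ->
  (exists2 g : TX -> R, is_condexp F0 X (fun w => rho w gamma0 ^+ 2) g &
     exists C : R, ae_bounded F0 (g \o X) C) ->
  ('E_F0[fun w => (m w gamma0 ^+ 2)%R] < +oo)%E ->
  (forall e : R, 0 < e -> exists2 eta : R, 0 < eta &
     forall g, Gamma g -> l2norm F0 ((g \- gamma0) \o X) < eta ->
       ('E_F0[fun w => ((rho w g - rho w gamma0) ^+ 2)%R] < e%:E)%E) ->
  (exists2 C : R, 0 < C & exists2 eta : R, 0 < eta &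
     forall g, Gamma g -> l2norm F0 ((g \- gamma0) \o X) < eta ->
       ('E_F0[fun w => ((rhobar g (X w) - rhobar gamma0 (X w)) ^+ 2)%R]
        <= (C * l2norm F0 ((g \- gamma0) \o X) ^+ 2)%:E)%E) ->
  (* (4) *)
  ((forall (t : R) g h, Gamma g -> Gamma h ->
      {ae F0, forall w, rho w (fun x => (1 - t) * g x + t * h x) =
                        (1 - t) * rho w g + t * rho w h}) \/
   ((forall l : 'I_L,
       cvg_in_prob P (fun n om => n%:R `^ (4^-1) * dist_g l n om) 0) /\
    (exists2 C : R, 0 < C & exists2 e : R, 0 < e &
       forall g, Gamma g -> l2norm F0 ((g \- gamma0) \o X) ^+ 2 <= e ->
         (`| 'E_F0[psi X m rho theta0 g alpha0] |
          <= (C * l2norm F0 ((g \- gamma0) \o X) ^+ 2)%:E)%E))) ->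
  let V : R := fine 'E_F0[fun w => psi X m rho theta0 gamma0 alpha0 w ^+ 2] in
  cvg_in_distr P
    (fun n om => Num.sqrt n%:R *
       (thetahat X m rho fold ghat ahat (sample W n om) - theta0))
    (centered_normal V) /\
  cvg_in_prob P
    (fun n om => Vhat X m rho fold ghat ahat (sample W n om)) V.
Proof.
move=> dist_g dist_a [M M0 hM] cg ca cga hahat [C0 hC0] [g2 cond2 [K0 hK0]] hm0
  hrho2 [C C_gt0 [eta eta0 hrb]] h4 V.
(* An almost sure bound on the conditional second moment, made nonnegative as the perturbation
   bounds require. *)
pose K := `|K0|.
have K_ge0 : 0 <= K by exact: normr_ge0.
have hK : ae_bounded F0 (g2 \o X) K.
  by apply: filterS hK0 => w /le_trans; apply; exact: ler_norm.
set psi0 := psi X m rho theta0 gamma0 alpha0.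
have spsi0 : sqr_int F0 psi0 :=
  psi0_sqr_int hGamma rho_meas gamma0_in m_int alpha0_in hC0 cond2 hm0.
have psi0_mean : \int[F0]_w psi0 w = 0 :=
  Rintegral_psi0 hGamma rho_meas gamma0_in hgamma0 m_int htheta0 alpha0_in hC0 cond2 hm0.
(* For this [D] it remains to supply the two inputs of the abstract limit theorems: a small second
   moment ([hq]) and a mean of order o_p(n^(-1/2)) ([hm]). *)
pose D n l s w := psi X m rho theta0 (@ghat n l s) (@ahat n l s) w - psi0 w.
have mD n l : measurable_fun setT (fun p : n.-tuple TW * TW => D n l p.1 p.2).
  apply: measurable_funB; last first.
    by apply: (measurableT_comp spsi0.1); exact: measurable_snd.
  apply: measurable_funD; first by apply: measurable_funB => //; exact: m_ghat_meas.
  by apply: measurable_funM; [exact: (measurable_learner_X (ahat_meas n l))|exact: rho_ghat_meas].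
have iD l n i : fold n i == l -> ignores i (D n l).
  move=> /eqP il s t st; have st' j : fold n j != l -> tnth s j = tnth t j.
    by move=> jl; apply: st; apply: contraNneq jl => ->; rewrite il.
  by apply/funext => w; rewrite /D (ghat_cf _ _ _ _ st') (ahat_cf _ _ _ _ st').
have mg l n : measurable_fun setT (dist_g l n).
  have h := measurable_l2norm_learner (X := X) (ghat_meas n l) (Gamma_measurable hGamma gamma0_in).
  exact: (measurableT_comp h (@measurable_sample _ _ _ _ _ P W n)).
have ma l n : measurable_fun setT (dist_a l n).
  have h := measurable_l2norm_learner (X := X) (ahat_meas n l) (Gamma_measurable hGamma alpha0_in).
  exact: (measurableT_comp h (@measurable_sample _ _ _ _ _ P W n)).
have sg l : small_in_prob P (dist_g l).
  have := (cvg_in_prob_small P 0 (mg l)).1 (cg l).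
  by apply: small_in_prob_le => n om; rewrite subr0.
have sa l : small_in_prob P (dist_a l).
  have := (cvg_in_prob_small P 0 (ma l)).1 (ca l).
  by apply: small_in_prob_le => n om; rewrite subr0.
have sga l : small_in_prob P (fun n om => Num.sqrt n%:R * dist_g l n om * dist_a l n om).
  have mga n : measurable_fun setT (fun om => Num.sqrt n%:R * dist_g l n om * dist_a l n om).
    by apply: measurable_funM => //; exact: measurable_funM.
  have := (cvg_in_prob_small P 0 mga).1 (cga l).
  by apply: small_in_prob_le => n om; rewrite subr0.
have dg0 l n om : 0 <= dist_g l n om by exact: sqrtr_ge0.
have da0 l n om : 0 <= dist_a l n om by exact: sqrtr_ge0.
have rho_sq gg u : Gamma gg ->
    ('E_F0[fun w => ((rho w gg - rho w gamma0) ^+ 2)%R] < u%:E)%E ->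
    sqr_int F0 (fun w => rho w gg - rho w gamma0).
  move=> Gg; rewrite expectationE => h; apply: sqr_int_lty.
    by apply: measurable_funB; exact: rho_meas.
  by rewrite (lt_trans h) // ltry.
have hq l (e dl : R) : 0 < e -> 0 < dl -> \forall n \near \oo,
    exists B, [/\ measurable B, (P B <= dl%:E)%E &
    forall om, ~ B om -> (\int[F0]_w (D n l (sample W n om) w ^+ 2)%:E <= e%:E)%E].
  move=> e0 dl0; have [Ca hCa] := hahat l.
  pose c := M + Ca ^+ 2 + K.
  have c0 : 0 < c by rewrite /c -addrA ltr_wpDr // addr_ge0 // sqr_ge0.
  (* Bounding the squared errors of both learners and the mean square error of [rho] by [u] makes
     the bound of [psi_diff_sqr_bound] equal to [e]. *)
  pose u := e / (3 * c).
  have u0 : 0 < u by rewrite divr_gt0 // mulr_gt0.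
  have su0 : 0 < Num.sqrt u by rewrite sqrtr_gt0.
  have [et et0 het] := hrho2 _ u0.
  have m0 : 0 < Num.min et (Num.sqrt u) by rewrite lt_min et0.
  apply: filterS (small_in_prob_both (sg l) (sa l) m0 su0 dl0) => n [B [mB PB hB]].
  (* The bound on the learner holds only for almost every sample; the exceptional null set joins the
     bad event. *)
  have [N [mN PN hN]] := hCa n.
  exists (B `|` N); split; first exact: measurableU.
    by apply: (le_trans (measureU2 _ mB mN)); rewrite [X in (_ + X)%E](PN : P N = 0%E) adde0.
  move=> om /not_orP[/hB[]]; rewrite !ger0_norm // lt_min => /andP[g1 g2'] a1 nN.
  have bnd : ae_bounded F0 (@ahat n l (sample W n om) \o X) Ca.
    by apply: contrapT => h; apply: nN; apply: hN.
  have hr := het _ (ghat_in n l _) g1.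
  have sr := rho_sq _ _ (ghat_in n l _) hr.
  rewrite expectationE in hr.
  have := psi_diff_sqr_bound hGamma rho_meas gamma0_in m_int m_lin alpha0_in hM cond2 hK
    (ghat_in n l _) (ahat_in n l _) sr bnd theta0 K_ge0 (ltW hr).
  move=> /le_trans; apply; rewrite lee_fin.
  have h1 := sqr_le_of_lt_sqrt (dg0 l n om) g2'.
  have h2 := sqr_le_of_lt_sqrt (da0 l n om) a1.
  rewrite [leRHS](_ : _ = 3 * (M * u + Ca ^+ 2 * u + K * u)); last first.
    by rewrite -!mulrDl -/c mulrA /u [RHS]mulrCA divff ?mulr1 // mulf_neq0 // gt_eqF.
  rewrite ler_pM2l //; apply: lerD; first by rewrite lerD2r ler_pM2l.
  by rewrite ler_wpM2l.
have small_mean l : small_in_prob P (fun n om =>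
    Num.sqrt n%:R * \int[F0]_w psi X m rho theta0 (@ghat n l (sample W n om)) alpha0 w).
  case: h4 => [rho_affine|[cg4 [C1 C1_gt0 [e1 e1_gt0 hpsi]]]].
    have psi_derive delta : Gamma delta -> is_derive (0 : R) (1 : R)
       (fun r : R => fine 'E_F0[psi X m rho theta0
                                  (fun x => gamma0 x + r * delta x) alpha0]) 0.
      by move=> Gd; have := neyman_derive _ Gd; rewrite (neyman_orth _ Gd).
    have [et et0 het] := hrho2 _ ltr01.
    (* The mean is exactly zero as soon as the learner is within [et] of [gamma0]; this closeness
       ensures that the increment of [rho] is square integrable. *)
    move=> e dl e0 dl0; apply: filterS (sg l _ _ et0 dl0) => n [B [mB PB hB]].
    exists B; split => // om /hB; rewrite ger0_norm // => g1.
    have sr := rho_sq _ _ (ghat_in n l _) (het _ (ghat_in n l _) g1).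
    have -> := affine_psi_mean0 hGamma rho_meas gamma0_in hgamma0 m_int m_lin htheta0
      alpha0_in hM hC0 cond2 hK hm0 rho_affine psi_derive K_ge0 (ghat_in n l _) sr.
    by rewrite mulr0 normr0.
  have m4 n : measurable_fun setT (fun om => n%:R `^ (4^-1) * dist_g l n om).
    exact: measurable_funM.
  have h := (cvg_in_prob_small P 0 m4).1 (cg4 l).
  (* Squaring n^(1/4) times the distance gives sqrt n times its square, the order of the quadratic
     bound on the mean score. *)
  have {}h := small_in_probZ C1 (small_in_probM h h).
  have se0 : 0 < Num.sqrt e1 by rewrite sqrtr_gt0.
  move=> e dl e0 dl0; apply: filterS (small_in_prob_both h (sg l) e0 se0 dl0).
  move=> n [B [mB PB hB]]; exists B; split => // om /hB[].
  rewrite subr0 -expr2 exprMn powR_quarter_sqr => h1; rewrite ger0_norm // => h2.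
  have d2 : l2norm F0 ((@ghat n l (sample W n om) \- gamma0) \o X) ^+ 2 <= e1.
    exact: sqr_le_of_lt_sqrt (dg0 l n om) h2.
  have := abse_fine_le (hpsi _ (ghat_in n l _) d2); rewrite expectationE => h3.
  apply: le_lt_trans h1; rewrite normrM ger0_norm ?sqrtr_ge0 //.
  rewrite [leRHS]ger0_norm; last first.
    apply: mulr_ge0; first exact: ltW.
    by apply: mulr_ge0; [exact: sqrtr_ge0|exact: sqr_ge0].
  by rewrite mulrCA ler_wpM2l ?sqrtr_ge0.
have hm l (e dl : R) : 0 < e -> 0 < dl -> \forall n \near \oo,
    exists B, [/\ measurable B, (P B <= dl%:E)%E &
    forall om, ~ B om -> Num.sqrt n%:R * `|\int[F0]_w D n l (sample W n om) w| < e].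
  move=> e0 dl0; have [et et0 het] := hrho2 _ ltr01.
  (* Within [et] of [gamma0] the increment of [rho] is square integrable; within [eta] the bound on
     the increment of [rhobar] holds. *)
  have m0 : 0 < Num.min et eta by rewrite lt_min et0.
  have e2 : 0 < e / 2 by rewrite divr_gt0.
  have dl2 : 0 < dl / 2 by rewrite divr_gt0.
  have h := small_in_prob_both (small_mean l) (small_in_probZ (Num.sqrt C) (sga l)) e2 e2 dl2.
  move: h (sg l _ _ m0 dl2); apply: filterS2 => n [B1 [mB1 PB1 hB1]] [B2 [mB2 PB2 hB2]].
  exists (B1 `|` B2); split; first exact: measurableU.
    apply: (le_trans (measureU2 _ mB1 mB2)).
    by rewrite [dl]splitr EFinD; exact: leeD.
  move=> om /not_orP[/hB1[h1 h2] /hB2]; rewrite (ger0_norm (dg0 l n om)) lt_min => /andP[g1 g3].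
  have sr := rho_sq _ _ (ghat_in n l _) (het _ (ghat_in n l _) g1).
  have := psi_diff_mean_bound hGamma rho_meas gamma0_in hgamma0 m_int m_lin htheta0
    alpha0_in hM hC0 cond2 hK hm0 (ghat_in n l _) (ahat_in n l (sample W n om)) sr hrhobar
    (hrb _ (ghat_in n l _) g3) K_ge0 (ltW C_gt0).
  move=> /(ler_wpM2l (sqrtr_ge0 n%:R)) /le_lt_trans; apply.
  rewrite mulrDr [e]splitr; apply: ltrD.
    by move: h1; rewrite normrM ger0_norm ?sqrtr_ge0.
  move: h2; rewrite ger0_norm; last by rewrite !mulr_ge0 ?sqrtr_ge0.
  by apply: le_lt_trans; rewrite -/(dist_g l n om) -/(dist_a l n om); lra.
have VE : V = fine (\int[F0]_w (psi0 w ^+ 2)%:E) by rewrite /V expectationE.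
(* For n = 0 the left side is [- theta0] and the right side is 0. The factor sqrt n removes this
   discrepancy in the limit law, and the variance estimators both vanish at n = 0. *)
have meanE n om : n != 0%N ->
    thetahat X m rho fold ghat ahat (sample W n om) - theta0 =
    cross_fitted_mean (W := W) (fold := fold) (D := D) (xi := psi0) n om.
  move=> n0; have nn0 : n%:R != 0 :> R by rewrite pnatr_eq0.
  rewrite /thetahat /cross_fitted_mean.
  have -> : theta0 = n%:R^-1 * \sum_(l < L) \sum_(i < n | fold n i == l) theta0.
    by rewrite (sum_by_fibre (fold n) (fun=> theta0)) sumr_const card_ord
      -[theta0 *+ n]mulr_natl mulKf.
  rewrite -mulrBr -sumrB; congr (_ * _); apply: eq_bigr => l _.
  rewrite -sumrB; apply: eq_bigr => i _.
  by rewrite tnth_mktuple /D /psi; ring.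
split.
- have -> : (fun n om => Num.sqrt n%:R *
      (thetahat X m rho fold ghat ahat (sample W n om) - theta0)) =
      (fun n om => Num.sqrt n%:R *
        cross_fitted_mean (W := W) (fold := fold) (D := D) (xi := psi0) n om).
    apply/funext => -[|n]; apply/funext => om; first by rewrite sqrtr0 !mul0r.
    by rewrite meanE.
  by rewrite VE; exact: (cross_fitted_clt hW mD iD hq hm spsi0 psi0_mean).
- have -> : (fun n om => Vhat X m rho fold ghat ahat (sample W n om)) =
      cross_fitted_variance (W := W) (fold := fold) (D := D) (xi := psi0).
    apply/funext => n; apply/funext => om; have [n0|n0] := eqVneq n 0%N.
      by subst n; rewrite /Vhat /cross_fitted_variance invr0 !mul0r.
    rewrite /Vhat /cross_fitted_variance -(meanE _ _ n0); congr (_ * _).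
    apply: eq_bigr => l _; apply: eq_bigr => i _.
    by rewrite tnth_mktuple /D /psi; congr (_ ^+ 2); ring.
  by rewrite VE; exact: (cross_fitted_variance_cvg hW mD iD hq hm spsi0 psi0_mean).
Qed.
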